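(* If $\mathfrak g$ is the simple complex Lie algebra of type $D_n$ with $n$ odd, then the center $Z(U_q(\mathfrak g))$ of the quantized enveloping algebra $U_q(\mathfrak g)$ is isomorphic, as a $\mathbb C(q)$-algebra, to $\mathbb C(q)[t_1,t_2,\dots,t_{n+1}]/(t_{n-1}t_n-t_{n+1}^2)$.
   Context: Type $D_n$ is taken with $n\ge 4$ as usual (so here $n\ge5$ is odd). For $\mathfrak g$ with Cartan matrix $A=(a_{ij})_{n\times n}$, simple roots $\alpha_i$ and invariant form $(\cdot,\cdot)$ with $a_{ij}=2(\alpha_i,\alpha_j)/(\alpha_i,\alpha_i)$, let $q$ be an indeterminate and $q_i=q^{(\alpha_i,\alpha_i)/2}$. $U_q(\mathfrak g)$ is the associative $\mathbb C(q)$-algebra generated by $E_i,F_i,K_i,K_i^{-1}$ ($1\le i\le n$) subject to $K_iK_j=K_jK_i$, $K_iK_i^{-1}=K_i^{-1}K_i=1$, $K_iE_jK_i^{-1}=q^{a_{ij}}E_j$, $K_iF_jK_i^{-1}=q^{-a_{ij}}F_j$, $E_iF_j-F_jE_i=\delta_{ij}\frac{K_i-K_i^{-1}}{q-q^{-1}}$, and for $i\neq j$ the quantum Serre relations $\sum_{s=0}^{1-a_{ij}}(-1)^s\begin{bmatrix}1-a_{ij}\\ s\end{bmatrix}_{q_i}E_i^{1-a_{ij}-s}E_jE_i^s=0$ and the same with $F$ in place of $E$. $Z(U_q(\mathfrak g))$ is its center; $t_1,\dots,t_{n+1}$ are independent indeterminates. *)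

(* Defs.v *)
From mathcomp Require Import all_boot all_algebra.
From mathcomp Require Import complex.
From mathcomp Require Import Rstruct.
From mathcomp Require Import mpoly.

Set Implicit Arguments.
Unset Strict Implicit.
Unset Printing Implicit Defensive.

Import GRing.Theory.
Local Open Scope ring_scope.

Definition CC : fieldType := (Rdefinitions.R)[i].

Definition Cq : fieldType := {fraction {poly CC}}.

Definition qq : Cq := tofrac ('X : {poly CC}).

(* Cartan matrix of type D_n, nodes 0..n-1 (= 1..n of the paper):
   0 - 1 - ... - (n-3) - (n-2), and (n-1) attached to (n-3). *)
Definition D_adj (n : nat) (i j : 'I_n) : bool :=
  [|| [&& (i < n.-1)%N, (j < n.-1)%N & ((i.+1 == j) || (j.+1 == i))%N],
      ((i == n.-1 :> nat) && (j == (n - 3)%N :> nat))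
    | ((j == n.-1 :> nat) && (i == (n - 3)%N :> nat))].

Definition cartanD (n : nat) (i j : 'I_n) : int :=
  if i == j then 2 else if D_adj i j then -1 else 0.

Definition qint (F : fieldType) (x : F) (k : nat) : F :=
  (x ^ (k%:Z) - x ^ (- (k%:Z))) / (x - x^-1).
Definition qfact (F : fieldType) (x : F) (k : nat) : F :=
  \prod_(1 <= l < k.+1) qint x l.
Definition qbinom (F : fieldType) (x : F) (m s : nat) : F :=
  qfact x m / (qfact x s * qfact x (m - s)).

(* Defining relations of U_q(g) for Cartan matrix a, with
   (alpha_i,alpha_i)/2 = d i, so q_i = q ^+ d i. *)
Definition Uq_rels (F : fieldType) (n : nat) (a : 'I_n -> 'I_n -> int)
    (d : 'I_n -> nat) (q : F) (A : algType F) (E Fg K Kinv : 'I_n -> A) : Prop :=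
  (forall i j, K i * K j = K j * K i) /\
  (forall i, K i * Kinv i = 1 /\ Kinv i * K i = 1) /\
  (forall i j, K i * E j * Kinv i = q ^ (a i j) *: E j) /\
  (forall i j, K i * Fg j * Kinv i = q ^ (- a i j) *: Fg j) /\
  (forall i j, E i * Fg j - Fg j * E i =
               if i == j then (q - q^-1)^-1 *: (K i - Kinv i) else 0) /\
      (forall i j, i != j ->
         let m := absz (1 - a i j) in
         \sum_(s < m.+1) ((-1) ^+ s * qbinom (q ^+ d i) m s)
             *: (E i ^+ (m - s) * E j * E i ^+ s) = 0) /\
      (forall i j, i != j ->
         let m := absz (1 - a i j) in
         \sum_(s < m.+1) ((-1) ^+ s * qbinom (q ^+ d i) m s)
             *: (Fg i ^+ (m - s) * Fg j * Fg i ^+ s) = 0).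

(* A (with the elements E,F,K,K^-1) is U_q(g): the F-algebra presented by the
   generators and relations above, i.e. the universal algebra for them. *)
Definition is_Uq (F : fieldType) (n : nat) (a : 'I_n -> 'I_n -> int)
    (d : 'I_n -> nat) (q : F) (A : algType F) (E Fg K Kinv : 'I_n -> A) : Prop :=
  Uq_rels a d q E Fg K Kinv /\
  forall (B : algType F) (E' Fg' K' Kinv' : 'I_n -> B),
    Uq_rels a d q E' Fg' K' Kinv' ->
    (exists f : {lrmorphism A -> B},
        forall i, [/\ f (E i) = E' i, f (Fg i) = Fg' i,
                      f (K i) = K' i & f (Kinv i) = Kinv' i]) /\
    (forall f g : {lrmorphism A -> B},
        (forall i, [/\ f (E i) = g (E i), f (Fg i) = g (Fg i),
                      f (K i) = g (K i) & f (Kinv i) = g (Kinv i)]) ->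
        forall x, f x = g x).

Definition central (R : nzRingType) (z : R) : Prop := forall x : R, z * x = x * z.

(* The polynomial t_{n-1} t_n - t_{n+1}^2 in C(q)[t_1..t_{n+1}]
   (variables indexed 0..n, so t_k is 'X_(k-1)). *)
Definition relD (n : nat) : {mpoly Cq[n.+1]} :=
  'X_(inord (n - 2)%N) * 'X_(inord n.-1) - 'X_(inord n) ^+ 2.

(* Main.v *)
(* U_q acts on the dual Verma modules, realised as the functions of words in the
   simple roots that satisfy the Serre relations: E_i deletes the first letter,
   and F_i acts through q-shuffle skew derivations.  These modules separate the
   elements of U_q, so a central z is determined by the scalars chi_lam(z), and a
   z commuting with all E_i, K_i is already central.  Evaluating at a weight shifted
   by rho turns z into a Laurent polynomial on Z^n that is invariant under the Weyl
   group and, for n odd, involves only the characters q^(2<t,mu>) with mu in Z^n.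

   Conversely, a finite-dimensional representation R gives a central element, the
   quantum trace of the product of the two L-operators of R, with value the shifted
   character of R at q^2.  The L-operators are written down directly: their entries
   are the elements of the two halves of U_q whose pairing with a word is the
   matrix coefficient of R at that word, and they exist because the pairing of the
   halves is nondegenerate.  Applied to the simple modules L(lam), lam in Z^n
   dominant, this makes the map from the center to the invariants bijective.

   The invariants are generated by functions of highest weights omega_1, ...,
   omega_{n-2} together with chi_-^2, chi_+^2 and chi_+ chi_-, where chi_+ and
   chi_- are the half-spin characters; the highest weights of the monomials of
   degree at most 1 in the last generator are exactly the dominant weights in Z^n,
   each reached once, so the relation between the last three is the only one. *)

From HB Require Import structures.
Require Import Defs.
From mathcomp Require Import all_boot all_order all_algebra.
From mathcomp Require Import complex Rstruct mpoly.
From mathcomp Require Import ring zify boolp.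
Set Implicit Arguments.
Unset Strict Implicit.
Unset Printing Implicit Defensive.
Import GRing.Theory Num.Theory Order.TTheory.
Local Open Scope ring_scope.

(** * Linear endomorphisms and subalgebras *)

(** [U_q] is known only through its universal property, so every fact about its elements has to come
    from morphisms into algebras built by hand. No basis of Poincare-Birkhoff-Witt type is at hand:
    the triangular decomposition is a spanning statement, and independence comes from the action on
    Serre functions with values in [A] itself. The same device defines the skew derivations: acting
    on a suitable [A]-valued function extends a rule on words to a linear map on [A]. Nondegeneracy
    of the pairing rests on rank one theory: a nonzero weight vector killed by all skew derivations
    has a weight pairing nonpositively with every simple root, and positive definiteness leaves only
    the weight zero. The universal R-matrix lives in a completion. In a bounded representation only
    finitely many words matter, so the two L-operators become solutions of finite linear systems.
    The parity of [n] enters once. Comparing the highest weights [q^m] and [-q^m] at a node shows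
    that the weights of a central element have even labels; for odd [n] a root lattice vector with
    even labels is twice a vector of [Z^n]. *)

Section LinearReflection.
Variables (F : fieldType) (V : lmodType F).

Inductive lterm :=
  LV of nat | LA of lterm & lterm | LN of lterm | LZ of F & lterm | L0.
Fixpoint leval (env : seq V) t : V :=
  match t with
  | LV i => nth 0 env i
  | LA s t => leval env s + leval env t
  | LN t => - leval env t
  | LZ c t => c *: leval env t
  | L0 => 0
  end.
Fixpoint lcoef (i : nat) t : F :=
  match t with
  | LV j => if eqn i j then 1 else 0
  | LA s t => lcoef i s + lcoef i t
  | LN t => - lcoef i t
  | LZ c t => c * lcoef i t
  | L0 => 0
  end.
Fixpoint lcoefs_eq k s t :=
  if k is k'.+1 then lcoef k' s = lcoef k' t /\ lcoefs_eq k' s t else True.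

Lemma levalE env t : leval env t = \sum_(i < size env) lcoef i t *: nth 0 env i.
Proof.
elim: t => [j|s IHs t IHt|t IHt|c t IHt|] /=.
- have eqE i : eqn i j = (i == j) by [].
  case: (ltnP j (size env)) => [hj|hj].
    rewrite (bigD1 (Ordinal hj)) //= eqE eqxx scale1r big1 ?addr0 // => i.
    by rewrite -val_eqE /= eqE => /negbTE ->; rewrite scale0r.
  rewrite nth_default // big1 // => i _; rewrite eqE ltn_eqF ?scale0r //.
  exact: leq_trans (ltn_ord i) hj.
- by rewrite IHs IHt -big_split; apply: eq_bigr => i _; rewrite scalerDl.
- by rewrite IHt -sumrN; apply: eq_bigr => i _; rewrite scaleNr.
- by rewrite IHt scaler_sumr; apply: eq_bigr => i _; rewrite scalerA.
- by rewrite big1 // => i _; rewrite scale0r.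
Qed.

Lemma leval_eq env s t :
  lcoefs_eq (size env) s t -> leval env s = leval env t.
Proof.
rewrite !levalE => h; apply: eq_bigr => i _; congr (_ *: _).
elim: (size env) i h => [|k IH] i; first by case: i.
case=> h1 h2; case: (unliftP ord_max i) => [j ->|-> //]; rewrite lift_max; exact: IH.
Qed.
End LinearReflection.

Ltac lin_mem x l :=
  lazymatch l with
  | nil => constr:(false)
  | ?y :: ?l' =>
    match goal with
    | _ => let _ := match goal with _ => unify x y end in constr:(true)
    | _ => lin_mem x l'
    end
  end.
Ltac lin_idx x l :=
  lazymatch l with
  | ?y :: ?l' =>
    match goal with
    | _ => let _ := match goal with _ => unify x y end in constr:(O)
    | _ => let k := lin_idx x l' in constr:(S k)
    end
  end.
Ltac lin_atoms t l :=
  lazymatch t with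
  | @GRing.add _ ?s ?t' => let l1 := lin_atoms s l in lin_atoms t' l1
  | @GRing.opp _ ?s => lin_atoms s l
  | @GRing.scale _ _ _ ?s => lin_atoms s l
  | @GRing.zero _ => l
  | _ => let b := lin_mem t l in
         lazymatch b with true => l | false => constr:(t :: l) end
  end.
Ltac lin_reify F t l :=
  lazymatch t with
  | @GRing.add _ ?s ?t' =>
      let x := lin_reify F s l in let y := lin_reify F t' l in
      constr:(@LA F x y)
  | @GRing.opp _ ?s => let x := lin_reify F s l in constr:(@LN F x)
  | @GRing.scale _ _ ?c ?s => let x := lin_reify F s l in constr:(@LZ F c x)
  | @GRing.zero _ => constr:(@L0 F)
  | _ => let k := lin_idx t l in constr:(@LV F k)
  end.
(* Reduces an equality of linear combinations in an [F]-module to the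
   equalities of the coefficients of the atoms. *)
Ltac lin_eq F V :=
  match goal with
  | |- ?s = ?t =>
    let l1 := lin_atoms s constr:(@nil V) in
    let l := lin_atoms t l1 in
    let x := lin_reify F s l in
    let y := lin_reify F t l in
    apply: (@leval_eq F V l x y); cbv [lcoefs_eq lcoef eqn size];
    repeat split
  end.

Section Endo.
Variables (F : fieldType) (W : lmodType F).

(* The nontriviality witness [hW] is carried by the type because algebras are
   required to satisfy [1 != 0]. *)
Record endo (hW : exists x : W, x <> 0) :=
  Endo { efun :> W -> W; efun_lin : linear efun }.

Variable hW : exists x : W, x <> 0.
Notation B := (endo hW).

Lemma endo_ext (f g : B) : (forall x, f x = g x) -> f = g.
Proof.
case: f g => f hf [g hg] /= /funext fg.
by case: _ / fg hg => hg; congr Endo; apply: Prop_irrelevance.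
Qed.

HB.instance Definition _ := gen_eqMixin B.
HB.instance Definition _ := gen_choiceMixin B.

Lemma endoD (f : B) x y : f (x + y) = f x + f y.
Proof. by have := efun_lin f 1 x y; rewrite !scale1r. Qed.
Lemma endo0 (f : B) : f 0 = 0.
Proof. by apply: (@addrI _ (f 0)); rewrite -endoD !addr0. Qed.
Lemma endoZ (f : B) c x : f (c *: x) = c *: f x.
Proof. by have := efun_lin f c x 0; rewrite endo0 !addr0. Qed.

Definition endo_add (f g : B) : B.
Proof.
by exists (fun x => f x + g x) => c x y; rewrite !endoD !endoZ scalerDr addrACA.
Defined.
Definition endo_zero : B.
Proof. by exists (fun _ => 0) => c x y; rewrite scaler0 addr0. Defined.
Definition endo_opp (f : B) : B.
Proof.
by exists (fun x => - f x) => c x y; rewrite endoD endoZ opprD scalerN.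
Defined.
Definition endo_scale (c : F) (f : B) : B.
Proof.
exists (fun x => c *: f x) => k x y.
by rewrite endoD endoZ scalerDr !scalerA mulrC.
Defined.
Definition endo_one : B.
Proof. by exists id. Defined.
Definition endo_mul (f g : B) : B.
Proof. by exists (f \o g) => c x y /=; rewrite !(endoD, endoZ). Defined.

Fact endo_addA : associative endo_add.
Proof. by move=> f g h; apply: endo_ext => x /=; rewrite addrA. Qed.
Fact endo_addC : commutative endo_add.
Proof. by move=> f g; apply: endo_ext => x /=; rewrite addrC. Qed.
Fact endo_add0 : left_id endo_zero endo_add.
Proof. by move=> f; apply: endo_ext => x /=; rewrite add0r. Qed.
Fact endo_addN : left_inverse endo_zero endo_opp endo_add.
Proof. by move=> f; apply: endo_ext => x /=; rewrite addNr. Qed.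
HB.instance Definition _ :=
  GRing.isZmodule.Build B endo_addA endo_addC endo_add0 endo_addN.

Fact endo_mulA : associative endo_mul.
Proof. by move=> f g h; apply: endo_ext. Qed.
Fact endo_mul1 : left_id endo_one endo_mul.
Proof. by move=> f; apply: endo_ext. Qed.
Fact endo_1mul : right_id endo_one endo_mul.
Proof. by move=> f; apply: endo_ext. Qed.
Fact endo_mulDl : left_distributive endo_mul +%R.
Proof. by move=> f g h; apply: endo_ext. Qed.
Fact endo_mulDr : right_distributive endo_mul +%R.
Proof. by move=> f g h; apply: endo_ext => x /=; rewrite endoD. Qed.
Fact endo_nz : endo_one != 0.
Proof.
apply/eqP => e; case: (hW) => x; apply.
exact: (congr1 (fun f : B => f x) e).
Qed.
HB.instance Definition _ := GRing.Zmodule_isNzRing.Build B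
  endo_mulA endo_mul1 endo_1mul endo_mulDl endo_mulDr endo_nz.

Fact endo_scaleA (c d : F) (f : B) :
  endo_scale c (endo_scale d f) = endo_scale (c * d) f.
Proof. by apply: endo_ext => x /=; rewrite scalerA. Qed.
Fact endo_scale1 : left_id 1 endo_scale.
Proof. by move=> f; apply: endo_ext => x /=; rewrite scale1r. Qed.
Fact endo_scaleDr : right_distributive endo_scale +%R.
Proof. by move=> c f g; apply: endo_ext => x /=; rewrite scalerDr. Qed.
Fact endo_scaleDl (f : B) : {morph endo_scale^~ f : c d / c + d}.
Proof. by move=> c d; apply: endo_ext => x /=; rewrite scalerDl. Qed.
HB.instance Definition _ := GRing.Zmodule_isLmodule.Build F B
  endo_scaleA endo_scale1 endo_scaleDr endo_scaleDl.

Fact endo_scalerAl (c : F) (f g : B) : c *: (f * g) = (c *: f) * g.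
Proof. exact: endo_ext. Qed.
HB.instance Definition _ := GRing.Lmodule_isLalgebra.Build F B endo_scalerAl.
Fact endo_scalerAr (c : F) (f g : B) : c *: (f * g) = f * (c *: g).
Proof. by apply: endo_ext => x /=; rewrite endoZ. Qed.
HB.instance Definition _ := GRing.Lalgebra_isAlgebra.Build F B endo_scalerAr.

Lemma endoME (f g : B) x : (f * g) x = f (g x). Proof. by []. Qed.
Lemma endo0E x : (0 : B) x = 0. Proof. by []. Qed.
Lemma endoDE (f g : B) x : (f + g) x = f x + g x. Proof. by []. Qed.
Lemma endoNE (f : B) x : (- f) x = - f x. Proof. by []. Qed.
Lemma endoZE c (f : B) x : (c *: f) x = c *: f x. Proof. by []. Qed.
End Endo.

Section Subalgebra.
Variables (F : fieldType) (A : algType F).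
Record salg := Salg { sa_mem : A -> Prop; sa_1 : sa_mem 1;
  sa_lin : forall c x y, sa_mem x -> sa_mem y -> sa_mem (c *: x + y);
  sa_mul : forall x y, sa_mem x -> sa_mem y -> sa_mem (x * y) }.
Definition sa_pred (S : salg) : {pred A} := fun x => `[< sa_mem S x >].
Variable S : salg.
Fact sa_closed : subalg_closed (sa_pred S).
Proof.
split; first by apply/asboolP/sa_1.
- by move=> c x y /asboolP hx /asboolP hy; apply/asboolP/sa_lin.
- by move=> x y /asboolP hx /asboolP hy; apply/asboolP/sa_mul.
Qed.
HB.instance Definition _ :=
  GRing.isSubalgClosed.Build F A (sa_pred S) (GRing.subalg_closed_semi sa_closed).
Definition sa_type := {x : A | sa_pred S x}.
HB.instance Definition _ := SubChoice.on sa_type.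
HB.instance Definition _ :=
  GRing.SubChoice_isSubAlgebra.Build F A (sa_pred S) sa_type sa_closed.
Definition sa_val (x : sa_type) : A := val x.
Fact sa_val_lin : linear sa_val.
Proof. by []. Qed.
HB.instance Definition _ := GRing.isLinear.Build F sa_type A *:%R sa_val sa_val_lin.
Fact sa_val_mul : multiplicative sa_val.
Proof. by []. Qed.
HB.instance Definition _ := GRing.isMultiplicative.Build sa_type A sa_val sa_val_mul.
End Subalgebra.

(** * The presentation *)

Section Presentation.
Variables (F : fieldType) (n : nat) (a : 'I_n -> 'I_n -> int) (q : F).

Definition serre (B : algType F) (X : 'I_n -> B) := forall i j, i != j ->
  (a i j = 0 -> X i * X j = X j * X i) /\
  (a i j = -1 -> X i * X i * X j - (q + q^-1) *: (X i * X j * X i)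
                 + X j * X i * X i = 0).

(** These relations are kept apart from the Serre relations: on Serre functions the Serre relations
    for [Gend] are deduced from them. *)
Record urel0 (B : algType F) (E G K L : 'I_n -> B) : Prop := Urel0 {
  uKL : forall i, K i * L i = 1;
  uLK : forall i, L i * K i = 1;
  uKK : forall i j, K i * K j = K j * K i;
  uKE : forall i j, K i * E j = q ^ a i j *: (E j * K i);
  uKG : forall i j, K i * G j = q ^ (- a i j) *: (G j * K i);
  uEG : forall i j, E i * G j - G j * E i =
          if i == j then (q - q^-1)^-1 *: (K i - L i) else 0 }.

Definition urel (B : algType F) (E G K L : 'I_n -> B) :=
  [/\ urel0 E G K L, serre E & serre G].

Definition isU (A : algType F) (E G K L : 'I_n -> A) :=
  urel E G K L /\ forall (B : algType F) (E' G' K' L' : 'I_n -> B),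
    urel E' G' K' L' ->
    (exists f : {lrmorphism A -> B}, forall i,
        [/\ f (E i) = E' i, f (G i) = G' i, f (K i) = K' i & f (L i) = L' i]) /\
    (forall f g : {lrmorphism A -> B},
        (forall i, [/\ f (E i) = g (E i), f (G i) = g (G i),
                       f (K i) = g (K i) & f (L i) = g (L i)]) ->
        forall x, f x = g x).

Hypothesis q0 : q != 0.

Section Basic.
Variables (B : algType F) (E G K L : 'I_n -> B) (U : urel0 E G K L).

Lemma uLX (X : 'I_n -> B) i j c :
  c != 0 -> K i * X j = c *: (X j * K i) -> L i * X j = c^-1 *: (X j * L i).
Proof.
move=> c0 h; rewrite -[L i * X j]mulr1 -(uKL U i) mulrA -[L i * X j * K i]mulrA.
have -> : X j * K i = c^-1 *: (K i * X j) by rewrite h scalerA mulVf // scale1r.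
by rewrite -scalerAr !mulrA (uLK U) mul1r scalerAl.
Qed.
Lemma uLE i j : L i * E j = q ^ (- a i j) *: (E j * L i).
Proof. by rewrite -invr_expz; apply: uLX (uKE U i j); rewrite expfz_neq0. Qed.
Lemma uLG i j : L i * G j = q ^ a i j *: (G j * L i).
Proof.
by rewrite -[a i j]opprK -invr_expz; apply: uLX (uKG U i j); rewrite expfz_neq0.
Qed.
Lemma uKL_comm i j : K i * L j = L j * K i.
Proof.
rewrite -[K i * L j]mul1r -(uLK U j) -mulrA [K j * _]mulrA -(uKK U).
by rewrite -[K i * K j * _]mulrA (uKL U) mulr1.
Qed.
Lemma uLL i j : L i * L j = L j * L i.
Proof.
rewrite -[L i * L j]mul1r -(uLK U j) -mulrA [K j * _]mulrA uKL_comm.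
by rewrite -[L i * K j * _]mulrA (uKL U) mulr1.
Qed.

Lemma urel0_swap : urel0 G E L K.
Proof.
split.
- exact: uLK U.
- exact: uKL U.
- exact: uLL.
- exact: uLG.
- exact: uLE.
- move=> i j; rewrite -opprB (uEG U) eq_sym.
  by case: eqP => [->|_]; rewrite ?oppr0 // -scalerN opprB.
Qed.

Let D k (x : B) := E k * x - x * E k.
Let DM k x y : D k (x * y) = D k x * y + x * D k y.
Proof. by rewrite /D mulrBl mulrBr !mulrA addrA subrK. Qed.

Hypothesis asym : forall i j, a i j = a j i.
Hypothesis a2 : forall i, a i i = 2.

(** [D k] is a derivation that kills [G l] unless [l] is [k]. For [k] equal to [i] or [j] the Cartan
    elements are moved to the right, and the coefficient of each resulting monomial vanishes. *)
Lemma serre_comm i j k : i != j -> a i j = -1 ->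
  let S := G i * G i * G j - (q + q^-1) *: (G i * G j * G i) + G j * G i * G i in
  E k * S = S * E k.
Proof.
move=> ij aij S; apply/eqP; rewrite -subr_eq0; apply/eqP.
have aji : a j i = -1 by rewrite asym.
pose H := (q - q^-1)^-1.
have DZ c x : D k (c *: x) = c *: D k x.
  by rewrite /D -scalerAr -scalerAl -scalerBr.
have DD x y : D k (x + y) = D k x + D k y.
  by rewrite /D mulrDr mulrDl opprD addrACA.
have DN x : D k (- x) = - D k x by rewrite -scaleN1r DZ scaleN1r.
rewrite -/(D k S) /S !(DD, DN, DZ, DM).
have Dg l : D k (G l) = if k == l then H *: (K k - L k) else 0 by exact: uEG.
rewrite !Dg.
have KLx l (x y : B) c d : K l * y = c *: (y * K l) -> L l * y = d *: (y * L l) ->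
    x * (H *: (K l - L l)) * y = H *: (c *: (x * y * K l) - d *: (x * y * L l)).
  move=> h1 h2; rewrite -scalerAr -scalerAl -[x * _ * y]mulrA [(_ - _) * y]mulrBl.
  by rewrite h1 h2 mulrBr -!scalerAr !mulrA.
have KLy l (y : B) c d : K l * y = c *: (y * K l) -> L l * y = d *: (y * L l) ->
    H *: (K l - L l) * y = H *: (c *: (y * K l) - d *: (y * L l)).
  by move=> h1 h2; have := KLx l 1 y c d h1 h2; rewrite !mul1r.
have KM (M : B) x y c d : M * x = c *: (x * M) -> M * y = d *: (y * M) ->
    M * (x * y) = (c * d) *: (x * y * M).
  move=> h1 h2; rewrite mulrA h1 -scalerAl -[x * M * y]mulrA h2 -scalerAr scalerA mulrA.
  done.
case: (eqVneq k i) => [->|ki]; first rewrite (negbTE ij).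
  have e3 : K i * G j = q *: (G j * K i) by rewrite (uKG U) aij opprK expr1z.
  have e4 : L i * G j = q^-1 *: (G j * L i) by rewrite uLG aij exprN1.
  have e5 : K i * G i = q^-1 ^+ 2 *: (G i * K i).
    by rewrite (uKG U) a2 -invr_expz exprVn.
  have e6 : L i * G i = q ^+ 2 *: (G i * L i) by rewrite uLG a2.
  rewrite !(mul0r, mulr0, addr0, add0r).
  rewrite !mulrDl -[H *: _ * G i * G j]mulrA -[H *: _ * G j * G i]mulrA.
  rewrite (KLy _ _ _ _ (KM _ _ _ _ _ e5 e3) (KM _ _ _ _ _ e6 e4)).
  rewrite (KLy _ _ _ _ (KM _ _ _ _ _ e3 e5) (KM _ _ _ _ _ e4 e6)).
  rewrite (KLx _ _ _ _ _ e3 e4) (KLx _ _ _ _ _ e5 e6).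
  rewrite -!scalerAr !mulrBr.
  by lin_eq F B; field.
case: (eqVneq k j) => [->|kj]; last first.
  by rewrite !(mul0r, mulr0, addr0, scaler0, subr0).
have e3 : K j * G i = q *: (G i * K j) by rewrite (uKG U) aji opprK expr1z.
have e4 : L j * G i = q^-1 *: (G i * L j) by rewrite uLG aji exprN1.
rewrite !(mul0r, mulr0, addr0, add0r).
rewrite -[_ * G i * G i]mulrA.
rewrite (KLy _ _ _ _ (KM _ _ _ _ _ e3 e3) (KM _ _ _ _ _ e4 e4)).
rewrite (KLx _ _ _ _ _ e3 e4) -!scalerAr !mulrBr.
by lin_eq F B; field.
Qed.

Lemma serre_comm0 i j k : i != j -> a i j = 0 ->
  E k * (G i * G j - G j * G i) = (G i * G j - G j * G i) * E k.
Proof.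
move=> ij aij; apply/eqP; rewrite -subr_eq0; apply/eqP.
have aji : a j i = 0 by rewrite asym.
have DB x y : D k (x - y) = D k x - D k y.
  by rewrite /D mulrBr [(x - y) * _]mulrBl; lin_eq F B; ring.
rewrite -/(D k _) DB !DM.
have Dg l : D k (G l) = if k == l then (q - q^-1)^-1 *: (K k - L k) else 0.
  exact: uEG.
have e l m : a l m = 0 -> (K l - L l) * G m = G m * (K l - L l).
  by move=> h; rewrite mulrBl mulrBr (uKG U) uLG h !scale1r.
rewrite !Dg; case: (eqVneq k i) => [->|ki].
  rewrite (negbTE ij) !(mul0r, mulr0, addr0, add0r).
  by rewrite -scalerAl -scalerAr e // subrr.
case: (eqVneq k j) => [->|kj]; last by rewrite !(mul0r, mulr0, addr0, subr0).
by rewrite !(mul0r, mulr0, addr0, add0r) -scalerAl -scalerAr e // subrr.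
Qed.
End Basic.

Lemma urel_morph (B C : algType F) (f : {lrmorphism B -> C}) E G K L :
  injective f -> urel (f \o E) (f \o G) (f \o K) (f \o L) ->
  urel E G K L.
Proof.
move=> fI [[h1 h2 h3 h4 h5 h6] h7 h8]; split.
  split=> *; apply: fI; rewrite ?(rmorphM, rmorph1, linearZ, rmorphB, rmorphM).
  + exact: h1. + exact: h2. + exact: h3. + exact: h4. + exact: h5.
  + rewrite [LHS]h6; case: ifP => _; last by rewrite rmorph0.
    by rewrite linearZ rmorphB.
all: move=> i j ij.
- have [s0 s1] := h7 i j ij; split=> e; apply: fI.
  + by rewrite !rmorphM; exact: s0.
  + by rewrite rmorph0 rmorphD rmorphB /= linearZ /= !rmorphM; exact: s1.
- have [s0 s1] := h8 i j ij; split=> e; apply: fI.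
  + by rewrite !rmorphM; exact: s0.
  + by rewrite rmorph0 rmorphD rmorphB /= linearZ /= !rmorphM; exact: s1.
Qed.

Section Generation.
Variables (A : algType F) (E G K L : 'I_n -> A) (HU : isU E G K L).

(** The elements satisfying [P] form a subalgebra containing the generators. The universal property
    maps [A] into it, and by uniqueness the composite with the inclusion is the identity. *)
Lemma gen_ind (P : A -> Prop) : P 1 ->
  (forall c x y, P x -> P y -> P (c *: x + y)) ->
  (forall x y, P x -> P y -> P (x * y)) ->
  (forall i, [/\ P (E i), P (G i), P (K i) & P (L i)]) -> forall x, P x.
Proof.
move=> P1 Pl PM Pg x.
pose S := Salg P1 Pl PM; pose B := sa_type S : algType F.
have mk (X : 'I_n -> A) : (forall i, P (X i)) -> {Y : 'I_n -> B | forall i, val (Y i) = X i}.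
  move=> h; have h' i : sa_pred S (X i) by apply/asboolP.
  by exists (fun i => exist _ (X i) (h' i) : B).
have [E' e1] := mk E (fun i => let: And4 h _ _ _ := Pg i in h).
have [G' e2] := mk G (fun i => let: And4 _ h _ _ := Pg i in h).
have [K' e3] := mk K (fun i => let: And4 _ _ h _ := Pg i in h).
have [L' e4] := mk L (fun i => let: And4 _ _ _ h := Pg i in h).
have U' : urel E' G' K' L'.
  apply: (@urel_morph B A (@sa_val F A S)); first exact: val_inj.
  have -> : sa_val (S := S) \o E' = E by apply/funext.
  have -> : sa_val (S := S) \o G' = G by apply/funext.
  have -> : sa_val (S := S) \o K' = K by apply/funext.
  have -> : sa_val (S := S) \o L' = L by apply/funext.
  exact: (proj1 HU).
have [[f hf] _] := proj2 HU B _ _ _ _ U'.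
have [_ un] := proj2 HU A _ _ _ _ (proj1 HU).
have -> : x = val (f x).
  rewrite -[LHS]/((idfun : {lrmorphism A -> A}) x).
  rewrite -[RHS]/(((@sa_val F A S : {lrmorphism B -> A}) \o f : {lrmorphism A -> A}) x).
  apply: un => i; have [h1 h2 h3 h4] := hf i.
  by split; rewrite /= /sa_val (h1, h2, h3, h4) (e1, e2, e3, e4).
by have := valP (f x) => /asboolP.
Qed.

Lemma gen_left_ind (P : A -> Prop) : P 1 ->
  (forall c x y, P x -> P y -> P (c *: x + y)) ->
  (forall i x, P x -> [/\ P (E i * x), P (G i * x), P (K i * x) & P (L i * x)]) ->
  forall x, P x.
Proof.
move=> P1 Pl Pg x; rewrite -[x]mulr1.
move: x 1 P1; apply: gen_ind.
- by move=> z Pz; rewrite mul1r.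
- by move=> c y z hy hz w hw; rewrite mulrDl -scalerAl; apply: Pl; auto.
- by move=> y z hy hz w hw; rewrite -mulrA; auto.
- by move=> i; split=> z /(Pg i) [].
Qed.
End Generation.

Lemma urel_swap (B : algType F) (E G K L : 'I_n -> B) :
  urel E G K L -> urel G E L K.
Proof. by case=> h1 h2 h3; split=> //; apply: urel0_swap. Qed.

(** Results on the half generated by [E] are transferred to the half generated by [G] through this
    exchange. *)
Lemma isU_swap (A : algType F) (E G K L : 'I_n -> A) :
  isU E G K L -> isU G E L K.
Proof.
case=> h1 h2; split; first exact: urel_swap.
move=> B E' G' K' L' /urel_swap /(h2 B) [[f hf] un]; split.
  by exists f => i; have [] := hf i.
by move=> g1 g2 hg; apply: un => i; have [] := hg i.
Qed.
End Presentation.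

(** * Dual Verma modules *)

(* Simply laced Cartan matrices of finite type. *)
Record gcm (n : nat) := Gcm {
  ca :> 'I_n -> 'I_n -> int;
  ca_sym : forall i j, ca i j = ca j i;
  ca_diag : forall i, ca i i = 2;
  ca_off : forall i j, i != j -> ca i j = 0 \/ ca i j = -1;
  ca_pos : forall v : {ffun 'I_n -> int},
    (\sum_i \sum_j ca i j * v i * v j <= 0)%R -> v = 0 }.

(** The properties of the indeterminate that the argument uses; the ground field stays abstract
    until the end. *)
Record qpar (F : fieldType) := Qpar {
  qval :> F;
  q_neq0 : qval != 0;
  q_nroot : forall k, (0 < k)%N -> qval ^+ k != 1;
  q_char0 : forall k, (k.+1)%:R != 0 :> F }.

Section QPar.
Variables (F : fieldType) (q : qpar F).
Lemma qexp_eq1 (z : int) : ((q : F) ^ z == 1) = (z == 0).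
Proof.
case: z => [[|k]|k]; rewrite ?expr0z ?eqxx //.
  by rewrite -exprnP (negbTE (q_nroot q _)).
by rewrite NegzE -exprnN invr_eq1 (negbTE (q_nroot q _)).
Qed.
Lemma qexp_neq0 (z : int) : (q : F) ^ z != 0.
Proof. by rewrite expfz_neq0 ?q_neq0. Qed.
Lemma qexp_inj (y z : int) : (q : F) ^ y = (q : F) ^ z -> y = z.
Proof.
move=> h; apply/eqP; rewrite -subr_eq0 -qexp_eq1 expfzDr ?q_neq0 // -invr_expz h.
by rewrite divff ?qexp_neq0.
Qed.
Lemma qqV_neq0 : (q : F) - (q : F)^-1 != 0.
Proof.
rewrite subr_eq0 -[X in _ != X]exprN1; apply/eqP => h.
by have /qexp_inj : (q : F) ^ (1 : int) = (q : F) ^ (-1) by rewrite expr1z.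
Qed.
End QPar.

Section DualVerma.
Variables (F : fieldType) (n : nat) (a : gcm n) (q : qpar F) (V : lmodType F).
Notation I := 'I_n.
Notation qF := (q : F).
Notation fn := (seq I -> V).

Definition wp (i : I) (w : seq I) : int := \sum_(j <- w) a i j.
Lemma wp_cons i j w : wp i (j :: w) = a i j + wp i w.
Proof. by rewrite /wp big_cons. Qed.

(** The q-shuffle of the letter [i] with [f]: the value at [w] is a sum over the occurrences of [i]
    in [w], of [f] at [w] with that occurrence deleted, weighted by [q] to the power [e] times the
    pairing of [i] with the letters in front of it. *)
Fixpoint dop (e : int) (i : I) (f : fn) (w : seq I) : V :=
  if w is j :: w' then
    (if i == j then f w' else 0) + qF ^ (e * a i j) *: dop e i (fun u => f (j :: u)) w'
  else 0.

Lemma dop_ext e i f g w : f =1 g -> dop e i f w = dop e i g w.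
Proof. by move=> /funext ->. Qed.
Lemma dop_lin e i c f g w :
  dop e i (fun u => c *: f u + g u) w = c *: dop e i f w + dop e i g w.
Proof.
elim: w f g => [|j w IH] f g /=; first by rewrite scaler0 addr0.
by rewrite IH; case: eqP => _; lin_eq F V; ring.
Qed.
Lemma dop0 e i w : dop e i (fun=> 0) w = 0.
Proof. by elim: w => //= j w ->; case: eqP; rewrite scaler0 addr0. Qed.

(** These are the linear maps from the free algebra on [I] to [V] that vanish on the two-sided ideal
    generated by the Serre elements. *)
Definition serre_fn (f : fn) := forall u w i j, i != j ->
  (a i j = 0 -> f (u ++ [:: i, j & w]) = f (u ++ [:: j, i & w])) /\
  (a i j = -1 -> f (u ++ [:: i, i, j & w]) - (qF + qF^-1) *: f (u ++ [:: i, j, i & w])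
                 + f (u ++ [:: j, i, i & w]) = 0).

Lemma serre_fn_cons f j : serre_fn f -> serre_fn (fun u => f (j :: u)).
Proof. by move=> h u w i k ik; apply: (h (j :: u)). Qed.

Lemma serre_fn_lin c f g :
  serre_fn f -> serre_fn g -> serre_fn (fun u => c *: f u + g u).
Proof.
move=> hf hg u w i j ij; have [f0 f1] := hf u w i j ij.
have [g0 g1] := hg u w i j ij; split=> e; first by rewrite f0 ?g0.
have {}f1 := f1 e; have {}g1 := g1 e.
transitivity (c *: (0 : V) + 0); last by rewrite scaler0 addr0.
by rewrite -{1}f1 -{1}g1; lin_eq F V; ring.
Qed.

Lemma serre_fn_dop e k f : e = 1 \/ e = -1 -> serre_fn f -> serre_fn (dop e k f).
Proof.
move=> he hf u w i j ij.
elim: u f hf => [|l u IH] f hf; last first.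
  rewrite /=; have [f0 f1] := hf u w i j ij.
  have [g0 g1] := IH _ (serre_fn_cons l hf); split=> eij.
    by rewrite f0 // g0.
  have {}f1 := f1 eij; have {}g1 := g1 eij.
  set D1 := dop _ _ _ (u ++ [:: i, i, j & w]) in g1 *.
  set D2 := dop _ _ _ (u ++ [:: i, j, i & w]) in g1 *.
  set D3 := dop _ _ _ (u ++ [:: j, i, i & w]) in g1 *.
  have -> : D3 = 0 - D1 + (qF + qF^-1) *: D2 by rewrite -g1; lin_eq F V; ring.
  case: eqP => _; last by lin_eq F V; ring.
  have -> : f (u ++ [:: j, i, i & w]) =
    0 - f (u ++ [:: i, i, j & w]) + (qF + qF^-1) *: f (u ++ [:: i, j, i & w]).
    by rewrite -f1; lin_eq F V; ring.
  by lin_eq F V; ring.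
rewrite /=; split=> eij.
  have -> : dop e k (fun u => f [:: i, j & u]) w = dop e k (fun u => f [:: j, i & u]) w.
    by apply: dop_ext => x; have [f0 _] := hf [::] x i j ij; apply: f0.
  case: (eqVneq k i) => [ki|ki].
    rewrite ki (negbTE ij) eij mulr0 expr0z; lin_eq F V; ring.
  case: (eqVneq k j) => [kj|kj].
    rewrite kj (ca_sym a j i) eij mulr0 expr0z; lin_eq F V; ring.
  by lin_eq F V; ring.
have q0 := q_neq0 q.
set D1 := dop _ _ (fun u => f [:: i, i, j & u]) w.
set D2 := dop _ _ (fun u => f [:: i, j, i & u]) w.
set D3 := dop _ _ (fun u => f [:: j, i, i & u]) w.
have -> : D3 = 0 - D1 + (qF + qF^-1) *: D2.
  have h x : f [:: j, i, i & x] = (-1) *: f [:: i, i, j & x] +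
             ((qF + qF^-1) *: f [:: i, j, i & x] + 0).
    have [_ f1] := hf [::] x i j ij; rewrite -(f1 eij) /=; lin_eq F V; ring.
  rewrite /D3 (dop_ext e k w h) !dop_lin dop0 -/D1 -/D2; lin_eq F V; ring.
(* For [e = -1] the roles of [q] and [q^-1] are exchanged. [p] stands for whichever of them occurs,
   so that both signs are treated at once. *)
have [p [p0 eb ep ep1]] : exists p : F, [/\ p != 0, qF + qF^-1 = p + p^-1,
     qF ^ (e * 2) = p ^+ 2 & qF ^ (e * -1) = p^-1].
  case: he => ->; first by exists qF; rewrite !mul1r exprN1.
  by exists qF^-1; rewrite invrK addrC !mulN1r opprK expr1z invr_eq0 -invr_expz exprVn.
rewrite eb; case: (eqVneq k i) => [ki|ki].
  by rewrite ki (negbTE ij) eij ca_diag ep ep1; lin_eq F V; field.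
case: (eqVneq k j) => [kj|kj].
  rewrite kj (ca_sym a j i) eij ca_diag ep ep1.
  by lin_eq F V; field.
by lin_eq F V; ring.
Qed.

Variable lam : I -> F.
Hypothesis lam0 : forall i, lam i != 0.

Definition Kop i (f : fn) : fn := fun w => (lam i * qF ^ (- wp i w)) *: f w.
Definition Lop i (f : fn) : fn := fun w => ((lam i)^-1 * qF ^ (wp i w)) *: f w.
(** The commutator with [E] forces this formula. Each occurrence of [i] in [w] contributes
    [(K i - L i)/(q - q^-1)] taken at the letters behind it, times [f] with that occurrence deleted.
    The factors [q^2] and [q^-2] discount the deleted letter, which [Kop] and [Lop] still count. *)
Definition Gop i (f : fn) : fn := fun w => (qF - qF^-1)^-1 *:
  (qF ^+ 2 *: Kop i (dop 1 i f) w - qF^-1 ^+ 2 *: Lop i (dop (-1) i f) w).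

Lemma serre_fn_wt (c : seq I -> F) f :
  (forall u w w', perm_eq w w' -> c (u ++ w) = c (u ++ w')) ->
  serre_fn f -> serre_fn (fun w => c w *: f w).
Proof.
move=> hc hf u w i j ij; have [f0 f1] := hf u w i j ij; split=> e.
  rewrite f0 // (hc u [:: i, j & w] [:: j, i & w]) //.
  by apply/permP => x /=; rewrite addnCA.
rewrite (hc u [:: i, j, i & w] [:: i, i, j & w]); last first.
  by apply/permP => x /=; rewrite -!plusE; lia.
rewrite (hc u [:: j, i, i & w] [:: i, i, j & w]); last first.
  by apply/permP => x /=; rewrite -!plusE; lia.
transitivity (c (u ++ [:: i, i, j & w]) *: (0 : V)); last exact: scaler0.
by rewrite -(f1 e); lin_eq F V; ring.
Qed.

Lemma wp_perm i u w w' : perm_eq w w' -> wp i (u ++ w) = wp i (u ++ w').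
Proof. by move=> h; apply: perm_big; rewrite perm_cat2l. Qed.

Lemma serre_fn_K i f : serre_fn f -> serre_fn (Kop i f).
Proof. by apply: serre_fn_wt => u w w' h; rewrite (wp_perm _ _ h). Qed.
Lemma serre_fn_L i f : serre_fn f -> serre_fn (Lop i f).
Proof. by apply: serre_fn_wt => u w w' h; rewrite (wp_perm _ _ h). Qed.
Lemma serre_fn_G i f : serre_fn f -> serre_fn (Gop i f).
Proof.
move=> hf.
have z : serre_fn (fun=> 0) by move=> u w k j kj; split=> // _; lin_eq F V; ring.
have h1 := serre_fn_lin ((qF - qF^-1)^-1 * qF ^+ 2)
  (serre_fn_K i (@serre_fn_dop 1 i f (or_introl erefl) hf)) z.
have h2 := serre_fn_lin (- (qF - qF^-1)^-1 * qF^-1 ^+ 2)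
  (serre_fn_L i (@serre_fn_dop (-1) i f (or_intror erefl) hf)) h1.
congr (serre_fn _): h2; apply/funext => w; rewrite /Gop; lin_eq F V; ring.
Qed.

Lemma dop_wt e i j f (c : F) w : dop e j (fun u => (c * qF ^ (- wp i u)) *: f u) w =
  (qF ^ a i j * (c * qF ^ (- wp i w))) *: dop e j f w.
Proof.
have q0 := q_neq0 q.
elim: w c f => [|k w IH] c f /=; first by rewrite scaler0.
have E u : (c * qF ^ (- wp i (k :: u))) *: f (k :: u) =
   ((c * qF ^ (- a i k)) * qF ^ (- wp i u)) *: f (k :: u).
  by rewrite wp_cons opprD expfzDr // mulrA.
rewrite (dop_ext _ _ _ E) IH wp_cons opprD expfzDr //.
case: (eqVneq j k) => [->|_]; last by lin_eq F V; ring.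
rewrite -[qF ^ (- a i k)]invr_expz; have := qexp_neq0 q (a i k).
by move=> h; lin_eq F V; field; rewrite ?h ?q0.
Qed.
End DualVerma.

(** * The space of Serre functions and the action on it *)

Section SerreFunctions.
Variables (F : fieldType) (n : nat) (a : gcm n) (q : qpar F) (V : lmodType F).
Notation I := 'I_n.
Notation qF := (q : F).

(** [V = F^o] gives a dual Verma module; with [V = A] elements of [A] are recovered as values of
    functions. *)
Record sfn := Sfn { sfn_fun :> seq I -> V; sfnP : serre_fn a q sfn_fun }.

Lemma sfn_ext (f g : sfn) : (forall w, f w = g w) -> f = g.
Proof.
case: f g => f hf [g hg] /= /funext fg.
by case: _ / fg hg => hg; congr Sfn; apply: Prop_irrelevance.
Qed.

HB.instance Definition _ := gen_eqMixin sfn.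
HB.instance Definition _ := gen_choiceMixin sfn.

Fact serre_fn0 : serre_fn a q (fun=> 0 : V).
Proof. by move=> u w k j kj; split=> // _; lin_eq F V; ring. Qed.
Definition sfn_zero := Sfn serre_fn0.
Definition sfn_lin c (f g : sfn) := Sfn (serre_fn_lin c (sfnP f) (sfnP g)).
Definition sfn_add := sfn_lin 1.
Definition sfn_scale c f := sfn_lin c f sfn_zero.
Definition sfn_opp := sfn_scale (-1).

Fact sfn_addA : associative sfn_add.
Proof. by move=> f g h; apply: sfn_ext => x /=; rewrite !scale1r addrA. Qed.
Fact sfn_addC : commutative sfn_add.
Proof. by move=> f g; apply: sfn_ext => x /=; rewrite !scale1r addrC. Qed.
Fact sfn_add0 : left_id sfn_zero sfn_add.
Proof. by move=> f; apply: sfn_ext => x /=; rewrite scaler0 add0r. Qed.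
Fact sfn_addN : left_inverse sfn_zero sfn_opp sfn_add.
Proof.
by move=> f; apply: sfn_ext => x /=; rewrite scale1r scaleN1r addr0 addNr.
Qed.
HB.instance Definition _ :=
  GRing.isZmodule.Build sfn sfn_addA sfn_addC sfn_add0 sfn_addN.

Fact sfn_scaleA (c d : F) (f : sfn) : sfn_scale c (sfn_scale d f) = sfn_scale (c * d) f.
Proof. by apply: sfn_ext => x /=; rewrite !addr0 scalerA. Qed.
Fact sfn_scale1 : left_id 1 sfn_scale.
Proof. by move=> f; apply: sfn_ext => x /=; rewrite addr0 scale1r. Qed.
Fact sfn_scaleDr : right_distributive sfn_scale +%R.
Proof. by move=> c f g; apply: sfn_ext => x /=; lin_eq F V; ring. Qed.
Fact sfn_scaleDl (f : sfn) : {morph sfn_scale^~ f : c d / c + d}.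
Proof. by move=> c d; apply: sfn_ext => x /=; lin_eq F V; ring. Qed.
HB.instance Definition _ := GRing.Zmodule_isLmodule.Build F sfn
  sfn_scaleA sfn_scale1 sfn_scaleDr sfn_scaleDl.

Lemma sfnDE (f g : sfn) w : (f + g) w = f w + g w.
Proof. by rewrite /= scale1r. Qed.
Lemma sfnNE (f : sfn) w : (- f) w = - f w.
Proof. by rewrite /= scaleN1r addr0. Qed.
Lemma sfnZE c (f : sfn) w : (c *: f) w = c *: f w.
Proof. by rewrite /= addr0. Qed.
Lemma sfn0E w : (0 : sfn) w = 0. Proof. by []. Qed.
Lemma sfn_sumE T (r : seq T) (g : T -> sfn) w :
  (\sum_(t <- r) g t) w = \sum_(t <- r) g t w.
Proof. by elim: r => [|t r IH]; rewrite ?big_nil // !big_cons sfnDE IH. Qed.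

Definition vac_fn (v : V) (w : seq I) : V := if w is [::] then v else 0.
Fact vac_fnP v : serre_fn a q (vac_fn v).
Proof. by move=> u w i j ij; case: u => [|k u] /=; split=> // _; lin_eq F V; ring. Qed.
Definition vac v := Sfn (vac_fnP v).
End SerreFunctions.

Section SerreModule.
Variables (F : fieldType) (n : nat) (a : gcm n) (q : qpar F) (V : lmodType F).
Notation I := 'I_n.
Notation qF := (q : F).
Notation sfn := (sfn a q V).
Variables (hV : exists v : V, v <> 0).
Fact sfn_nz : exists f : sfn, f <> 0.
Proof.
by case: hV => v hv; exists (vac a q v) => /(congr1 (fun f : sfn => f [::])).
Qed.
Notation B := (endo sfn_nz).
Variable lam : I -> F.
Hypothesis lam0 : forall i, lam i != 0.

Fact Eend_lin i : linear (fun f : sfn => Sfn (serre_fn_cons i (sfnP f))).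
Proof. by move=> c f g; apply: sfn_ext => w /=; rewrite scale1r addr0. Qed.
Definition Eend i : B := Endo _ (Eend_lin i).
Fact Kend_lin i : linear (fun f : sfn => Sfn (serre_fn_K lam i (sfnP f))).
Proof.
by move=> c f g; apply: sfn_ext => w; rewrite !(sfnDE, sfnZE) /= /Kop; lin_eq F V; ring.
Qed.
Definition Kend i : B := Endo _ (Kend_lin i).
Fact Lend_lin i : linear (fun f : sfn => Sfn (serre_fn_L lam i (sfnP f))).
Proof.
by move=> c f g; apply: sfn_ext => w; rewrite !(sfnDE, sfnZE) /= /Lop; lin_eq F V; ring.
Qed.
Definition Lend i : B := Endo _ (Lend_lin i).
Lemma dop_sfn_lin e i c (f g : sfn) w :
  dop a q e i (c *: f + g) w = c *: dop a q e i f w + dop a q e i g w.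
Proof. by rewrite -dop_lin; apply: dop_ext => u; rewrite sfnDE sfnZE. Qed.
Fact Gend_lin i : linear (fun f : sfn => Sfn (serre_fn_G lam i (sfnP f))).
Proof.
move=> c f g; apply: sfn_ext => w; rewrite !(sfnDE, sfnZE) /= /Gop /Kop /Lop.
by rewrite !dop_sfn_lin; lin_eq F V; ring.
Qed.
Definition Gend i : B := Endo _ (Gend_lin i).

Let q0 := q_neq0 q.
Let qVq := qqV_neq0 q.
Let qq1 : qF * qF - 1 != 0.
Proof. by rewrite -expr2 subr_eq0 (q_nroot q). Qed.

Lemma end_urel0 : urel0 a q Eend Gend Kend Lend.
Proof.
split.
- move=> i; apply: endo_ext => f; apply: sfn_ext => w /=; rewrite /Kop /Lop /=.
  rewrite scalerA -invr_expz mulrACA divff ?mul1r ?mulVf ?scale1r //.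
  exact: qexp_neq0.
- move=> i; apply: endo_ext => f; apply: sfn_ext => w /=; rewrite /Kop /Lop /=.
  rewrite scalerA -invr_expz mulrACA mulVf ?mul1r ?divff ?scale1r //.
  exact: qexp_neq0.
- move=> i j; apply: endo_ext => f; apply: sfn_ext => w /=; rewrite /Kop /=.
  by rewrite !scalerA mulrC.
- move=> i j; apply: endo_ext => f; apply: sfn_ext => w.
  rewrite endoZE sfnZE !endoME /= /Kop /= wp_cons opprD expfzDr // -!invr_expz scalerA.
  congr (_ *: _); field; rewrite (negbTE (qexp_neq0 q _)) //=.
  exact: qexp_neq0.
- move=> i j; apply: endo_ext => f; apply: sfn_ext => w.
  rewrite endoZE sfnZE !endoME /= /Kop /= /Gop /= /Kop /Lop /=.
  rewrite !(@dop_wt F n a q V _ i j _ (lam i)) -!invr_expz.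
  lin_eq F V; field; rewrite ?q0 ?qexp_neq0 ?qVq ?qq1 ?lam0 //.
- move=> i j; apply: endo_ext => f; apply: sfn_ext => w.
  rewrite endoDE endoNE sfnDE sfnNE !endoME /= /Gop /= /Kop /Lop /=.
  rewrite wp_cons [j == i]eq_sym opprD !expfzDr // !mul1r !mulN1r (ca_sym a j i).
  rewrite -!invr_expz; have ha := qexp_neq0 q (a i j).
  case: (eqVneq i j) => [<-|ij].
    rewrite endoZE sfnZE endoDE endoNE sfnDE sfnNE /= /Kop /Lop ca_diag.
    have -> : qF ^ (2 : int) = qF ^+ 2 by [].
    by rewrite -!invr_expz; lin_eq F V; field; rewrite ?q0 ?qexp_neq0 ?qVq ?qq1 ?lam0 //.
  by rewrite endo0E sfn0E; lin_eq F V; field; rewrite ?q0 ?qexp_neq0 ?qVq ?qq1 ?lam0 ?ha.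
Qed.

Lemma Gend_nil i (f : sfn) : Gend i f [::] = 0.
Proof. by rewrite /= /Gop /Kop /Lop /= !scaler0 subr0 scaler0. Qed.

Lemma end_urel : urel a q Eend Gend Kend Lend.
Proof.
have U := end_urel0; split=> // i j ij.
- split=> eij; apply: endo_ext => f; apply: sfn_ext => w.
    have [h _] := sfnP f [::] w ij.
    by have := h eij; rewrite /= => ->.
  have [_ h] := sfnP f [::] w ij.
  rewrite !(endoDE, endoNE, endoZE, endo0E) !(sfnDE, sfnNE, sfnZE, sfn0E).
  by rewrite !endoME /= -(h eij) /=; lin_eq F V; ring.
(* A value at a word is a value at the empty word after deleting letters, so an operator commuting
   with every deletion is determined by its values at the empty word. The Serre elements in [Gend]
   are such operators, and they vanish there. *)
- have nil0 (S : B) : (forall k, Eend k * S = S * Eend k) ->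
      (forall f, S f [::] = 0) -> S = 0.
    move=> hk h; apply: endo_ext => f; apply: sfn_ext => w.
    elim: w f => [|k w IH] f; first exact: h.
    have -> : S f (k :: w) = (Eend k * S) f w by [].
    by rewrite hk endoME IH.
  split=> eij.
    apply/eqP; rewrite -subr_eq0; apply/eqP; apply: nil0 => [k|f].
      exact: (@serre_comm0 _ _ a qF q0 _ _ _ _ _ U (ca_sym a)).
    by rewrite endoDE endoNE sfnDE sfnNE !endoME !Gend_nil subrr.
  apply: nil0 => [k|f].
    exact: (@serre_comm _ _ a qF q0 _ _ _ _ _ U (ca_sym a) (ca_diag a)).
  rewrite !(endoDE, endoNE, endoZE) !(sfnDE, sfnNE, sfnZE) !endoME !Gend_nil.
  by lin_eq F V; ring.
Qed.
End SerreModule.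

Section Action.
Variables (F : fieldType) (n : nat) (a : gcm n) (q : qpar F).
Notation I := 'I_n.
Notation qF := (q : F).
Variables (A : algType F) (E G K L : I -> A) (HU : isU a q E G K L).
Variables (V : lmodType F) (hV : exists v : V, v <> 0).
Variable lam : I -> F.
Hypothesis lam0 : forall i, lam i != 0.
Notation sfn := (sfn a q V).

Lemma act_ex : exists f : {lrmorphism A -> endo (sfn_nz a q hV)},
  forall i, [/\ f (E i) = Eend a q hV i, f (G i) = Gend a q hV lam i,
                f (K i) = Kend a q hV lam i & f (L i) = Lend a q hV lam i].
Proof. by have [_ /(_ _ _ _ _ _ (end_urel a q hV lam0)) []] := HU. Qed.

Definition act (x : A) (f : sfn) : sfn := projT1 (cid act_ex) x f.

Lemma actDr x f g : act x (f + g) = act x f + act x g.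
Proof. by rewrite /act endoD. Qed.
Lemma actZr x c f : act x (c *: f) = c *: act x f.
Proof. by rewrite /act endoZ. Qed.
Lemma act0r x : act x 0 = 0.
Proof. by rewrite /act endo0. Qed.
Lemma actM x y f : act (x * y) f = act x (act y f).
Proof. by rewrite /act rmorphM. Qed.
Lemma act1 f : act 1 f = f.
Proof. by rewrite /act rmorph1. Qed.
Lemma actD x y f : act (x + y) f = act x f + act y f.
Proof. by rewrite /act rmorphD. Qed.
Lemma actN x f : act (- x) f = - act x f.
Proof. by rewrite /act rmorphN. Qed.
Lemma actB x y f : act (x - y) f = act x f - act y f.
Proof. by rewrite actD actN. Qed.
Lemma actZ c x f : act (c *: x) f = c *: act x f.
Proof. by rewrite /act linearZ. Qed.
Lemma act0 f : act 0 f = 0.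
Proof. by rewrite /act rmorph0. Qed.
Lemma act_sum T (r : seq T) (x : T -> A) f :
  act (\sum_(t <- r) x t) f = \sum_(t <- r) act (x t) f.
Proof. by elim: r => [|t r IH]; rewrite ?big_nil ?act0 // !big_cons actD IH. Qed.

Lemma actE i f w : act (E i) f w = f (i :: w).
Proof. by rewrite /act; case: (cid _) => g /= /(_ i) [-> _ _ _]. Qed.
Lemma actG i f w : act (G i) f w = Gop a q lam i f w.
Proof. by rewrite /act; case: (cid _) => g /= /(_ i) [_ -> _ _]. Qed.
Lemma actK i f w : act (K i) f w = (lam i * qF ^ (- wp a i w)) *: f w.
Proof. by rewrite /act; case: (cid _) => g /= /(_ i) [_ _ -> _]. Qed.
Lemma actL i f w : act (L i) f w = ((lam i)^-1 * qF ^ (wp a i w)) *: f w.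
Proof. by rewrite /act; case: (cid _) => g /= /(_ i) [_ _ _ ->]. Qed.
Lemma actG_nil i f : act (G i) f [::] = 0.
Proof. by rewrite actG /Gop /Kop /Lop /= !scaler0 subr0 scaler0. Qed.
End Action.

(** * Skew derivations and the pairing *)

Section Words.
Variables (F : fieldType) (n : nat) (A : algType F).
Notation I := 'I_n.

(* Words are multiplied from right to left, so that [wd E w] acts on functions
   of words by deleting the prefix [w]. *)
Fixpoint wd (X : I -> A) (w : seq I) : A := if w is i :: w' then wd X w' * X i else 1.

Lemma wd_cat X u w : wd X (u ++ w) = wd X w * wd X u.
Proof. by elim: u => [|i u IH] /=; rewrite ?mulr1 // IH mulrA. Qed.

Definition span (P : seq I -> Prop) (X : I -> A) (x : A) :=
  exists s : seq (F * seq I),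
    (forall p, p \in s -> P p.2) /\ x = \sum_(p <- s) p.1 *: wd X p.2.

Lemma span_wd (P : seq I -> Prop) X w : P w -> span P X (wd X w).
Proof.
by move=> h; exists [:: (1, w)]; split=> [p|]; rewrite ?inE ?big_seq1 ?scale1r // => /eqP ->.
Qed.
Lemma span_lin P X c x y : span P X x -> span P X y -> span P X (c *: x + y).
Proof.
move=> [s [hs ->]] [t [ht ->]].
exists ([seq (c * p.1, p.2) | p <- s] ++ t); split=> [p|].
  by rewrite mem_cat => /orP [/mapP [r /hs h ->]|/ht].
rewrite big_cat big_map scaler_sumr; congr (_ + _).
by apply: eq_bigr => p _; rewrite scalerA.
Qed.
Lemma span0 P X : span P X 0.
Proof. by exists [::]; split=> //; rewrite big_nil. Qed.
Lemma spanZ P X c x : span P X x -> span P X (c *: x).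
Proof. by move=> h; rewrite -[_ *: _]addr0; apply/span_lin/span0. Qed.
Lemma spanD P X x y : span P X x -> span P X y -> span P X (x + y).
Proof. by move=> hx hy; rewrite -[x]scale1r; apply: span_lin. Qed.
Lemma spanN P X x : span P X x -> span P X (- x).
Proof. by rewrite -scaleN1r; apply: spanZ. Qed.
Lemma span_sum P X T (r : seq T) (g : T -> A) :
  (forall t, span P X (g t)) -> span P X (\sum_(t <- r) g t).
Proof.
move=> h; elim: r => [|t r IH]; rewrite ?big_nil ?big_cons; first exact: span0.
exact: spanD.
Qed.
Lemma span_ind P X (Q : A -> Prop) : Q 0 ->
  (forall c x y, Q x -> Q y -> Q (c *: x + y)) ->
  (forall w, P w -> Q (wd X w)) -> forall x, span P X x -> Q x.
Proof.
move=> Q0 Ql Qw x [s [hs ->]]; elim: s hs => [|p s IH] hs.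
  by rewrite big_nil.
rewrite big_cons; apply: Ql; first by apply: Qw; apply: hs; rewrite mem_head.
by apply: IH => r hr; apply: hs; rewrite inE hr orbT.
Qed.
Lemma span_sub (P Q : seq I -> Prop) X x :
  (forall w, P w -> Q w) -> span P X x -> span Q X x.
Proof. by move=> h [s [hs ->]]; exists s; split=> // p /hs /h. Qed.

Definition spanT := span (fun=> True).
Lemma spanT_wd X w : spanT X (wd X w). Proof. exact: span_wd. Qed.
Lemma spanT1 X : spanT X 1. Proof. exact: (spanT_wd X [::]). Qed.
Lemma spanTX X i : spanT X (X i).
Proof. by have := @span_wd (fun=> True) X [:: i] Logic.I; rewrite /= mul1r. Qed.
Lemma spanTM X x y : spanT X x -> spanT X y -> spanT X (x * y).
Proof.
move=> hx hy; move: y hy; apply: span_ind => [|c y z hy hz|w _].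
- by rewrite mulr0; apply: span0.
- by rewrite mulrDr -scalerAr; apply: span_lin.
- move: x hx; apply: span_ind => [|c y z hy hz|v _].
  + by rewrite mul0r; apply: span0.
  + by rewrite mulrDl -scalerAl; apply: span_lin.
  + by rewrite -wd_cat; apply: span_wd.
Qed.
Lemma spanTMX X x k : spanT X x -> spanT X (x ^+ k).
Proof.
move=> hx; elim: k => [|k IH]; first exact: spanT1.
by rewrite exprS; apply: spanTM.
Qed.
End Words.

(** * The symmetric bilinear form on words *)

Section Gram.
Variables (F : fieldType) (n : nat) (a : gcm n) (q : qpar F).
Notation I := 'I_n.
Notation qF := (q : F).

Lemma dop_morph (V W : lmodType F) (g : V -> W) e i (f : seq I -> V) w :
  g 0 = 0 -> (forall c x y, g (c *: x + y) = c *: g x + g y) ->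
  g (dop a q e i f w) = dop a q e i (g \o f) w.
Proof.
move=> g0 gl; elim: w f => [|j w IH] f //=.
rewrite addrC gl IH addrC; congr (_ + _); by case: eqP.
Qed.

Definition delta_nil (w : seq I) : F^o := if w is [::] then 1 else 0.
(** Up to normalisation this is Lusztig's form: [gram w] is the iterated q-shuffle of the letters of
    [w]. It depends only on the Cartan matrix and [q], so the two halves of the algebra share it. *)
Fixpoint gram (w : seq I) : seq I -> F^o :=
  if w is i :: w' then dop a q 1 i (gram w') else delta_nil.

Lemma dop_dop e f i j (H : seq I -> seq I -> F^o) v w :
  dop a q e i (fun u => dop a q f j (H u) w) v =
  dop a q f j (fun x => dop a q e i (H^~ x) v) w.
Proof.
elim: v H => [|k v IH] H /=; first by rewrite dop0.
rewrite IH [RHS](@dop_ext F n a q F^o _ _ _ (fun x => (qF ^ (e * a i k)) *: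
  dop a q e i (fun u => H (k :: u) x) v + (if i == k then H v x else 0))).
  by rewrite dop_lin addrC; congr (_ + _); case: eqP => // _; rewrite dop0.
by move=> x; rewrite addrC.
Qed.

Lemma gram_cons j v w : gram w (j :: v) = dop a q 1 j (gram^~ v) w.
Proof.
elim: w v => [|i w IH] v //=; rewrite eq_sym (ca_sym a i j).
have -> : (fun u => gram w (j :: u)) = (fun u => dop a q 1 j (gram^~ u) w).
  by apply/funext => u; rewrite IH.
by rewrite (dop_dop 1 1 i j (fun u x => gram x u)); case: eqP => [->|].
Qed.

Lemma gram_sym v w : gram v w = gram w v.
Proof.
elim: v w => [|j v IH] w; first by elim: w => [|i w IH] //=; rewrite gram_cons.
by rewrite gram_cons /=; apply: dop_ext => u; rewrite IH.
Qed.
End Gram.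

Section Half.
Variables (F : fieldType) (n : nat) (a : gcm n) (q : qpar F).
Notation I := 'I_n.
Notation qF := (q : F).
Variables (A : algType F) (E G K L : I -> A) (HU : isU a q E G K L).
Let q0 := q_neq0 q.
Let U0 : urel0 a q E G K L. Proof. by case: HU => [[]]. Qed.

Fact one_neq0 : forall i : I, (1 : F) != 0. Proof. by move=> _; apply: oner_neq0. Qed.
Fact nzA : exists v : A, v <> 0. Proof. by exists 1; apply/eqP/oner_neq0. Qed.
Fact nzF : exists v : F^o, v <> 0. Proof. by exists 1; apply/eqP/oner_neq0. Qed.

(** The word map is itself an [A]-valued Serre function. A rule on words that respects the Serre
    relations therefore extends to a linear map on all of [A]: act on the corresponding function and
    evaluate at the empty word. No presentation of the half generated by [E] is involved. *)
Fact wd_serre : serre_fn a q (wd E).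
Proof.
have [[_ sE _] _] := HU; move=> u w i j ij; have [s0 s1] := sE i j ij.
rewrite !wd_cat /=; split=> e; first by rewrite -[wd E w * _ * _]mulrA -s0 ?mulrA.
transitivity (wd E w * 0 * wd E u); last by rewrite mulr0 mul0r.
rewrite -(s1 e) mulrDr mulrBr mulrDl mulrBl -scalerAr -scalerAl !mulrA.
by lin_eq F A; ring.
Qed.
Definition fwd := Sfn wd_serre.

Lemma act_wd (V : lmodType F) hV (lam : I -> F) (lam0 : forall i, lam i != 0)
  (f : sfn a q V) w v : act HU hV lam0 (wd E w) f v = f (w ++ v).
Proof.
elim: w f v => [|i w IH] f v /=; first by rewrite act1.
by rewrite actM IH actE.
Qed.

Definition sg (b : bool) : int := if b then 1 else -1.
Fact sgP b : sg b = 1 \/ sg b = -1. Proof. by case: b; [left|right]. Qed.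
Definition dfn b i := Sfn (serre_fn_dop i (sgP b) wd_serre).

(* Skew derivations of the subalgebra generated by [E]; the two values of [b]
   give the coefficients of [L i] and [K i] in the commutator with [G i]. *)
Definition sd b i (x : A) : A := act HU nzA one_neq0 x (dfn b i) [::].
Definition cst (x : A) : F := act HU nzF one_neq0 x (vac a q (1 : F^o)) [::].

Lemma sd_lin b i c x y : sd b i (c *: x + y) = c *: sd b i x + sd b i y.
Proof. by rewrite /sd actD actZ sfnDE sfnZE. Qed.
Lemma sd0 b i : sd b i 0 = 0. Proof. by rewrite /sd act0. Qed.
Lemma sdD b i x y : sd b i (x + y) = sd b i x + sd b i y.
Proof. by have := sd_lin b i 1 x y; rewrite !scale1r. Qed.
Lemma sdZ b i c x : sd b i (c *: x) = c *: sd b i x.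
Proof. by have := sd_lin b i c x 0; rewrite sd0 !addr0. Qed.
Lemma cst_lin c x y : cst (c *: x + y) = c * cst x + cst y.
Proof. by rewrite /cst actD actZ sfnDE sfnZE. Qed.
Lemma cst0 : cst 0 = 0. Proof. by rewrite /cst act0. Qed.
Lemma cst_wd w : cst (wd E w) = (w == [::])%:R.
Proof. by rewrite /cst act_wd cats0; case: w. Qed.

Lemma sd_wd b i w : sd b i (wd E w) = dop a q (sg b) i (wd E) w.
Proof. by rewrite /sd act_wd cats0. Qed.
Lemma sd1 b i : sd b i 1 = 0. Proof. exact: (sd_wd b i [::]). Qed.
Lemma sd_cons b i j w : sd b i (wd E (j :: w)) =
  (if i == j then wd E w else 0) + qF ^ (sg b * a i j) *: (sd b i (wd E w) * E j).
Proof.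
rewrite !sd_wd /=; congr (_ + _ *: _).
rewrite (@dop_morph _ _ a q A A (fun y : A => y * E j)) ?mul0r // => c x y.
by rewrite mulrDl -scalerAl.
Qed.
Lemma sdMX b i j x : spanT E x ->
  sd b i (x * E j) = (if i == j then x else 0) + qF ^ (sg b * a i j) *: (sd b i x * E j).
Proof.
move: x; apply: span_ind => [|c x y hx hy|w _]; last exact: (sd_cons b i j w).
  by rewrite mul0r sd0 mul0r scaler0; case: eqP; rewrite addr0.
rewrite mulrDl -scalerAl !sd_lin hx hy mulrDl -scalerAl.
by case: eqP => _; lin_eq F A; ring.
Qed.
Lemma sdX b i j : sd b i (E j) = if i == j then 1 else 0.
Proof. by have := sdMX b i j (spanT1 E); rewrite mul1r sd1 mul0r scaler0 addr0. Qed.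

Lemma sd_span b i x : spanT E x -> spanT E (sd b i x).
Proof.
move: x; apply: span_ind => [|c x y hx hy|w _]; first by rewrite sd0; apply: span0.
  by rewrite sd_lin; apply: span_lin.
elim: w => [|j w IH]; first by rewrite sd1; apply: span0.
rewrite sd_cons addrC; apply: span_lin; last first.
  by case: eqP => _; [apply: spanT_wd | apply: span0].
by apply: spanTM => //; apply: spanTX.
Qed.

(* Conjugation by [K i] or its inverse: [E j] is multiplied by [q ^ (sg b * a i j)]. *)
Definition tw b i (x : A) : A := if b then K i * x * L i else L i * x * K i.
Lemma tw_lin b i c x y : tw b i (c *: x + y) = c *: tw b i x + tw b i y.
Proof.
by case: b; rewrite /tw mulrDr mulrDl -scalerAr -scalerAl.
Qed.
Lemma tw0 b i : tw b i 0 = 0. Proof. by case: b; rewrite /tw mulr0 mul0r. Qed.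
Lemma twM b i x y : tw b i (x * y) = tw b i x * tw b i y.
Proof.
case: b; rewrite /tw !mulrA.
  by rewrite -[_ * L i * K i]mulrA (uLK U0) mulr1.
by rewrite -[_ * K i * L i]mulrA (uKL U0) mulr1.
Qed.
Lemma tw1 b i : tw b i 1 = 1.
Proof. by case: b; rewrite /tw mulr1 ?(uKL U0) ?(uLK U0). Qed.
Lemma twX b i j : tw b i (E j) = qF ^ (sg b * a i j) *: E j.
Proof.
case: b; rewrite /tw /=.
  by rewrite (uKE U0) -scalerAl -mulrA (uKL U0) mulr1 mul1r.
by rewrite (uLE q0 U0) -scalerAl -mulrA (uLK U0) mulr1 mulN1r.
Qed.
Lemma twK b i x : tw b i (tw (~~ b) i x) = x.
Proof.
case: b; rewrite /tw /= !mulrA.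
  by rewrite (uKL U0) mul1r -mulrA (uKL U0) mulr1.
by rewrite (uLK U0) mul1r -mulrA (uLK U0) mulr1.
Qed.
Lemma tw_wd b i w : tw b i (wd E w) = qF ^ (sg b * wp a i w) *: wd E w.
Proof.
elim: w => [|j w IH] /=; first by rewrite tw1 /wp big_nil mulr0 expr0z scale1r.
rewrite twM IH twX wp_cons mulrDr expfzDr // -scalerAr -scalerAl scalerA.
by rewrite mulrC.
Qed.
Lemma tw_span b i x : spanT E x -> spanT E (tw b i x).
Proof.
move: x; apply: span_ind => [|c x y hx hy|w _]; first by rewrite tw0; apply: span0.
  by rewrite tw_lin; apply: span_lin.
by rewrite tw_wd; apply/spanZ/spanT_wd.
Qed.

Lemma sdM b i x y : spanT E x -> spanT E y ->
  sd b i (x * y) = x * sd b i y + sd b i x * tw b i y.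
Proof.
move=> hx; move: y; apply: span_ind => [|c y z hy hz|w _].
- by rewrite mulr0 sd0 tw0 !mulr0 addr0.
- rewrite mulrDr -scalerAr !sd_lin hy hz tw_lin !mulrDr -!scalerAr.
  by lin_eq F A; ring.
elim: w => [|j w IH] /=; first by rewrite mulr1 sd1 tw1 mulr0 add0r mulr1.
rewrite mulrA sdMX; last by apply: spanTM => //; apply: spanT_wd.
rewrite sdMX ?IH; last exact: spanT_wd.
rewrite twM twX mulrDl !mulrDr -!scalerAr !mulrA.
case: eqP => _; last by rewrite mulr0; lin_eq F A; ring.
by lin_eq F A; ring.
Qed.

Lemma sd_comm i j x : spanT E x ->
  sd true j (sd false i x) = qF ^ (- a i j) *: sd false i (sd true j x).
Proof.
move: x; apply: span_ind => [|c x y hx hy|w _]; first by rewrite !sd0 scaler0.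
  by rewrite !sd_lin hx hy; lin_eq F A; ring.
elim: w => [|k w IH]; first by rewrite !sd1 !sd0 scaler0.
have sw := spanT_wd E w.
rewrite !sd_cons !sdD !sdZ !sdMX ?IH; try exact: sd_span.
rewrite mul1r mulN1r; case: (eqVneq i k) => [<-|ik].
  rewrite (ca_sym a j i); case: (eqVneq j i) => [->|ji].
    rewrite -!invr_expz -scalerAl; have h := qexp_neq0 q (a i i).
    by lin_eq F A; field.
  rewrite !sd0 -!invr_expz -scalerAl; have h := qexp_neq0 q (a i j).
  by have h' := qexp_neq0 q (a i i); lin_eq F A; field; rewrite ?h ?h'.
rewrite !sd0; case: (eqVneq j k) => [<-|jk]; rewrite ?sd0 -scalerAl -!invr_expz.
  have h := qexp_neq0 q (a i j); have h' := qexp_neq0 q (a j j).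
  by lin_eq F A; field; rewrite ?h ?h'.
by lin_eq F A; ring.
Qed.

Lemma sd_tw b c i j x : spanT E x ->
  sd b i (tw c j x) = qF ^ (sg c * a i j) *: tw c j (sd b i x).
Proof.
move: x; apply: span_ind => [|k x y hx hy|w _]; first by rewrite tw0 sd0 tw0 scaler0.
  by rewrite !(tw_lin, sd_lin) hx hy; lin_eq F A; ring.
elim: w => [|k w IH]; first by rewrite tw1 sd1 tw0 scaler0.
rewrite tw_wd sdZ sd_cons addrC tw_lin twM twX.
rewrite tw_wd sdZ in IH.
have -> : tw c j (sd b i (wd E w)) = (qF ^ (sg c * a i j))^-1 * qF ^ (sg c * wp a j w) *:
   sd b i (wd E w).
  by rewrite -scalerA IH scalerA mulVf ?scale1r // qexp_neq0.
have h := qexp_neq0 q (sg c * a i j).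
rewrite wp_cons mulrDr expfzDr // -scalerAl -scalerAr; case: eqP => [<-|_].
  rewrite tw_wd (ca_sym a j i); lin_eq F A; field; exact: h.
by rewrite tw0; lin_eq F A; field; rewrite h.
Qed.

Lemma commG i x : spanT E x ->
  G i * x - x * G i = (qF - qF^-1)^-1 *: (sd false i x * L i - sd true i x * K i).
Proof.
have qq := qqV_neq0 q.
move: x; apply: span_ind => [|c x y hx hy|w _].
- by rewrite mulr0 mul0r !sd0 !mul0r subrr scaler0.
- rewrite mulrDr mulrDl -scalerAr -scalerAl !sd_lin !mulrDl -!scalerAl.
  have -> : G i * x = x * G i + (qF - qF^-1)^-1 *: (sd false i x * L i - sd true i x * K i).
    by rewrite -hx addrC subrK.
  have -> : G i * y = y * G i + (qF - qF^-1)^-1 *: (sd false i y * L i - sd true i y * K i).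
    by rewrite -hy addrC subrK.
  by lin_eq F A; ring.
elim: w => [|j w IH] /=; first by rewrite mulr1 mul1r !sd1 !mul0r !subrr scaler0.
rewrite !sdMX; try exact: spanT_wd.
have h1 : G i * E j = E j * G i - (if i == j then (qF - qF^-1)^-1 *: (K i - L i) else 0).
  by rewrite eq_sym; have := uEG U0 j i; case: eqP => [->|_] <-; rewrite opprB addrC subrK.
have h2 : G i * wd E w = wd E w * G i + (qF - qF^-1)^-1 *: (sd false i (wd E w) * L i - sd true i (wd E w) * K i).
  by rewrite -IH addrC subrK.
rewrite mulrA h2 mulrDl -[wd E w * G i * _]mulrA h1 mulrBr !mulrA.
rewrite -!scalerAl mulrBl -!mulrA (uKE U0) (uLE q0 U0) mul1r mulN1r !mulrDl.
rewrite -!scalerAl -!scalerAr !mulrA; case: eqP => _.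
  rewrite -scalerAr mulrBr; lin_eq F A; ring.
by rewrite !mul0r mulr0; lin_eq F A; ring.
Qed.

Fixpoint pr (w : seq I) (x : A) : F := if w is i :: w' then pr w' (sd true i x) else cst x.
Lemma pr_lin w c x y : pr w (c *: x + y) = c * pr w x + pr w y.
Proof. by elim: w x y => [|i w IH] x y /=; rewrite ?cst_lin // sd_lin IH. Qed.
Lemma pr0 w : pr w 0 = 0.
Proof. by elim: w => [|i w IH] /=; rewrite ?cst0 // sd0. Qed.
Lemma prZ w c x : pr w (c *: x) = c * pr w x.
Proof. by have := pr_lin w c x 0; rewrite pr0 !addr0. Qed.
Lemma prD w x y : pr w (x + y) = pr w x + pr w y.
Proof. by have := pr_lin w 1 x y; rewrite scale1r mul1r. Qed.
Lemma prN w x : pr w (- x) = - pr w x.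
Proof. by rewrite -scaleN1r prZ mulN1r. Qed.
Lemma pr_sum w T (r : seq T) (g : T -> A) :
  pr w (\sum_(t <- r) g t) = \sum_(t <- r) pr w (g t).
Proof. by elim: r => [|t r IH]; rewrite ?big_nil ?pr0 // !big_cons prD IH. Qed.

Lemma pr_wd w v : pr w (wd E v) = gram a q w v.
Proof.
elim: w v => [|i w IH] v /=; first by rewrite cst_wd; case: v.
rewrite sd_wd (@dop_morph _ _ a q A F^o (pr w)) ?pr0 //; last exact: pr_lin.
have -> : pr w \o wd E = gram a q w by apply/funext => u /=; rewrite IH.
by [].
Qed.
End Half.
Arguments tw : simpl never.

(** * Nondegeneracy of the pairing *)

Section Weights.
Variable n : nat.
Notation I := 'I_n.
Definition sr (i : I) : {ffun I -> int} := [ffun j => (j == i)%:Z].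
Definition wt (w : seq I) : {ffun I -> int} := \sum_(j <- w) sr j.
Lemma wt_nil : wt [::] = 0. Proof. by rewrite /wt big_nil. Qed.
Lemma wt_cons j w : wt (j :: w) = sr j + wt w.
Proof. by rewrite /wt big_cons. Qed.
Lemma wt_cat u w : wt (u ++ w) = wt u + wt w.
Proof. by rewrite /wt big_cat. Qed.
Lemma wt_ge0 w i : 0 <= wt w i.
Proof.
elim: w => [|j w IH]; first by rewrite wt_nil ffunE.
by rewrite wt_cons !ffunE addr_ge0 //; case: eqP.
Qed.
Lemma sum_sr (c : I -> int) i : \sum_j c j * sr i j = c i.
Proof.
rewrite (bigD1 i) //= ffunE eqxx mulr1 big1 ?addr0 // => j ji.
by rewrite ffunE (negbTE ji) mulr0.
Qed.
Lemma wt_size w : \sum_i wt w i = (size w)%:Z.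
Proof.
elim: w => [|j w IH]; first by rewrite wt_nil big1 // => i _; rewrite ffunE.
under eq_bigr do rewrite wt_cons ffunE; rewrite big_split /= IH.
have -> : \sum_i sr j i = 1.
  by rewrite -[RHS](sum_sr (fun=> 1) j); apply: eq_bigr => i _; rewrite mul1r.
by rewrite -intS.
Qed.
Lemma wp_wt (a : gcm n) i w : wp a i w = \sum_j a i j * wt w j.
Proof.
elim: w => [|k w IH].
  by rewrite /wp big_nil big1 // => j _; rewrite wt_nil ffunE mulr0.
under eq_bigr do rewrite wt_cons ffunE mulrDr.
by rewrite big_split /= -IH wp_cons sum_sr.
Qed.
Lemma wt_eq0 w : wt w = 0 -> w = [::].
Proof.
move=> h; apply/nilP; have := wt_size w; rewrite h big1 => [[e]|i _]; last by rewrite ffunE.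
by rewrite /nilp -e.
Qed.
End Weights.

Section Nondegeneracy.
Variables (F : fieldType) (n : nat) (a : gcm n) (q : qpar F).
Notation I := 'I_n.
Notation qF := (q : F).
Variables (A : algType F) (E G K L : I -> A) (HU : isU a q E G K L).
Let q0 := q_neq0 q.
Notation sd := (sd HU).
Notation tw := (tw K L).
Notation pr := (pr HU).
Notation cst := (cst HU).

Section Adjoint.
Variable i : I.
(** The adjoint action of [E i], a twisted derivation by [adM]. For [a i j = -1] the Serre relation
    reads [ad (ad (E j)) = 0]. *)
Definition ad (u : A) := u * E i - E i * tw false i u.

Lemma ad_lin c u v : ad (c *: u + v) = c *: ad u + ad v.
Proof.
by rewrite /ad tw_lin mulrDl mulrDr -scalerAl -scalerAr; lin_eq F A; ring.
Qed.
Lemma ad0 : ad 0 = 0. Proof. by rewrite /ad tw0 mul0r mulr0 subrr. Qed.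
Lemma adM u v : ad (u * v) = u * ad v + ad u * tw false i v.
Proof. by rewrite /ad (twM HU) mulrBr mulrBl !mulrA subrKA. Qed.
Lemma ad_tw b u : ad (tw b i u) = qF ^ (- sg b * 2) *: tw b i (ad u).
Proof.
have twB x y : tw b i (x - y) = tw b i x - tw b i y.
  by rewrite -scaleN1r addrC tw_lin scaleN1r addrC.
rewrite /ad twB (twM HU b i u) (twM HU b i (E i)) (twX HU) ca_diag -scalerAl -scalerAr -scalerBr scalerA.
rewrite mulNr -invr_expz mulVf ?qexp_neq0 // scale1r.
by congr (_ - _ * _); case: b {twB}; rewrite ?(twK HU true i) ?(twK HU false i).
Qed.
Lemma iter_ad_lin m c u v : iter m ad (c *: u + v) = c *: iter m ad u + iter m ad v.
Proof. by elim: m => //= m ->; rewrite ad_lin. Qed.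
Lemma iter_ad0 m : iter m ad 0 = 0.
Proof. by elim: m => //= m ->; rewrite ad0. Qed.
Lemma iter_ad_tw b m u : iter m ad (tw b i u) = (qF ^ (- sg b * 2)) ^+ m *: tw b i (iter m ad u).
Proof.
elim: m => [|m /= ->]; first by rewrite expr0 scale1r.
have -> : forall c x, ad (c *: x) = c *: ad x.
  by move=> c x; rewrite -[c *: x]addr0 ad_lin ad0 addr0.
by rewrite ad_tw scalerA exprSr.
Qed.
Lemma iter_ad_le m k u : iter m ad u = 0 -> (m <= k)%N -> iter k ad u = 0.
Proof. by move=> h /subnK <-; rewrite iterD h iter_ad0. Qed.
Lemma iter_adM k b u v : (b <= k)%N -> iter (k - b) ad u = 0 -> iter b ad v = 0 ->
  iter k ad (u * v) = 0.
Proof.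
elim: k b u v => [|k IH] b u v bk hu hv.
  by move: hu; rewrite sub0n /= => ->; rewrite mul0r.
rewrite iterSr adM -[u * _]scale1r iter_ad_lin scale1r.
case: b bk hu hv => [|b] bk hu hv.
  move: hv => /= ->; rewrite ad0 mulr0 tw0 mulr0 iter_ad0 addr0 //.
rewrite (IH b) ?add0r //; last by rewrite -iterSr.
move: bk; rewrite leq_eqVlt => /orP [/eqP [e]|bk].
  by move: hu; rewrite e subnn /= => ->; rewrite ad0 mul0r iter_ad0.
apply: (IH b.+1) => //; last by rewrite iter_ad_tw hv tw0 scaler0.
by rewrite -iterSr -subSn.
Qed.

(** Nilpotency of [ad] is carried along until [sd_eq0_NF]: expanding the elements of the half in
    powers of [E i] with such coefficients shows that it follows from the vanishing of
    [sd true i]. *)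
Definition NF u := [/\ spanT E u, sd true i u = 0 & exists m, iter m ad u = 0].

Lemma NF0 : NF 0.
Proof. by split; [apply: span0 | rewrite sd0 | exists 0]. Qed.
Lemma NF1 : NF 1.
Proof.
split; [exact: spanT1 | exact: sd1 | exists 1%N].
by rewrite /= /ad (tw1 HU) mul1r mulr1 subrr.
Qed.
Lemma NF_lin c u v : NF u -> NF v -> NF (c *: u + v).
Proof.
move=> [su du [m hm]] [sv dv [k hk]]; split; first exact: span_lin.
  by rewrite sd_lin du dv scaler0 addr0.
exists (maxn m k); rewrite iter_ad_lin (iter_ad_le hm) ?leq_maxl //.
by rewrite (iter_ad_le hk) ?leq_maxr // scaler0 addr0.
Qed.
Lemma NFD u v : NF u -> NF v -> NF (u + v).
Proof. by move=> hu hv; rewrite -[u]scale1r; apply: NF_lin. Qed.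
Lemma NFM u v : NF u -> NF v -> NF (u * v).
Proof.
move=> [su du [m hm]] [sv dv [k hk]]; split; first exact: spanTM.
  by rewrite sdM // dv du mulr0 mul0r addr0.
by exists (m + k)%N; apply: (iter_adM (b := k)); rewrite ?leq_addl ?addnK.
Qed.
Lemma NF_tw b u : NF u -> NF (tw b i u).
Proof.
move=> [su du [m hm]]; split; first exact: (tw_span HU).
  by rewrite sd_tw // du tw0 scaler0.
by exists m; rewrite iter_ad_tw hm tw0 scaler0.
Qed.
Lemma NF_ad u : NF u -> NF (ad u).
Proof.
move=> hu; have [st dt _] := NF_tw false hu; case: hu => su du [m hm].
have sE := spanTX E i.
split.
- by apply/spanD/spanN/spanTM => //; apply: spanTM.
- rewrite /ad -scaleN1r addrC sd_lin sdM // dt mulr0 add0r sdX eqxx mul1r.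
  rewrite (twK HU true) sdM // sdX eqxx du mul0r mulr1 addr0 scaleN1r.
  by rewrite addNr.
- by exists m; rewrite -iterSr /= hm ad0.
Qed.
Lemma NFX j : i != j -> NF (E j).
Proof.
move=> ij; split; [exact: spanTX | by rewrite sdX (negbTE ij) |].
have [[_ sE _] _] := HU; have [s0 s1] := sE i j ij.
case: (ca_off a ij) => e.
  by exists 1%N; rewrite /= /ad (twX HU) e mulr0 expr0z scale1r s0 ?subrr.
have e1 : sg false * -1 = 1 by [].
have e2 : qF ^ (sg false * 2) = qF^-1 ^+ 2 by rewrite mulN1r -invr_expz exprVn.
have adj : ad (E j) = (- qF) *: (E i * E j) + E j * E i.
  by rewrite /ad (twX HU) e e1 expr1z -scalerAr scaleNr addrC.
exists 2; rewrite /= adj /ad tw_lin !(twM HU false i (E _)) !(twX HU) e ca_diag.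
rewrite e1 e2 expr1z; transitivity (0 : A) => //; rewrite -(s1 e).
rewrite -!scalerAr -!scalerAl !mulrDr !mulrDl -!scalerAr -!scalerAl !mulrA.
by lin_eq F A; field.
Qed.

Definition dec x := exists k (u : nat -> A), [/\ forall m, NF (u m),
   forall m, (k <= m)%N -> u m = 0 & x = \sum_(m < k) E i ^+ m * u m].

Lemma dec_widen k l (u : nat -> A) : (forall m, (k <= m)%N -> u m = 0) ->
  (k <= l)%N -> \sum_(m < k) E i ^+ m * u m = \sum_(m < l) E i ^+ m * u m.
Proof.
move=> h /subnKC <-; rewrite big_split_ord /= [X in _ = _ + X]big1 ?addr0 // => m _.
by rewrite h ?leq_addr // mulr0.
Qed.

Lemma dec_lin c x y : dec x -> dec y -> dec (c *: x + y).
Proof.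
move=> [k [u [hu zu ->]]] [l [v [hv zv ->]]].
exists (maxn k l), (fun m => c *: u m + v m); split.
- by move=> m; apply: NF_lin.
- by move=> m; rewrite geq_max => /andP [h1 h2]; rewrite zu // zv // scaler0 addr0.
rewrite (dec_widen zu (leq_maxl k l)) (dec_widen zv (leq_maxr k l)).
rewrite scaler_sumr -big_split; apply: eq_bigr => m _ /=.
by rewrite mulrDr -scalerAr.
Qed.

Lemma dec_mulX j x : dec x -> dec (x * E j).
Proof.
move=> [k [u [hu zu ->]]]; case: (eqVneq i j) => [<-|ij]; last first.
  exists k, (fun m => u m * E j); split=> [m|m h|]; first exact: NFM (NFX ij).
  - by rewrite zu // mul0r.
  - by rewrite mulr_suml; apply: eq_bigr => m _; rewrite mulrA.
(* Since [u * E i = ad u + E i * tw false i u], a factor [E i] on the right contributes to the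
   coefficients of two consecutive powers. *)
exists k.+1, (fun m => ad (u m) + if m is m'.+1 then tw false i (u m') else 0); split.
- case=> [|m]; first by rewrite addr0; apply: NF_ad.
  by apply: NFD; [apply: NF_ad | apply: NF_tw].
- by case=> // m h; rewrite !zu ?ad0 ?tw0 ?addr0 // ltnW.
rewrite mulr_suml; under [RHS]eq_bigr do rewrite mulrDr.
rewrite big_split /= big_ord_recr /= zu // ad0 mulr0 addr0.
rewrite [X in _ = _ + X]big_ord_recl /= mulr0 add0r -big_split /=.
apply: eq_bigr => m _; rewrite /bump /= add1n exprSr -!mulrA -mulrDr /ad.
by rewrite subrK.
Qed.

Lemma dec_span x : spanT E x -> dec x.
Proof.
have dec0 : dec 0.
  by exists 0%N, (fun=> 0); split=> [m|//|]; [exact: NF0 | rewrite big_ord0].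
move: x; apply: span_ind => // [|w _]; first exact: dec_lin.
elim: w => [|j w IH] /=; last exact: dec_mulX.
exists 1%N, (fun m => if m is 0%N then 1 else 0); split=> [[|m]|[|m]|] //.
- exact: NF1.
- exact: NF0.
- by rewrite big_ord_recl big_ord0 /= expr0 mulr1 addr0.
Qed.

Lemma q2_neq1 : qF ^+ 2 - 1 != 0.
Proof. by rewrite subr_eq0 (q_nroot q). Qed.

Lemma sd_exp k u : NF u -> sd true i (E i ^+ k.+1 * u) =
  ((qF ^+ 2 ^+ k.+1 - 1) / (qF ^+ 2 - 1)) *: (E i ^+ k * tw true i u).
Proof.
move=> [su du _]; have sE := spanTX E i.
rewrite sdM //; last exact: spanTMX.
rewrite du mulr0 add0r scalerAl; congr (_ * _).
elim: k => [|k IH].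
  by rewrite expr1 sdX eqxx divff ?q2_neq1 // expr0 scale1r.
rewrite exprSr sdMX; last exact: spanTMX.
rewrite eqxx IH ca_diag mul1r -scalerAl -exprSr.
have -> : qF ^ (2 : int) = qF ^+ 2 by [].
have h := q2_neq1; rewrite -{1}[E i ^+ k.+1]scale1r scalerA -scalerDl.
by congr (_ *: _); rewrite [in RHS]exprSr; field.
Qed.

Lemma sd_sum (k : nat) (u : nat -> A) : (forall m, NF (u m)) ->
  sd true i (\sum_(m < k.+1) E i ^+ m * u m) =
  \sum_(m < k) E i ^+ m * (((qF ^+ 2 ^+ m.+1 - 1) / (qF ^+ 2 - 1)) *: tw true i (u m.+1)).
Proof.
move=> hu; rewrite big_ord_recl /= sdD expr0 mul1r; case: (hu 0%N) => _ -> _.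
rewrite add0r; elim/big_ind2: _ => [||m _]; first exact: sd0.
  by move=> x1 x2 y1 y2 <- <-; rewrite sdD.
by rewrite /bump /= add1n sd_exp // scalerAr.
Qed.

Lemma sd_coef_neq0 m : (qF ^+ 2 ^+ m.+1 - 1) / (qF ^+ 2 - 1) != 0.
Proof.
rewrite mulf_neq0 ?invr_eq0 ?q2_neq1 // subr_eq0 -exprM.
by rewrite (q_nroot q).
Qed.

Lemma NF_coef m u : NF u ->
  NF (((qF ^+ 2 ^+ m.+1 - 1) / (qF ^+ 2 - 1)) *: tw true i u).
Proof. by move=> hu; rewrite -[_ *: _]addr0; apply/NF_lin/NF0/NF_tw. Qed.

Lemma coef_eq0 m u :
  ((qF ^+ 2 ^+ m.+1 - 1) / (qF ^+ 2 - 1)) *: tw true i u = 0 -> u = 0.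
Proof.
move=> /eqP; rewrite scaler_eq0 (negbTE (sd_coef_neq0 m)) => /eqP h.
by rewrite -(twK HU false i u) h tw0.
Qed.

(** [sd true i] lowers the power of [E i] by one, with a coefficient that is nonzero because [q] is
    not a root of unity; induction on the number of terms applies. *)
Lemma NF_free k (u : nat -> A) : (forall m, NF (u m)) ->
  \sum_(m < k) E i ^+ m * u m = 0 -> forall m, (m < k)%N -> u m = 0.
Proof.
elim: k u => [|k IH] u hu h m //.
have h' : forall m, (m < k)%N -> u m.+1 = 0.
  move=> l hl; apply: (@coef_eq0 l); move: l hl.
  apply: IH => [l|]; first exact: NF_coef.
  by rewrite -(sd_sum _ hu) h sd0.
case: m => [_|m /h' //]; move: h; rewrite big_ord_recl big1 ?addr0 ?expr0 ?mul1r //.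
by move=> l _; rewrite lift0 h' ?mulr0.
Qed.

Lemma sd_eq0_NF x : spanT E x -> sd true i x = 0 -> NF x.
Proof.
move=> /dec_span [[|k] [u [hu zu ->]]] h; first by rewrite big_ord0; apply: NF0.
have z l : (l < k)%N -> u l.+1 = 0.
  move=> hl; apply: (@coef_eq0 l); move: l hl.
  apply: NF_free => [m|]; first exact: NF_coef.
  by rewrite -(sd_sum _ hu) h.
rewrite big_ord_recl expr0 mul1r big1 ?addr0; first exact: hu.
by move=> l _; rewrite lift0 z ?mulr0.
Qed.

(* An [E i]-, [F i]-primitive element of weight [N] for the node [i] is the
   extremal vector of a finite-dimensional [sl2]-module, whence the sign of [N]. *)
Lemma primitive_weight (N : int) x : spanT E x -> sd true i x = 0 -> sd false i x = 0 ->
  tw false i x = qF ^ (- N) *: x -> x <> 0 -> N <= 0.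
Proof.
move=> sx d1 d2 tx x0; have [_ _ [m0 hm0]] := sd_eq0_NF sx d1.
pose u m := iter m ad x.
have NFu m : NF (u m) by elim: m => [|m IH]; [apply: sd_eq0_NF | apply: NF_ad].
pose X := qF ^ (- N); pose s := qF^-1 ^+ 2.
have adZ c y : ad (c *: y) = c *: ad y.
  by rewrite -[c *: y]addr0 ad_lin ad0 addr0.
have tu m : tw false i (u m) = (X * s ^+ m) *: u m.
  elim: m => [|m IH]; first by rewrite mulr1.
  have := ad_tw false (u m); rewrite IH adZ.
  have -> : qF ^ (- sg false * 2) = qF ^+ 2 by [].
  move=> /(congr1 (fun y => s *: y)); rewrite !scalerA /s -exprMn mulVf //.
  by rewrite expr1n scale1r => <-; congr (_ *: _); rewrite [_ ^+ m.+1]exprS mulrCA.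
have s1 : 1 - s != 0.
  by rewrite subr_eq0 eq_sym /s exprVn invr_eq1 (q_nroot q).
have step m z : sd false i (u m) = z -> sd false i (u m.+1) =
    (1 - (X * s ^+ m) ^+ 2) *: u m + s *: (z * E i) - (X * s ^+ m) *: (E i * z).
  move=> ez; have [su _ _] := NFu m; have [st _ _] := NF_tw false (NFu m).
  have sE := spanTX E i.
  have -> : u m.+1 = (-1) *: (E i * tw false i (u m)) + u m * E i.
    by rewrite /u iterS /ad scaleN1r addrC.
  rewrite sd_lin sdMX // eqxx ca_diag sdM // sdX eqxx mul1r tu !sdZ.
  have -> : tw false i ((X * s ^+ m) *: u m) = (X * s ^+ m) *: tw false i (u m).
    by rewrite -[_ *: u m]addr0 tw_lin tw0 addr0.
  rewrite tu ez -scalerAr.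
  have -> : qF ^ (sg false * 2) = s by rewrite mulN1r -invr_expz /s exprVn.
  by lin_eq F A; ring.
(* The rank one computation: [sd false i] returns [u m.+1] to a multiple of [u m]. At the last
   nonzero [u m] this multiple has to vanish. *)
have hC m : sd false i (u m.+1) = ((1 - X ^+ 2 * s ^+ m) * (1 - s ^+ m.+1) / (1 - s)) *: u m.
  elim: m => [|m IH].
    rewrite (step 0%N 0) // mul0r mulr0; lin_eq F A; rewrite !(expr0, expr1); field; exact: s1.
  rewrite (step m.+1 _ IH) {1}[u m.+1]/u iterS -/(u m) /ad tu.
  have -> : u m.+1 = u m * E i - (X * s ^+ m) *: (E i * u m).
    by rewrite /u iterS /ad -/(u m) tu scalerAr.
  rewrite -!scalerAl -!scalerAr !exprS; lin_eq F A; field; exact: s1.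
have [m [um um1]] : exists m, u m.+1 = 0 /\ u m <> 0.
  elim: m0 hm0 => [/x0 //|m IH] hm; case: (pselect (u m = 0)) => [/IH //|h].
  by exists m.
have := hC m; rewrite um sd0 => /esym/eqP; rewrite scaler_eq0 => /orP [|/eqP //].
rewrite !mulf_eq0 invr_eq0 (negbTE s1) orbF => /orP [|]; last first.
  by rewrite subr_eq0 eq_sym /s -exprM exprVn invr_eq1 (negbTE (q_nroot q _)).
(* The vanishing factor gives [q^(-2N - 2m) = 1], whence [N = -m]. *)
have -> : X ^+ 2 * s ^+ m = qF ^ (- N * 2%:Z - (2 * m)%N%:Z).
  by rewrite /X /s -exprM exprVn exprnP exprz_exp expfzDr // -invr_expz -exprnP.
rewrite subr_eq0 eq_sym qexp_eq1 => /eqP h.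
by lia.
Qed.
End Adjoint.
End Nondegeneracy.

Lemma sum_fibers (V : nmodType) (T : Type) (S : eqType) (s : seq T) (g : T -> S) (f : T -> V) :
  \sum_(p <- s) f p = \sum_(c <- undup [seq g p | p <- s]) \sum_(p <- s | g p == c) f p.
Proof.
set r := undup _; have ur : uniq r by exact: undup_uniq.
have : all (fun p => g p \in r) s.
  have : all (fun p => g p \in [seq g p | p <- s]) s.
    elim: s {r ur} => //= p s IH; rewrite mem_head /=; apply: sub_all IH => x h.
    by rewrite inE h orbT.
  by apply: sub_all => p; rewrite mem_undup.
move: r ur => u; elim: s u => [|p s IH] u uu hs.
  by rewrite big_nil big1 // => c _; rewrite big_nil.
case/andP: hs => hp hs; rewrite big_cons (IH u) //.
under [RHS]eq_bigr do rewrite big_cons.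
rewrite (bigD1_seq _ hp uu) [in RHS](bigD1_seq _ hp uu) /= eqxx addrA.
congr (_ + _); apply: eq_bigr => c; rewrite eq_sym => /negbTE -> //.
Qed.

Notation wspan E nu := (span (fun w => wt w = nu) E).

(** * Weight spaces and nondegeneracy *)

Section Nondegeneracy.
Variables (F : fieldType) (n : nat) (a : gcm n) (q : qpar F).
Notation I := 'I_n.
Notation qF := (q : F).
Variables (A : algType F) (E G K L : I -> A) (HU : isU a q E G K L).
Let q0 := q_neq0 q.
Notation sd := (sd HU).
Notation tw := (tw K L).
Notation pr := (pr HU).
Notation cst := (cst HU).

Lemma homT nu x : wspan E nu x -> spanT E x.
Proof. exact: span_sub. Qed.

Lemma hom_mulX nu j x : wspan E nu x -> wspan E (nu + sr j) (x * E j).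
Proof.
move: x; apply: span_ind => [|c x y hx hy|w hw].
- by rewrite mul0r; apply: span0.
- by rewrite mulrDl -scalerAl; apply: span_lin.
- by apply: (@span_wd _ _ _ _ _ (j :: w)); rewrite wt_cons hw addrC.
Qed.

Lemma hom_sd b i nu x : wspan E nu x -> wspan E (nu - sr i) (sd b i x).
Proof.
move: x; apply: span_ind => [|c x y hx hy|w <-].
- by rewrite sd0; apply: span0.
- by rewrite sd_lin; apply: span_lin.
elim: w => [|j w IH]; first by rewrite sd1; apply: span0.
rewrite sd_cons [_ + _ *: _]addrC wt_cons; apply: span_lin; last first.
  case: eqP => [->|_]; last exact: span0.
  by rewrite addrAC subrr add0r; apply: span_wd.
have -> : sr j + wt w - sr i = wt w - sr i + sr j by rewrite [sr j + _]addrC addrAC.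
exact: hom_mulX.
Qed.

Lemma hom_tw b i nu x : wspan E nu x ->
  tw b i x = qF ^ (sg b * \sum_j a i j * nu j) *: x.
Proof.
move: x; apply: span_ind => [|c x y hx hy|w <-]; first by rewrite tw0 scaler0.
  by rewrite tw_lin hx hy; lin_eq F A; ring.
by rewrite (tw_wd HU) wp_wt.
Qed.

Lemma hom_neq0 nu x : wspan E nu x -> x <> 0 -> exists w, wt w = nu.
Proof.
move=> [[|p s] [hs ->]]; first by rewrite big_nil.
by exists p.2; apply: hs; rewrite mem_head.
Qed.

Lemma cst_mulX x j : spanT E x -> cst (x * E j) = 0.
Proof.
move: x; apply: span_ind => [|c x y hx hy|w _].
- by rewrite mul0r cst0.
- by rewrite mulrDl -scalerAl cst_lin hx hy mulr0 addr0.
- exact: (cst_wd HU (j :: w)).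
Qed.

Lemma cst_sd i x : spanT E x -> cst (sd false i x) = cst (sd true i x).
Proof.
move: x; apply: span_ind => [|c x y hx hy|w _]; first by rewrite !sd0.
  by rewrite !sd_lin !cst_lin hx hy.
case: w => [|j w]; first by rewrite !sd1.
have sw := spanT_wd E w.
rewrite !sd_cons ![(if _ then _ else _) + _]addrC !cst_lin.
by rewrite !cst_mulX ?mulr0 //; apply: sd_span.
Qed.

Lemma pr_hom nu v x : wspan E nu x -> wt v <> nu -> pr v x = 0.
Proof.
elim: v nu x => [|i v IH] nu x hx hv /=; last first.
  by apply: (IH (nu - sr i)); [apply: hom_sd | move=> e; apply: hv; rewrite wt_cons e addrC subrK].
move: x hx; apply: span_ind => [|c x y hx hy|w hw]; first exact: cst0.
  by rewrite cst_lin hx hy mulr0 addr0.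
by rewrite cst_wd; case: w hw => // hw; case: hv.
Qed.

(** By definition of [pr], [sd true i] puts a letter in front of the word. The q-commutation
    [sd_comm] carries [sd false i] past all letters, to the end of the word. *)
Lemma pr_sd i v x : spanT E x ->
  pr v (sd false i x) = qF ^ (- wp a i v) * pr (rcons v i) x.
Proof.
elim: v x => [|j v IH] x sx /=.
  by rewrite cst_sd // /wp big_nil oppr0 expr0z mul1r.
rewrite sd_comm // prZ IH; last exact: sd_span.
by rewrite wp_cons opprD expfzDr // mulrA.
Qed.

Lemma pr_tw b i v x : spanT E x ->
  pr v (tw b i x) = qF ^ (sg b * wp a i v) * pr v x.
Proof.
elim: v x => [|j v IH] x sx /=; last first.
  rewrite sd_tw // prZ IH; last exact: sd_span.
  by rewrite wp_cons mulrDr expfzDr // mulrA (ca_sym a i j).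
move: x sx; apply: span_ind => [|c x y hx hy|w _]; first by rewrite tw0 cst0 mulr0.
  by rewrite tw_lin !cst_lin hx hy; ring.
rewrite (tw_wd HU) -[_ *: _]addr0 cst_lin cst0 addr0 cst_wd.
by case: w => [|j w] //; rewrite !mulr0.
Qed.

(** By induction on the height both skew derivatives of [x] vanish at every node. If [x] is nonzero,
    [primitive_weight] makes [nu] pair nonpositively with each simple root; as [nu] has nonnegative
    coordinates, its norm is then nonpositive, so [nu = 0], against its positive height. *)
Lemma pr_nondeg_hom k (nu : {ffun I -> int}) x : \sum_i nu i = k%:Z -> wspan E nu x ->
  (forall v, pr v x = 0) -> x = 0.
Proof.
elim: k nu x => [|k IH] nu x hk hx hpr.
  have -> : x = cst x *: 1.
    move: x hx {hpr}; apply: span_ind => [|c x y hx hy|w hw].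
    - by rewrite cst0 scale0r.
    - by rewrite cst_lin {1}hx {1}hy scalerDl scalerA.
    have := wt_size w; rewrite hw hk => [[/esym/size0nil ->]].
    by rewrite cst_wd eqxx scale1r.
  by have := hpr [::]; rewrite /= => ->; rewrite scale0r.
have sx := homT hx.
have hk' i : \sum_j (nu - sr i) j = k%:Z.
  under eq_bigr do rewrite !ffunE; rewrite sumrB hk.
  have -> : \sum_j ((j == i)%:Z : int) = 1.
    by rewrite (bigD1 i) //= eqxx big1 ?addr0 // => j /negbTE ->.
  by rewrite intS addrC addKr.
have d1 i : sd true i x = 0.
  by apply: (IH _ _ (hk' i) (hom_sd true i hx)) => v; apply: (hpr (i :: v)).
have d2 i : sd false i x = 0.
  apply: (IH _ _ (hk' i) (hom_sd false i hx)) => v.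
  by rewrite pr_sd // hpr mulr0.
apply: contrapT => x0; have [w hw] := hom_neq0 hx x0.
have neg i : \sum_j a i j * nu j <= 0.
  apply: (primitive_weight sx (d1 i) (d2 i) _ x0).
  by rewrite (hom_tw _ _ hx) mulN1r.
have := @ca_pos _ a nu.
have -> : \sum_i \sum_j a i j * nu i * nu j = \sum_i nu i * \sum_j a i j * nu j.
  apply: eq_bigr => i _; rewrite mulr_sumr; apply: eq_bigr => j _; ring.
case: (leP (\sum_i nu i * \sum_j a i j * nu j) 0) => [_ /(_ isT) h|].
  by move: hk; rewrite h big1 // => i _; rewrite ffunE.
rewrite ltNge; case/negP; apply: sumr_le0 => i _.
by rewrite mulr_ge0_le0 // -hw wt_ge0.
Qed.

Theorem pr_nondeg x : spanT E x -> (forall v, pr v x = 0) -> x = 0.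
Proof.
move=> [s [_ ->]] hpr; rewrite (sum_fibers _ (fun p => wt p.2)).
apply: big1_seq => nu /andP [_]; rewrite mem_undup => /mapP [p0 _ hp0].
set y := \sum_(p <- s | _) _.
have hy : wspan E nu y.
  exists [seq p <- s | wt p.2 == nu]; split; last by rewrite big_filter.
  by move=> p; rewrite mem_filter => /andP [/eqP].
apply: (@pr_nondeg_hom (size p0.2) nu) => //; first by rewrite hp0 wt_size.
move=> v; case: (eqVneq (wt v) nu) => [hv|/eqP hv]; last exact: pr_hom hy hv.
rewrite -[RHS](hpr v) [X in _ = pr v X](bigID (fun p => wt p.2 == nu)) /= prD.
rewrite [X in _ = _ + X](_ : _ = 0) ?addr0 // -big_filter pr_sum big1_seq // => p.
rewrite mem_filter => /andP [_ /andP [/eqP h _]]; rewrite prZ.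
rewrite (@pr_hom (wt p.2) v) ?mulr0 //; first exact: span_wd.
by move=> e; apply: h; rewrite -e.
Qed.

Lemma pr_inj x y : spanT E x -> spanT E y -> (forall v, pr v x = pr v y) -> x = y.
Proof.
move=> hx hy h; apply/eqP; rewrite -subr_eq0; apply/eqP; apply: pr_nondeg.
  exact/spanD/spanN.
by move=> v; rewrite prD prN h subrr.
Qed.
End Nondegeneracy.

Section Characters.
Variables (F : fieldType) (n : nat) (q : qpar F) (V : lmodType F).
Notation I := 'I_n.
Notation qF := (q : F).
Notation Z := ({ffun I -> int}).
Definition dot (t k : Z) : int := \sum_i t i * k i.

Lemma dotDl t u k : dot (t + u) k = dot t k + dot u k.
Proof. by rewrite -big_split; apply: eq_bigr => i _; rewrite ffunE mulrDl. Qed.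
Lemma dotDr t k l : dot t (k + l) = dot t k + dot t l.
Proof. by rewrite -big_split; apply: eq_bigr => i _; rewrite ffunE mulrDr. Qed.
Lemma dotNr t k : dot t (- k) = - dot t k.
Proof. by rewrite -sumrN; apply: eq_bigr => i _; rewrite ffunE mulrN. Qed.
Lemma dotNl t k : dot (- t) k = - dot t k.
Proof. by rewrite -sumrN; apply: eq_bigr => i _; rewrite ffunE mulNr. Qed.
Lemma dotC t k : dot t k = dot k t.
Proof. by apply: eq_bigr => i _; rewrite mulrC. Qed.
Lemma dot_sr i k : dot (sr i) k = k i.
Proof. by rewrite -[RHS](sum_sr k i); apply: eq_bigr => j _; rewrite mulrC. Qed.

(* Dedekind independence of the characters [t |-> q ^ dot t k], tested on the
   nonnegative cone only. *)
Lemma char_indep (s : seq Z) (v : Z -> V) : uniq s ->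
  (forall t : Z, (forall i, 0 <= t i) -> \sum_(k <- s) qF ^ dot t k *: v k = 0) ->
  forall k, k \in s -> v k = 0.
Proof.
elim: s v => [|k s IH] v //= /andP [ks us] h.
have hs l : l \in s -> v l = 0.
  move=> hl; have kl : k != l by apply: contraNneq ks => ->.
  have [i ki] : exists i, k i != l i.
    apply/existsP; apply: contraR kl; rewrite negb_exists => /forallP e.
    by apply/eqP/ffunP => i; have := e i; rewrite negbK => /eqP.
  have c0 : qF ^ l i - qF ^ k i != 0.
    by rewrite subr_eq0; apply: contra ki => /eqP/qexp_inj ->.
  have : (qF ^ l i - qF ^ k i) *: v l = 0.
    apply: (IH (fun m => (qF ^ m i - qF ^ k i) *: v m)) => // t ht.
    have h1 := h t ht; have h2 : \sum_(m <- k :: s) qF ^ dot (t + sr i) m *: v m = 0.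
      by apply: h => j; rewrite !ffunE addr_ge0 //; case: eqP.
    have -> : \sum_(m <- s) qF ^ dot t m *: ((qF ^ m i - qF ^ k i) *: v m) =
       \sum_(m <- k :: s) qF ^ dot (t + sr i) m *: v m -
         qF ^ k i *: \sum_(m <- k :: s) qF ^ dot t m *: v m.
      rewrite scaler_sumr -sumrB big_cons -[LHS]add0r; congr (_ + _).
        rewrite dotDl dot_sr expfzDr ?q_neq0 // scalerA -scalerBl.
        by rewrite mulrC subrr scale0r.
      apply: eq_bigr => m _; rewrite dotDl dot_sr expfzDr ?q_neq0 //.
      by lin_eq F V; ring.
    by rewrite h1 h2 scaler0 subr0.
  by move/eqP; rewrite scaler_eq0 (negbTE c0) => /eqP.
move=> l; rewrite inE => /orP [/eqP ->|/hs //].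
have := h 0 (fun i => _); rewrite big_cons big1_seq => [|m /andP [_ /hs ->]]; last by rewrite scaler0.
rewrite addr0 => /(_ _)/eqP; rewrite scaler_eq0 (negbTE (qexp_neq0 _ _)) => hh.
by apply/eqP/hh => i; rewrite ffunE.
Qed.
End Characters.

(** * Triangular decomposition *)

Section Lattice.
Variable n : nat.
Notation I := 'I_n.
Notation Z := ({ffun I -> int}).

Lemma lattice_ind (P : Z -> Prop) : P 0 -> (forall k i, P k -> P (k + sr i)) ->
  (forall k i, P k -> P (k - sr i)) -> forall k, P k.
Proof.
move=> P0 Pa Ps k; have [N] := ubnP (\sum_i `|k i|%N).
elim: N k => // N IH k hk; case: (pselect (exists i, k i <> 0)) => [[i ki]|h]; last first.
  suff -> : k = 0 by [].
  by apply/ffunP => i; rewrite ffunE; apply: contrapT => ki; apply: h; exists i.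
have step (l : Z) : (`|l i| < `|k i|)%N -> (forall j, j != i -> l j = k j) -> P l.
  move=> h1 h2; apply: IH; rewrite -ltnS; apply: leq_trans hk; rewrite ltnS.
  rewrite (bigD1 i) //= [X in (_ < X)%N](bigD1 i) //= -addSn leq_add //.
  by apply: leq_sum => j /h2 ->.
case: (ltP 0 (k i)) => hi.
  rewrite -[k](subrK (sr i)); apply: Pa; apply: step => [|j ji].
    by move: ki hi; rewrite !ffunE eqxx /=; lia.
  by rewrite !ffunE (negbTE ji) subr0.
rewrite -[k](addrK (sr i)); apply: Ps; apply: step => [|j ji].
  by move: ki hi; rewrite !ffunE eqxx /=; lia.
by rewrite !ffunE (negbTE ji) addr0.
Qed.

Variable a : gcm n.
Definition ap (k : Z) j : int := \sum_i k i * a i j.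
Lemma apD k l j : ap (k + l) j = ap k j + ap l j.
Proof. by rewrite -big_split; apply: eq_bigr => i _; rewrite ffunE mulrDl. Qed.
Lemma apN k j : ap (- k) j = - ap k j.
Proof. by rewrite -sumrN; apply: eq_bigr => i _; rewrite ffunE mulNr. Qed.
Lemma ap0 j : ap 0 j = 0.
Proof. by rewrite /ap big1 // => i _; rewrite ffunE mul0r. Qed.
Lemma ap_sr i j : ap (sr i) j = a i j.
Proof. by rewrite -[RHS](sum_sr (a^~ j) i); apply: eq_bigr => k _; rewrite mulrC. Qed.
Lemma ap_wt w j : ap (wt w) j = wp a j w.
Proof. by rewrite wp_wt; apply: eq_bigr => i _; rewrite mulrC ca_sym. Qed.
Definition bf (k l : Z) : int := \sum_j ap k j * l j.
Lemma bfDl k l m : bf (k + l) m = bf k m + bf l m.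
Proof. by rewrite -big_split; apply: eq_bigr => i _; rewrite apD mulrDl. Qed.
Lemma bfDr m k l : bf m (k + l) = bf m k + bf m l.
Proof. by rewrite -big_split; apply: eq_bigr => i _; rewrite ffunE mulrDr. Qed.
Lemma bfNl k l : bf (- k) l = - bf k l.
Proof. by rewrite -sumrN; apply: eq_bigr => i _; rewrite apN mulNr. Qed.
Lemma bfNr k l : bf k (- l) = - bf k l.
Proof. by rewrite -sumrN; apply: eq_bigr => i _; rewrite ffunE mulrN. Qed.
Lemma bf0l l : bf 0 l = 0.
Proof. by rewrite /bf big1 // => j _; rewrite ap0 mul0r. Qed.
Lemma bf0r l : bf l 0 = 0.
Proof. by rewrite /bf big1 // => j _; rewrite ffunE mulr0. Qed.
Lemma bf_srr k i : bf k (sr i) = ap k i.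
Proof. exact: sum_sr. Qed.
Lemma bf_srl k i : bf (sr i) k = ap k i.
Proof.
by apply: eq_bigr => j _; rewrite ap_sr mulrC (ca_sym a i j).
Qed.
End Lattice.

Section LamPower.
Variables (F : fieldType) (n : nat).
Notation Z := ({ffun 'I_n -> int}).
Definition lamk (lam : 'I_n -> F) (k : Z) : F := \prod_i lam i ^ k i.
Lemma lamkD lam k l : (forall i, lam i != 0) -> lamk lam (k + l) = lamk lam k * lamk lam l.
Proof.
by move=> h; rewrite -big_split; apply: eq_bigr => i _; rewrite ffunE expfzDr.
Qed.
Lemma lamk0 lam : lamk lam 0 = 1.
Proof. by rewrite /lamk big1 // => i _; rewrite ffunE expr0z. Qed.
Lemma lamk_sr lam i : lamk lam (sr i) = lam i.
Proof.
rewrite /lamk (bigD1 i) //= ffunE eqxx expr1z big1 ?mulr1 // => j ji.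
by rewrite ffunE (negbTE ji) expr0z.
Qed.
Lemma lamkN lam k : (forall i, lam i != 0) -> lamk lam (- k) = (lamk lam k)^-1.
Proof. by move=> h; rewrite -prodfV; apply: eq_bigr => i _; rewrite ffunE invr_expz. Qed.
End LamPower.

Section Torus.
Variables (F : fieldType) (n : nat) (a : gcm n) (q : qpar F).
Notation I := 'I_n.
Notation qF := (q : F).
Notation Z := ({ffun I -> int}).
Variables (A : algType F) (E G K L : I -> A) (HU : isU a q E G K L).
Let q0 := q_neq0 q.
Let U0 : urel0 a q E G K L. Proof. by case: HU => [[]]. Qed.

Definition Kp i (z : int) : A := if z is Posz m then K i ^+ m else L i ^+ (absz z).
Definition Kk (k : Z) : A := \prod_(j <- enum 'I_n) Kp j (k j).

Lemma Kk0 : Kk 0 = 1.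
Proof. by rewrite /Kk big1 // => i _; rewrite ffunE. Qed.

Lemma Kp_comm i j z : K i * Kp j z = Kp j z * K i.
Proof.
case: z => m /=; apply: commrX; rewrite /GRing.comm; first exact: (uKK U0).
exact: (uKL_comm U0).
Qed.

Lemma KpS i z : Kp i (z + 1) = K i * Kp i z.
Proof.
case: z => [m|[|m]].
- by rewrite -PoszD addn1 /= exprS.
- by rewrite NegzE addNr /= expr1 (uKL U0).
have -> : Negz m.+1 + 1 = Negz m by lia.
by rewrite /= [in RHS]exprS mulrA (uKL U0) mul1r.
Qed.

Lemma KkS k i : Kk (k + sr i) = K i * Kk k.
Proof.
rewrite /Kk; suff h (r : seq I) : uniq r -> \prod_(j <- r) Kp j ((k + sr i) j) =
   (if i \in r then K i else 1) * \prod_(j <- r) Kp j (k j).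
  by rewrite h ?enum_uniq // mem_enum.
elim: r => [|j r IH] /=; first by rewrite !big_nil mulr1.
case/andP=> jr ur; rewrite !big_cons IH // inE !ffunE.
case: (eqVneq i j) jr => [<-|ij] jr /=; first by rewrite (negbTE jr) mul1r KpS mulrA.
by rewrite addr0 !mulrA; case: ifP => _; rewrite ?mulr1 ?mul1r // Kp_comm.
Qed.
Lemma KkB k i : Kk (k - sr i) = L i * Kk k.
Proof. by rewrite -{2}[k](subrK (sr i)) KkS mulrA (uLK U0) mul1r. Qed.
Lemma KkD k l : Kk (k + l) = Kk k * Kk l.
Proof.
elim/lattice_ind: k => [|k i IH|k i IH]; first by rewrite Kk0 add0r mul1r.
  by rewrite addrAC !KkS IH mulrA.
by rewrite addrAC !KkB IH mulrA.
Qed.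
Lemma Kk_sr i : Kk (sr i) = K i.
Proof. by rewrite -[sr i]add0r KkS Kk0 mulr1. Qed.
Lemma KkC k l : Kk k * Kk l = Kk l * Kk k.
Proof. by rewrite -!KkD addrC. Qed.
Lemma KkE k j : Kk k * E j = qF ^ ap a k j *: (E j * Kk k).
Proof.
elim/lattice_ind: k => [|k i IH|k i IH].
- by rewrite Kk0 mul1r mulr1 ap0 expr0z scale1r.
- rewrite KkS -mulrA IH -scalerAr [K i * (_ * _)]mulrA (uKE U0) -scalerAl scalerA -mulrA -KkS.
  by rewrite apD ap_sr expfzDr.
- rewrite KkB -mulrA IH -scalerAr [L i * (_ * _)]mulrA (uLE q0 U0) -scalerAl scalerA -mulrA -KkB.
  by rewrite apD apN ap_sr expfzDr.
Qed.

Lemma act_Kk (V : lmodType F) hV (lam : I -> F) (lam0 : forall i, lam i != 0)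
    (f : sfn a q V) k w :
  act HU hV lam0 (Kk k) f w = (lamk lam k * qF ^ (- bf a k (wt w))) *: f w.
Proof.
elim/lattice_ind: k => [|k i IH|k i IH].
- by rewrite Kk0 act1 lamk0 bf0l oppr0 expr0z mulr1 scale1r.
- rewrite KkS actM actK IH scalerA; congr (_ *: _).
  rewrite lamkD // lamk_sr bfDl bf_srl ap_wt opprD expfzDr //; ring.
- rewrite KkB actM actL IH scalerA; congr (_ *: _).
  rewrite lamkD // lamkN // lamk_sr bfDl bfNl bf_srl ap_wt opprD opprK expfzDr //; ring.
Qed.
Lemma act_Kk_nil (V : lmodType F) hV (lam : I -> F) (lam0 : forall i, lam i != 0)
    (f : sfn a q V) k :
  act HU hV lam0 (Kk k) f [::] = lamk lam k *: f [::].
Proof. by rewrite act_Kk wt_nil bf0r oppr0 expr0z mulr1. Qed.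
End Torus.

Section Triangular.
Variables (F : fieldType) (n : nat) (a : gcm n) (q : qpar F).
Notation I := 'I_n.
Notation qF := (q : F).
Notation Z := ({ffun I -> int}).
Variables (A : algType F) (E G K L : I -> A) (HU : isU a q E G K L).
Let q0 := q_neq0 q.
Let U0 : urel0 a q E G K L. Proof. by case: HU => [[]]. Qed.
Notation HU' := (isU_swap (q_neq0 q) HU).
Notation Kk := (Kk K L).

(** Images of [G i] vanish at the empty word, so only the constant term of [y] is seen there. *)
Lemma act_spanG_nil (V : lmodType F) hV (lam : I -> F) (lam0 : forall i, lam i != 0)
    (f : sfn a q V) y : spanT G y ->
  act HU hV lam0 y f [::] = cst HU' y *: f [::].
Proof.
move=> hy; move: y hy f; apply: span_ind => [f|c x y hx hy f|w _].
- by rewrite act0 cst0 scale0r.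
- by rewrite actD actZ sfnDE sfnZE hx hy cst_lin scalerDl scalerA.
elim/last_ind: w => [|w i IH] f; first by rewrite (cst_wd HU' [::]) scale1r /= act1.
rewrite cst_wd -cats1 wd_cat /= mul1r actM actG_nil.
have -> : (w ++ [:: i] == [::]) = false by case: (w).
by rewrite scale0r.
Qed.

Lemma KG_wd i w : K i * wd G w = qF ^ (- wp a i w) *: (wd G w * K i).
Proof.
have := tw_wd HU' false i w; rewrite /tw mulN1r scalerAl => <-.
by rewrite -!mulrA (uLK U0) mulr1.
Qed.
Lemma LG_wd i w : L i * wd G w = qF ^ (wp a i w) *: (wd G w * L i).
Proof.
have := tw_wd HU' true i w; rewrite /tw mul1r scalerAl => <-.
by rewrite -!mulrA (uKL U0) mulr1.
Qed.

Lemma commE i y : spanT G y -> E i * y - y * E i =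
  (qF - qF^-1)^-1 *: (sd HU' false i y * K i - sd HU' true i y * L i).
Proof. exact: (commG HU'). Qed.

Definition tri (x : A) := exists s : seq (F * (seq I * Z * seq I)),
  x = \sum_(p <- s) p.1 *: (wd G p.2.1.1 * Kk p.2.1.2 * wd E p.2.2).

Lemma tri_lin c x y : tri x -> tri y -> tri (c *: x + y).
Proof.
move=> [s ->] [t ->]; exists ([seq (c * p.1, p.2) | p <- s] ++ t).
rewrite big_cat big_map scaler_sumr; congr (_ + _).
by apply: eq_bigr => p _; rewrite scalerA.
Qed.
Lemma tri0 : tri 0. Proof. by exists [::]; rewrite big_nil. Qed.
Lemma triZ c x : tri x -> tri (c *: x).
Proof. by move=> h; rewrite -[_ *: _]addr0; apply/tri_lin/tri0. Qed.
Lemma tri_mono w k v : tri (wd G w * Kk k * wd E v).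
Proof. by exists [:: (1, (w, k, v))]; rewrite big_seq1 scale1r. Qed.
Lemma tri_span y k v : spanT G y -> tri (y * Kk k * wd E v).
Proof.
move: y; apply: span_ind => [|c x y hx hy|w _]; last exact: tri_mono.
  by rewrite !mul0r; apply: tri0.
by rewrite !mulrDl -!scalerAl; apply: tri_lin.
Qed.

Lemma tri_ind (P : A -> Prop) : P 0 -> (forall c x y, P x -> P y -> P (c *: x + y)) ->
  (forall w k v, P (wd G w * Kk k * wd E v)) -> forall x, tri x -> P x.
Proof.
move=> P0 Pl Pm x [s ->]; elim: s => [|p s IH]; rewrite ?big_nil // big_cons.
exact: Pl.
Qed.

Lemma triangular x : tri x.
Proof.
move: x; apply: (gen_left_ind HU); first by have := tri_mono [::] 0 [::]; rewrite /= (Kk0 K L) !mulr1.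
  exact: tri_lin.
move=> i x; move: x.
have main : forall w k v, let m := wd G w * Kk k * wd E v in
    [/\ tri (E i * m), tri (G i * m), tri (K i * m) & tri (L i * m)].
  move=> w k v /=; split; rewrite !mulrA.
  - have -> : E i * wd G w = wd G w * E i + (qF - qF^-1)^-1 *:
       (sd HU' false i (wd G w) * K i - sd HU' true i (wd G w) * L i).
      by rewrite -(commE _ (spanT_wd G w)) addrC subrK.
    rewrite !mulrDl -[X in tri (X + _)]scale1r; apply: tri_lin.
      have -> : wd G w * E i * Kk k = qF ^ (- ap a k i) *: (wd G w * Kk k * E i).
        rewrite -[wd G w * Kk k * _]mulrA (KkE HU) -scalerAr scalerA -expfzDr // addNr.
        by rewrite expr0z scale1r mulrA.
      rewrite -scalerAl -[_ * E i * wd E v]mulrA.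
      have -> : E i * wd E v = wd E (rcons v i) by rewrite -cats1 wd_cat /= mul1r.
      exact/triZ/tri_mono.
    rewrite -!scalerAl; apply: triZ; rewrite !mulrBl.
    have e1 y : y * K i * Kk k = y * Kk (k + sr i) by rewrite (KkS HU) mulrA.
    have e2 y : y * L i * Kk k = y * Kk (k - sr i) by rewrite (KkB HU) mulrA.
    rewrite e1 e2 addrC -scaleN1r; apply: tri_lin.
      by apply/tri_span/sd_span/spanT_wd.
    by apply/tri_span/sd_span/spanT_wd.
  - have -> : G i * wd G w = wd G (rcons w i) by rewrite -cats1 wd_cat /= mul1r.
    exact: tri_mono.
  - rewrite KG_wd -!scalerAl -[wd G w * K i * _]mulrA -(KkS HU).
    exact/triZ/tri_mono.
  - rewrite LG_wd -!scalerAl -[wd G w * L i * _]mulrA -(KkB HU).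
    exact/triZ/tri_mono.
apply: tri_ind => //; first by rewrite !mulr0; split; apply: tri0.
move=> c x y [h1 h2 h3 h4] [h1' h2' h3' h4'].
by rewrite !mulrDr -!scalerAr; split; apply: tri_lin.
Qed.
End Triangular.

(** * Faithfulness *)

Lemma independent_subfamily (F : fieldType) (V : lmodType F) (s : seq V) :
  exists r : seq V, [/\ {subset r <= s},
    forall c : nat -> F, \sum_(i < size r) c i *: nth 0 r i = 0 ->
       forall i, (i < size r)%N -> c i = 0
    & forall x, x \in s -> exists c : nat -> F, x = \sum_(i < size r) c i *: nth 0 r i].
Proof.
elim: s => [|x s [r [rs ri rg]]].
  by exists [::]; split=> // x; rewrite inE.
case: (pselect (exists c : nat -> F, x = \sum_(i < size r) c i *: nth 0 r i)) => hx.
  exists r; split=> // [y /rs h|y]; first by rewrite inE h orbT.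
  by rewrite inE => /orP [/eqP ->|/rg].
exists (x :: r); split=> [y|c|y].
- by rewrite !inE => /orP [->|/rs ->]; rewrite ?orbT.
- rewrite /= big_ord_recl /= => h.
  have c0 : c 0%N = 0.
    apply: contrapT => /eqP c0; apply: hx.
    exists (fun i => - (c 0%N)^-1 * c i.+1).
    rewrite -[LHS](scalerK c0) (eq_bigr (fun i : 'I_(size r) =>
      - (c 0%N)^-1 *: (c i.+1 *: nth 0 r i))) => [|i _]; last by rewrite scalerA.
    rewrite -scaler_sumr scaleNr -scalerN; congr (_ *: _).
    by apply/eqP; rewrite -addr_eq0; apply/eqP.
  move: h; rewrite c0 scale0r add0r => h.
  by case=> [//|i] hi; apply: (ri (fun i => c i.+1)).
- pose sh (c : nat -> F) (i : nat) : F := if i is j.+1 then c j else 0.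
  have main (c : nat -> F) : \sum_(i < size (x :: r))
     sh c i *: nth 0 (x :: r) i = \sum_(i < size r) c i *: nth 0 r i.
    by rewrite big_ord_recl /= scale0r add0r.
  rewrite inE => /orP [/eqP ->|/rg [c ->]]; last first.
    by exists (sh c); rewrite main.
  exists (fun i => (i == 0%N)%:R); rewrite big_ord_recl /= scale1r big1 ?addr0 // => i _.
  by rewrite scale0r.
Qed.

Lemma sum_subsr n (k : {ffun 'I_n -> int}) i : \sum_j (k - sr i) j = \sum_j k j - 1.
Proof.
under eq_bigr do rewrite !ffunE; rewrite sumrB; congr (_ - _).
by rewrite (bigD1 i) //= eqxx big1 ?addr0 // => j /negbTE ->.
Qed.

Section Faithful.
Variables (F : fieldType) (n : nat) (a : gcm n) (q : qpar F).
Notation I := 'I_n.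
Notation qF := (q : F).
Notation Z := ({ffun I -> int}).
Variables (A : algType F) (E G K L : I -> A) (HU : isU a q E G K L).
Let q0 := q_neq0 q.
Notation HU' := (isU_swap (q_neq0 q) HU).
Notation Kk := (Kk K L).

Definition qlam (t : Z) (i : I) : F := qF ^ t i.
Fact qlam_neq0 t i : qlam t i != 0. Proof. exact: qexp_neq0. Qed.
Lemma lamk_qlam t k : lamk (qlam t) k = qF ^ dot t k.
Proof.
rewrite /lamk /dot; elim/big_rec2: _ => [|i x y _ ->]; first by rewrite expr0z.
by rewrite expfzDr // exprz_exp.
Qed.

Notation actA t := (act HU (nzA A) (qlam_neq0 t)).
Definition kills (u : A) := forall t : Z, (forall i, 0 <= t i) ->
  forall f, actA t u f = 0.

(** A filtration of the [G] half, with zero intersection by nondegeneracy. The coefficients of an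
    element that acts by zero are pushed down through it one step at a time. *)
Definition low m (y : A) := spanT G y /\ forall v, (size v < m)%N -> pr HU' v y = 0.

Lemma low_lin m c x y : low m x -> low m y -> low m (c *: x + y).
Proof.
move=> [sx hx] [sy hy]; split; first exact: span_lin.
by move=> v hv; rewrite pr_lin hx // hy // mulr0 addr0.
Qed.
Lemma low0 m : low m 0.
Proof. by split=> [|v _]; [apply: span0 | apply: pr0]. Qed.
Lemma lowZ m c x : low m x -> low m (c *: x).
Proof. by move=> h; rewrite -[_ *: _]addr0; apply/low_lin/low0. Qed.
Lemma lowB m x y : low m x -> low m y -> low m (x - y).
Proof. by move=> hx hy; rewrite addrC -scaleN1r; apply: low_lin. Qed.
Lemma low_le m k y : (m <= k)%N -> low k y -> low m y.
Proof. by move=> mk [h1 h2]; split=> // v hv; apply: h2; apply: leq_trans mk. Qed.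
Lemma low_sd b i m y : low m.+1 y -> low m (sd HU' b i y).
Proof.
move=> [sy hy]; split; first exact: sd_span.
move=> v hv; case: b; first exact: (hy (i :: v)).
by rewrite pr_sd // hy ?mulr0 // size_rcons.
Qed.

Definition high m (u : A) := exists s : seq (A * Z * A),
  (forall p, p \in s -> low m p.1.1 /\ spanT E p.2) /\
  u = \sum_(p <- s) p.1.1 * Kk p.1.2 * p.2.

Lemma high_mono m y k x : low m y -> spanT E x -> high m (y * Kk k * x).
Proof.
by move=> hy hx; exists [:: (y, k, x)]; split=> [p|]; rewrite ?big_seq1 // inE => /eqP ->.
Qed.
Lemma highD m u v : high m u -> high m v -> high m (u + v).
Proof.
move=> [s [hs ->]] [t [ht ->]]; exists (s ++ t); rewrite big_cat; split=> // p.
by rewrite mem_cat => /orP [/hs|/ht].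
Qed.
Lemma high0 m : high m 0.
Proof. by exists [::]; split=> //; rewrite big_nil. Qed.
Lemma high_sum m T (r : seq T) (g : T -> A) :
  (forall t, high m (g t)) -> high m (\sum_(t <- r) g t).
Proof.
move=> h; elim: r => [|t r IH]; rewrite ?big_nil ?big_cons; first exact: high0.
exact: highD.
Qed.

Lemma E_mono i y k x : spanT G y -> spanT E x ->
  E i * (y * Kk k * x) = y * Kk k * (qF ^ (- ap a k i) *: (E i * x)) +
   ((qF - qF^-1)^-1 *: sd HU' false i y) * Kk (k + sr i) * x +
   (- (qF - qF^-1)^-1 *: sd HU' true i y) * Kk (k - sr i) * x.
Proof.
move=> sy sx; rewrite !mulrA.
have -> : E i * y = y * E i + (qF - qF^-1)^-1 *:
   (sd HU' false i y * K i - sd HU' true i y * L i).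
  by rewrite -(commE HU _ sy) addrC subrK.
have -> : y * Kk k * (qF ^ (- ap a k i) *: (E i * x)) = y * E i * Kk k * x.
  rewrite -[y * E i * Kk k]mulrA.
  have -> : E i * Kk k = qF ^ (- ap a k i) *: (Kk k * E i).
    by rewrite (KkE HU) scalerA -expfzDr // addNr expr0z scale1r.
  by rewrite -!scalerAr -!scalerAl !mulrA.
rewrite (KkS HU) (KkB HU) !mulrDl -!scalerAl !mulrBl !mulrA.
by lin_eq F A; ring.
Qed.

Lemma high_E i m u : high m.+1 u -> high m (E i * u).
Proof.
move=> [s [hs ->]]; rewrite mulr_sumr big_seq.
elim/big_ind: _ => [|x y|p hp]; [exact: high0 | exact: highD |].
have [hl sx] := hs p hp; rewrite E_mono //; last by case: hl.
apply: highD; first apply: highD; apply: high_mono => //.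
- exact: low_le hl.
- by apply/spanZ/spanTM => //; apply: spanTX.
- by apply/lowZ/low_sd.
- by apply/lowZ/low_sd.
Qed.

Lemma actA_E_nil t x : spanT E x -> actA t x (fwd HU) [::] = x.
Proof.
move: x; apply: span_ind => [|c x y hx hy|w _]; first by rewrite act0.
  by rewrite actD actZ sfnDE sfnZE hx hy.
by rewrite act_wd cats0.
Qed.

Lemma actA_mono_nil t y k x : spanT G y -> spanT E x ->
  actA t (y * Kk k * x) (fwd HU) [::] = (cst HU' y * qF ^ dot t k) *: x.
Proof.
move=> sy sx; rewrite !actM act_spanG_nil // act_Kk_nil actA_E_nil //.
by rewrite lamk_qlam scalerA.
Qed.

Lemma kills_E i u : kills u -> kills (E i * u).
Proof. by move=> h t ht f; rewrite actM h // act0r. Qed.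

Section Step.
Variables (r : nat) (x : 'I_r -> A).
Hypothesis sx : forall j, spanT E (x j).
Hypothesis xi : forall c : 'I_r -> F, \sum_j c j *: x j = 0 -> forall j, c j = 0.

(** At the empty word only constant terms survive, which settles [m = 0] by independence of the
    characters and of the [x j]. For larger [m], multiplication by [E i] on the left brings in skew
    derivatives of the coefficients, to which the induction hypothesis applies; terms already deep
    in the filtration are collected in [h]. *)
Lemma kills_low m : forall (S : seq Z) (y : 'I_r -> Z -> A) (h : A), uniq S ->
  (forall j k, k \notin S -> y j k = 0) -> (forall j k, low m (y j k)) -> high m.+1 h ->
  kills (\sum_(k <- S) \sum_j y j k * Kk k * x j + h) -> forall j k, low m.+1 (y j k).
Proof.
elim: m => [|m IH] S y h uS yS ly hh kh.
  move=> j k; split; first by case: (ly j k).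
  case=> // _ /=; case: (boolP (k \in S)) => [kS|/yS ->]; last exact: cst0.
  apply: (xi (c := fun j => cst HU' (y j k))); move: k kS.
  apply: (@char_indep F n q A _ (fun k => \sum_j cst HU' (y j k) *: x j)) => // t ht.
  have := congr1 (fun g : sfn a q A => g [::]) (kh t ht (fwd HU)).
  rewrite actD act_sum sfnDE sfn_sumE sfn0E.
  have -> : actA t h (fwd HU) [::] = 0.
    have [s [hs ->]] := hh; rewrite act_sum sfn_sumE big1_seq // => p /andP [_ /hs [[sp hp] sp2]].
    by rewrite actA_mono_nil // [cst _ _](hp [::]) // mul0r scale0r.
  rewrite addr0 => e; rewrite -[RHS]e; apply: eq_bigr => k _.
  rewrite act_sum sfn_sumE scaler_sumr; apply: eq_bigr => l _.
  rewrite actA_mono_nil //; last by case: (ly l k).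
  by rewrite scalerA mulrC.
pose hq := (qF - qF^-1)^-1.
(* The coefficient of [Kk k * x j] produced by commuting [E i] past the [y]: the part with [K i]
   comes from the index [k - sr i], the part with [L i] from [k + sr i]. The other terms keep the
   coefficient [y], with [E i * x j] on the right, and join the error term. *)
pose Y i j k := hq *: sd HU' false i (y j (k - sr i)) - hq *: sd HU' true i (y j (k + sr i)).
pose S' i := undup ([seq k + sr i | k <- S] ++ [seq k - sr i | k <- S]).
have lY i j k : low m.+1 (Y i j k).
  apply: (IH (S' i) (Y i) (\sum_(k <- S) \sum_j y j k * Kk k * (qF ^ (- ap a k i) *: (E i * x j)) + E i * h)).
  - exact: undup_uniq.
  - move=> l k'; rewrite mem_undup mem_cat negb_or => /andP [h1 h2].
    rewrite /Y yS ?yS ?sd0 ?scaler0 ?subr0 //.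
      by apply: contra h2 => h2; apply/mapP; exists (k' + sr i); rewrite ?addrK.
    by apply: contra h1 => h1; apply/mapP; exists (k' - sr i); rewrite ?subrK.
  - by move=> l k'; apply: lowB; apply/lowZ/low_sd/ly.
  - apply: highD; last exact: high_E.
    apply: high_sum => k'; apply: high_sum => l; apply: high_mono; first exact: ly.
    by apply/spanZ/spanTM => //; apply: spanTX.
  have := kills_E i kh; congr kills.
  rewrite mulrDr addrA; congr (_ + _).
  have -> : \sum_(k0 <- S' i) \sum_l Y i l k0 * Kk k0 * x l =
     \sum_(k0 <- S) \sum_l ((hq *: sd HU' false i (y l k0)) * Kk (k0 + sr i) * x l +
        (- hq *: sd HU' true i (y l k0)) * Kk (k0 - sr i) * x l).
    have split_sum (f : Z -> Z) (g : 'I_r -> Z -> A) : injective f ->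
        {subset [seq f k | k <- S] <= S' i} ->
        (forall l k, f k \notin [seq f k | k <- S] -> g l (f k) = 0) ->
        (forall l k, k \notin [seq f k | k <- S] -> g l k = 0) ->
        \sum_(k0 <- S' i) \sum_l g l k0 * Kk k0 * x l =
        \sum_(k0 <- S) \sum_l g l (f k0) * Kk (f k0) * x l.
      move=> fI sub _ g0; rewrite -(big_map f xpredT (fun k0 => \sum_l g l k0 * Kk k0 * x l)).
      rewrite (bigID (fun k0 => k0 \in [seq f k | k <- S])) /= [X in _ + X]big1 ?addr0.
        rewrite -big_filter; apply: perm_big; apply: uniq_perm.
        - by rewrite filter_uniq ?undup_uniq.
        - by rewrite map_inj_uniq.
        - move=> k0; rewrite mem_filter; case: (boolP (k0 \in map f S)) => //= h0.
          by rewrite sub.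
      by move=> k0 h0; apply: big1 => l _; rewrite g0 // !mul0r.
    under eq_bigr => k0 _ do under eq_bigr => l _ do rewrite /Y !mulrBl.
    under eq_bigr => k0 _ do rewrite sumrB; rewrite sumrB.
    rewrite (split_sum (fun k => k + sr i) (fun l k => hq *: sd HU' false i (y l (k - sr i)))).
    - rewrite (split_sum (fun k => k - sr i) (fun l k => hq *: sd HU' true i (y l (k + sr i)))).
      + rewrite -sumrB; apply: eq_bigr => k0 _; rewrite -sumrB; apply: eq_bigr => l _.
        by rewrite addrK subrK scaleNr !mulNr.
      + exact: addIr.
      + by move=> k0 h0; rewrite mem_undup mem_cat h0 orbT.
      + move=> l k0; rewrite subrK (mem_map (addIr _)) => h0.
        by rewrite yS // sd0 scaler0.
      + move=> l k0 h0; rewrite yS ?sd0 ?scaler0 //; apply: contra h0 => h0.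
        by apply/mapP; exists (k0 + sr i); rewrite ?addrK.
    - exact: addIr.
    - by move=> k0 h0; rewrite mem_undup mem_cat h0.
    - move=> l k0; rewrite addrK (mem_map (addIr _)) => h0.
      by rewrite yS // sd0 scaler0.
    - move=> l k0 h0; rewrite yS ?sd0 ?scaler0 //; apply: contra h0 => h0.
      by apply/mapP; exists (k0 - sr i); rewrite ?subrK.
  rewrite mulr_sumr -big_split; apply: eq_bigr => k0 _ /=.
  rewrite mulr_sumr -big_split; apply: eq_bigr => l _ /=.
  rewrite E_mono //; last by case: (ly l k0).
  by rewrite -/hq; lin_eq F A; ring.
have [B hB] : exists B : int, forall k : Z, k \in S -> B < \sum_i k i.
  elim: (S) => [|k S0 [B hB]]; first by exists 0.
  exists (Num.min B (\sum_i k i - 1)) => l; rewrite inE => /orP [/eqP ->|/hB h0].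
    by rewrite gt_min ltrBlDr ltrDl ltr01 orbT.
  by rewrite gt_min h0.
(* [lY] ties the pairing of [y j k] with [i :: v] to that of [y j (k - sr i - sr i)] with
   [rcons v i]. At heights up to [B] all coefficients are zero, so an induction on the height
   reaches every [k]. *)
have main : forall N (k : Z) j v, \sum_i k i <= B + N%:Z -> size v = m.+1 -> pr HU' v (y j k) = 0.
  elim=> [|N IHN] k j v hk hv.
    rewrite yS ?pr0 //; apply/negP => /hB; rewrite addr0 in hk.
    by rewrite ltNge hk.
  case: v hv => // i v [hv].
  have [_ /(_ v)] := lY i j (k - sr i); rewrite hv ltnSn => /(_ isT).
  rewrite /Y -scalerBr prZ prD prN subrK => /eqP; rewrite mulf_eq0 invr_eq0.
  rewrite (negbTE (qqV_neq0 q)) /= subr_eq0 => /eqP <-.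
  rewrite pr_sd; last by case: (ly j (k - sr i - sr i)).
  rewrite IHN ?mulr0 ?size_rcons ?hv //.
  rewrite !sum_subsr.
  by move: hk; lia.
move=> j k; split; first by case: (ly j k).
move=> v; rewrite ltnS leq_eqVlt => /orP [/eqP hv|hv]; last by case: (ly j k) => _; apply.
have hle : \sum_i k i <= B + (absz (\sum_i k i - B)%R)%:Z by lia.
exact: main hle hv.
Qed.

Lemma kills_family (S : seq Z) (y : 'I_r -> Z -> A) : uniq S ->
  (forall j k, k \notin S -> y j k = 0) -> (forall j k, spanT G (y j k)) ->
  kills (\sum_(k <- S) \sum_j y j k * Kk k * x j) -> forall j k, y j k = 0.
Proof.
move=> uS yS sy kh j k; apply: (pr_nondeg (HU := HU')) => // v.
suff h m : forall j k, low m (y j k) by case: (h (size v).+1 j k) => _; apply.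
elim: m => [|m IH]; first by move=> l k'; split.
by apply: (kills_low (h := 0) uS yS IH); [apply: high0 | rewrite addr0].
Qed.
End Step.

Theorem kills_eq0 u : kills u -> u = 0.
Proof.
have [s us] := triangular HU u.
(* Words in [E] can be linearly dependent because of the Serre relations, so a basis of the span of
   those that occur is extracted. *)
have [r [rs ri rg]] := independent_subfamily [seq wd E p.2.2 | p <- s].
pose x (j : 'I_(size r)) := nth 0 r j.
have sx j : spanT E (x j).
  have /rs/mapP [p _ ->] : x j \in r by apply: mem_nth.
  exact: spanT_wd.
have xi (c : 'I_(size r) -> F) : \sum_j c j *: x j = 0 -> forall j, c j = 0.
  move=> h j; pose c' i := if insub i is Some j then c j else 0.
  have c'E (i : 'I_(size r)) : c' i = c i by rewrite /c' valK.
  rewrite -c'E; apply: ri => //; rewrite -[RHS]h; apply: eq_bigr => i _.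
  by rewrite c'E.
have {rg}rg p : p \in s -> exists c : 'I_(size r) -> F, wd E p.2.2 = \sum_j c j *: x j.
  by move=> hp; have [c ->] := rg _ (map_f _ hp); exists (fun j => c j).
suff [S [y [uS yS sy ->]]] : exists S (y : 'I_(size r) -> Z -> A), [/\ uniq S,
    forall j k, k \notin S -> y j k = 0, forall j k, spanT G (y j k) &
    u = \sum_(k <- S) \sum_j y j k * Kk k * x j].
  move=> kh; have y0 := kills_family sx xi uS yS sy kh.
  by apply: big1 => k _; apply: big1 => j _; rewrite y0 !mul0r.
rewrite us {us}; elim: s rg {rs} => [|p s IH] rg.
  by exists [::], (fun _ _ => 0); split=> // [j k|]; [apply: span0 | rewrite !big_nil].
have [|S [y [uS yS sy e]]] := IH; first by move=> p' hp'; apply: rg; rewrite inE hp' orbT.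
have [c hc] := rg p (mem_head _ _).
pose k0 := p.2.1.2; pose y' j k := (if k == k0 then (p.1 * c j) *: wd G p.2.1.1 else 0) + y j k.
exists (undup (k0 :: S)), y'; split.
- exact: undup_uniq.
- move=> j k; rewrite mem_undup inE negb_or /y' => /andP [/negbTE -> /yS ->].
  by rewrite addr0.
- move=> j k; rewrite /y'; apply: spanD; last exact: sy.
  case: (k == k0); last exact: span0.
  exact/spanZ/spanT_wd.
have ext (g : Z -> A) : (forall k, k \notin S -> g k = 0) ->
    \sum_(k <- undup (k0 :: S)) g k = \sum_(k <- S) g k.
  move=> g0; rewrite /=; case: ifP => kS; first by rewrite undup_id.
  by rewrite big_cons undup_id // g0 ?add0r ?kS.
under [RHS]eq_bigr => k _ do under eq_bigr => j _ do rewrite /y' !mulrDl.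
under [RHS]eq_bigr => k _ do rewrite big_split /=.
rewrite [RHS]big_split big_cons; congr (_ + _); last first.
  rewrite e ext // => k kS; apply: big1 => j _; by rewrite yS // !mul0r.
rewrite (bigD1_seq k0) ?undup_uniq ?mem_undup ?mem_head //= eqxx.
rewrite [X in _ = _ + X]big1 ?addr0; last first.
  by move=> k /negbTE ->; apply: big1 => j _; rewrite !mul0r.
rewrite hc mulr_sumr scaler_sumr; apply: eq_bigr => j _.
by rewrite -scalerAr scalerA -!scalerAl.
Qed.
End Faithful.

(** * Central characters *)

Lemma ap_eq0 n (a : gcm n) k : (forall i, ap a k i = 0) -> k = 0.
Proof.
move=> h; apply: (@ca_pos _ a).
suff -> : \sum_i \sum_j a i j * k i * k j = bf a k k by rewrite /bf big1 // => i _; rewrite h mul0r.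
rewrite exchange_big; apply: eq_bigr => j _; rewrite mulr_suml.
by apply: eq_bigr => i _; rewrite mulrC [a i j * _]mulrC mulrC.
Qed.

Section CentralCharacter.
Variables (F : fieldType) (n : nat) (a : gcm n) (q : qpar F).
Notation I := 'I_n.
Notation qF := (q : F).
Notation Z := ({ffun I -> int}).
Variables (A : algType F) (E G K L : I -> A) (HU : isU a q E G K L).
Let q0 := q_neq0 q.
Let U0 : urel0 a q E G K L. Proof. by case: HU => [[]]. Qed.
Notation Kk := (Kk K L).

Let conj i (x : A) := K i * x * L i.
Let conj_lin i c x y : conj i (c *: x + y) = c *: conj i x + conj i y.
Proof. by rewrite /conj mulrDr mulrDl -scalerAr -scalerAl. Qed.
Let conj0 i : conj i 0 = 0. Proof. by rewrite /conj mulr0 mul0r. Qed.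

Lemma conj_mono i w k v : conj i (wd G w * Kk k * wd E v) =
  qF ^ ap a (wt v - wt w) i *: (wd G w * Kk k * wd E v).
Proof.
rewrite /conj !mulrA (KG_wd HU) -!scalerAl.
have -> : wd G w * K i * Kk k * wd E v * L i = wd G w * Kk k * (K i * wd E v * L i).
  by rewrite -[wd G w * K i * _]mulrA -(Kk_sr HU) (KkC HU) !mulrA.
have := tw_wd HU true i v; rewrite /tw mul1r => ->.
by rewrite -scalerAr scalerA -expfzDr // apD apN !ap_wt addrC.
Qed.

(** For a nonzero weight [e] some node [i] separates it from zero, and [T] fixes what commutes with
    [K i] while killing the component of weight [e]. The nonzero weights are removed in this way one
    by one. *)
Lemma weight_zero_part (H : seq Z) (z z0 : A) (zz : Z -> A) :
  0 \notin H -> z = z0 + \sum_(e <- H) zz e ->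
  (forall i, conj i z = z) -> (forall i, conj i z0 = z0) ->
  (forall i e, conj i (zz e) = qF ^ ap a e i *: zz e) -> z = z0.
Proof.
elim: H zz => [|e H IH] zz; first by rewrite big_nil addr0.
rewrite inE negb_or eq_sym => /andP [e0 H0] hz cz cz0 czz.
have [i hi] : exists i, ap a e i <> 0.
  apply: contrapT => h; move/eqP: e0; apply; apply: (@ap_eq0 _ a) => i.
  by apply: contrapT => hi; apply: h; exists i.
have c0 : 1 - qF ^ ap a e i != 0.
  by rewrite subr_eq0 eq_sym qexp_eq1; apply/eqP.
pose T x := (1 - qF ^ ap a e i)^-1 *: (conj i x - qF ^ ap a e i *: x).
have T_lin c x y : T (c *: x + y) = c *: T x + T y.
  by rewrite /T conj_lin; lin_eq F A; ring.
have T1 x : conj i x = x -> T x = x.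
  by move=> h; rewrite /T h -{1}[x]scale1r -scalerBl scalerA mulVf ?scale1r.
apply: (IH (fun e' => T (zz e'))) => //.
- have TD x y : T (x + y) = T x + T y by rewrite -[x]scale1r T_lin !scale1r.
  have T0 : T 0 = 0 by rewrite /T conj0 scaler0 subr0 scaler0.
  have Ts (r : seq Z) : T (\sum_(e <- r) zz e) = \sum_(e <- r) T (zz e).
    by elim: r => [|e' r IHr]; rewrite ?big_nil // !big_cons TD IHr.
  rewrite -[LHS](T1 z) // hz TD (T1 z0) // Ts big_cons; congr (_ + _).
  by rewrite {1}/T czz subrr scaler0 add0r.
- move=> j e'; rewrite /T.
  have conjZ c x : conj j (c *: x) = c *: conj j x.
    by rewrite -[c *: x]addr0 conj_lin conj0 addr0.
  have conjB x y : conj j (x - y) = conj j x - conj j y.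
    by rewrite /conj mulrBr mulrBl.
  rewrite conjZ conjB !czz !conjZ !czz.
  by lin_eq F A; ring.
Qed.

Lemma weight_zero_tri z : (forall i, K i * z = z * K i) ->
  exists s : seq (F * (seq I * Z * seq I)),
   (forall p, p \in s -> wt p.2.1.1 = wt p.2.2) /\
   z = \sum_(p <- s) p.1 *: (wd G p.2.1.1 * Kk p.2.1.2 * wd E p.2.2).
Proof.
move=> hz; have [s hs] := triangular HU z.
pose g (p : F * (seq I * Z * seq I)) := wt p.2.2 - wt p.2.1.1.
exists [seq p <- s | g p == 0]; split.
  by move=> p; rewrite mem_filter => /andP [/eqP/subr0_eq ->].
set m := fun p : F * (seq I * Z * seq I) => p.1 *: (wd G p.2.1.1 * Kk p.2.1.2 * wd E p.2.2).
have cm i p : conj i (m p) = qF ^ ap a (g p) i *: m p.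
  by rewrite /m -[_ *: _]addr0 conj_lin conj0 conj_mono !addr0 !scalerA mulrC.
have cs i e (r : seq (F * (seq I * Z * seq I))) : conj i (\sum_(p <- r | g p == e) m p) =
    qF ^ ap a e i *: \sum_(p <- r | g p == e) m p.
  elim: r => [|p r IH]; first by rewrite big_nil conj0 scaler0.
  rewrite big_cons; case: eqP => // gp.
  by rewrite -[m p]scale1r conj_lin IH cm gp; lin_eq F A; ring.
apply: (@weight_zero_part [seq e <- undup [seq g p | p <- s] | e != 0] z _
   (fun e => \sum_(p <- s | g p == e) m p)) => //.
- by rewrite mem_filter eqxx.
- rewrite {1}hs (sum_fibers _ g) [LHS](bigID (fun e => e == 0)) /=.
  congr (_ + _); rewrite -big_filter //.
  case: (boolP (0 \in undup [seq g p | p <- s])) => h0.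
    have -> : [seq e <- undup [seq g p | p <- s] | e == 0] = [:: 0].
      apply: perm_small_eq => //; apply: uniq_perm => [||e]; rewrite ?filter_uniq ?undup_uniq //.
      by rewrite mem_filter inE; case: eqP => // ->.
    by rewrite big_seq1 big_filter.
  rewrite big1_seq; last first.
    by move=> e; rewrite mem_filter => /andP [_ /andP [/eqP ->]]; rewrite (negbTE h0).
  rewrite big_filter big1_seq // => p /andP [/eqP gp ps].
  by case/negP: h0; rewrite mem_undup -gp map_f.
- by move=> i; rewrite /conj hz -mulrA (uKL U0) mulr1.
- by move=> i; rewrite big_filter cs ap0 expr0z scale1r.
Qed.

Definition clist (s : seq (F * Z)) (lam : I -> F) := \sum_(p <- s) p.1 * lamk lam p.2.

Definition acts_by (z : A) (s : seq (F * Z)) :=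
  forall (V : lmodType F) hV (lam : I -> F) (lam0 : forall i, lam i != 0) (f : sfn a q V),
   act HU hV lam0 z f = clist s lam *: f.

Section Reflection.
Variables (i : I) (m : nat) (lam : I -> F) (lam0 : forall i, lam i != 0).
Hypothesis lami : lam i ^+ 2 = qF ^+ 2 ^+ m.

(** The functions [pow l] form a string for node [i]: [E i] shortens it and [G i] sends [pow l] to a
    multiple of [pow l.+1]. The hypothesis on [lam i], which allows both signs, makes this multiple
    zero for [l = m]. *)
Definition pow_fn l (w : seq I) : F^o := if w == nseq l i then 1 else 0.
Lemma mem_nseq_eq l (w : seq I) j : j != i -> j \in w -> (w == nseq l i) = false.
Proof.
move=> ji jw; apply/negP => /eqP e; move: jw; rewrite e mem_nseq => /andP [_ /eqP h].
by rewrite h eqxx in ji.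
Qed.
Fact pow_fnP l : serre_fn a q (pow_fn l).
Proof.
move=> u w j k jk.
have [b [bi hb]] : exists b, b != i /\ ((b == j) || (b == k)).
  case: (eqVneq j i) jk => [->|ji] jk; last by exists j; rewrite eqxx.
  by exists k; rewrite eq_sym jk eqxx orbT.
have z (v : seq I) : j \in v -> k \in v -> pow_fn l (u ++ v) = 0.
  move=> hj hk; rewrite /pow_fn (mem_nseq_eq _ bi) //.
  by rewrite mem_cat; case/orP: hb => /eqP ->; rewrite ?hj ?hk orbT.
split=> _; first by rewrite !z ?inE ?eqxx ?orbT.
by rewrite !z ?inE ?eqxx ?orbT //; lin_eq F F^o; ring.
Qed.
Definition pow l := Sfn (pow_fnP l).

Fixpoint dcoef (e : int) l : F := if l is l'.+1 then 1 + qF ^ (e * 2) * dcoef e l' else 1.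

Lemma dop_pow e l w : dop a q e i (pow_fn l) w = dcoef e l * pow_fn l.+1 w.
Proof.
elim: l w => [|l IH] w.
  case: w => [|j w] /=; first by rewrite /pow_fn mulr0.
  have -> : (fun u => pow_fn 0 (j :: u)) = (fun=> 0) by apply/funext.
  by rewrite dop0 scaler0 addr0 /pow_fn /= eqseq_cons mul1r [i == j]eq_sym; case: eqP.
case: w => [|j w] /=; first by rewrite /pow_fn mulr0.
case: (eqVneq i j) => [<-|ij].
  have -> : (fun u => pow_fn l.+1 (i :: u)) = pow_fn l.
    by apply/funext => u; rewrite /pow_fn /= eqseq_cons eqxx.
  rewrite IH ca_diag; have -> : pow_fn l.+2 (i :: w) = pow_fn l.+1 w.
    by rewrite /pow_fn /= eqseq_cons eqxx.
  by rewrite mulrDl mul1r -mulrA.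
have -> : (fun u => pow_fn l.+1 (j :: u)) = (fun=> 0).
  by apply/funext => u; rewrite /pow_fn /= eqseq_cons eq_sym (negbTE ij).
by rewrite dop0 scaler0 addr0 /pow_fn /= eqseq_cons [j == i]eq_sym (negbTE ij) mulr0.
Qed.

Lemma dcoefN l : dcoef (-1) l = (qF ^+ 2 ^+ l)^-1 * dcoef 1 l.
Proof.
elim: l => [|l IH] /=; first by rewrite expr0 invr1 mul1r.
rewrite IH mul1r mulN1r -invr_expz; have -> : qF ^ (2 : int) = qF ^+ 2 by [].
have closed l' : dcoef 1 l' * (qF ^+ 2 - 1) = qF ^+ 2 ^+ l'.+1 - 1.
  elim: l' => [|l' IH'] /=; first by rewrite expr1 mul1r.
  have -> : qF ^ (1 * 2) = qF ^+ 2 by [].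
  by rewrite mulrDl -mulrA IH' [in RHS]exprS; ring.
have h2 := q2_neq1 q.
have -> : dcoef 1 l = (qF ^+ 2 ^+ l.+1 - 1) / (qF ^+ 2 - 1) by rewrite -closed mulfK.
rewrite ![_ ^+ l.+1]exprS; have h3 : qF ^+ 2 ^+ l != 0 by rewrite !expf_neq0 ?q0.
by field; rewrite h3 h2 q0.
Qed.

Lemma wp_nseq l : wp a i (nseq l i) = (2 * l)%N%:Z.
Proof.
elim: l => [|l IH]; first by rewrite /wp big_nil.
by rewrite /= wp_cons IH ca_diag; lia.
Qed.

Lemma act_pow l : act HU (nzF F) lam0 (G i) (pow l) =
  ((qF - qF^-1)^-1 * dcoef 1 l * (lam i / qF ^+ 2 ^+ l - (lam i)^-1)) *: pow l.+1.
Proof.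
apply: sfn_ext => w; rewrite actG /Gop /Kop /Lop sfnZE !dop_pow /=.
rewrite /pow_fn; case: eqP => [->|_]; last by rewrite !mulr0 !scaler0 subr0 scaler0.
rewrite !mulr1 wp_nseq dcoefN -invr_expz.
have -> : qF ^ (2 * l.+1)%N%:Z = qF ^+ 2 ^+ l.+1 by rewrite -exprnP exprM.
rewrite /GRing.scale /= ![_ ^+ l.+1]exprS !mulr1.
have h3 : qF ^+ 2 ^+ l != 0 by rewrite !expf_neq0 ?q0.
have h2 := q2_neq1 q; rewrite expr2 in h2.
by field; rewrite h3 h2 lam0 q0.
Qed.

Lemma act_pow_m : act HU (nzF F) lam0 (G i) (pow m) = 0.
Proof.
rewrite act_pow; suff -> : lam i / qF ^+ 2 ^+ m - (lam i)^-1 = 0 by rewrite mulr0 scale0r.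
by rewrite -lami; have h := lam0 i; field.
Qed.

Lemma wd_nseq X l : wd X (nseq l i) = X i ^+ l :> A.
Proof. by elim: l => [|l IH] //=; rewrite IH exprSr. Qed.

Lemma act_pow_iter j l : exists c, act HU (nzF F) lam0 (wd G (nseq j i)) (pow l) = c *: pow (l + j).
Proof.
elim: j => [|j [c IH]]; first by exists 1; rewrite addn0 /= act1 scale1r.
rewrite wd_nseq exprS actM -wd_nseq IH actZr act_pow scalerA addnS.
by eexists.
Qed.

(** Unless the word [v] is a power of [i] of length at most [m.+1] it kills [pow m.+1]. Otherwise it
    leads to some [pow l] with [l] at most [m], and the word in [G] of the same weight would have to
    climb back through [pow m], which [G i] kills. *)
Lemma act_pow_mono w k v : wt w = wt v -> v != [::] ->
  act HU (nzF F) lam0 (wd G w * Kk k * wd E v) (pow m.+1) (nseq m.+1 i) = 0.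
Proof.
move=> wv v0; rewrite !actM.
case: (boolP (all (fun j => j == i) v)) => [vi|]; last first.
  move/allPn => [j jv ji]; have -> : act HU (nzF F) lam0 (wd E v) (pow m.+1) = 0.
    apply: sfn_ext => u; rewrite act_wd /= /pow_fn (mem_nseq_eq _ ji) //.
    by rewrite mem_cat jv.
  by rewrite !act0r.
have [l hv] : exists l, v = nseq l.+1 i.
  exists (size v).-1; rewrite prednK ?lt0n ?size_eq0 //; apply/all_pred1P.
  by apply: sub_all vi => j /eqP ->; rewrite /=.
have hw : w = nseq l.+1 i.
  have wi : all (fun j => j == i) w.
    apply/allP => j jw; apply: contrapT => ji; have := wt_size w; have := congr1 (fun f : Z => f j) wv.
    have z : forall u : seq I, all (fun j => j == i) u -> wt u j = 0.
      elim=> [|b u IH] /=; first by rewrite wt_nil ffunE.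
      by case/andP=> /eqP -> /IH h; rewrite wt_cons !ffunE h addr0; case: eqP ji => // ->; rewrite eqxx.
    rewrite (z v vi) => h _; elim: (w) jw h => // b u IH; rewrite inE wt_cons ffunE => /orP [/eqP <-|ju] h.
      by move: h; rewrite ffunE eqxx /=; have := wt_ge0 u j; lia.
    have := wt_ge0 u j; have := IH ju; move: h; rewrite ffunE; case: eqP => _ /=; lia.
  have -> : l.+1 = size w.
    by have := wt_size w; rewrite wv wt_size hv size_nseq => [[]].
  by apply/all_pred1P; apply: sub_all wi => j /eqP ->; rewrite /=.
rewrite hv hw; case: (leqP l m) => lm; last first.
  have -> : act HU (nzF F) lam0 (wd E (nseq l.+1 i)) (pow m.+1) = 0.
    apply: sfn_ext => u; rewrite act_wd /= /pow_fn; case: eqP => // /(congr1 size) /=.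
    by rewrite size_cat !size_nseq; lia.
  by rewrite !act0r.
have -> : act HU (nzF F) lam0 (wd E (nseq l.+1 i)) (pow m.+1) = pow (m - l).
  apply: sfn_ext => u; rewrite act_wd /= /pow_fn.
  have -> : nseq m.+1 i = nseq l.+1 i ++ nseq (m - l) i by rewrite -nseqD addSn subnKC.
  by rewrite -[i :: _]/(nseq l.+1 i ++ u) eqseq_cat // eqxx.
have -> : act HU (nzF F) lam0 (Kk k) (pow (m - l)) =
    (lamk lam k * qF ^ (- bf a k (wt (nseq (m - l) i)))) *: pow (m - l).
  apply: sfn_ext => u; rewrite act_Kk sfnZE /= /pow_fn; case: eqP => [->|] //.
  by rewrite !scaler0.
rewrite actZr wd_nseq exprS actM -wd_nseq.
by have [c ->] := act_pow_iter l (m - l); rewrite subnK // actZr act_pow_m !scaler0.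
Qed.
End Reflection.

(* Linkage at the wall of node [i]: [lam] and its dot-reflection occur in the same
   module, so [clist s] takes the same value at both. *)
Definition refl_inv (s : seq (F * Z)) := forall i m (lam : I -> F),
  (forall i, lam i != 0) -> lam i ^+ 2 = qF ^+ 2 ^+ m ->
  clist s lam = \sum_(p <- s) p.1 * (lamk lam p.2 * qF ^ (- (m.+1%:Z * ap a p.2 i))).

Lemma bf_nseq k l i : bf a k (wt (nseq l i)) = l%:Z * ap a k i.
Proof.
elim: l => [|l IH]; first by rewrite wt_nil bf0r mul0r.
by rewrite /= wt_cons bfDr IH bf_srr intS mulrDl mul1r.
Qed.

Lemma acts_by_nil z : (forall i, K i * z = z * K i) -> exists s : seq (F * Z),
  (forall (V : lmodType F) hV (lam : I -> F) (lam0 : forall i, lam i != 0) (f : sfn a q V),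
   act HU hV lam0 z f [::] = clist s lam *: f [::]) /\
  (forall i m (lam : I -> F) (lam0 : forall i, lam i != 0), lam i ^+ 2 = qF ^+ 2 ^+ m ->
   act HU (nzF F) lam0 z (pow i m.+1) (nseq m.+1 i) =
   \sum_(p <- s) p.1 * (lamk lam p.2 * qF ^ (- (m.+1%:Z * ap a p.2 i)))).
Proof.
move=> /weight_zero_tri [s [hs ->]].
exists [seq (p.1, p.2.1.2) | p <- s & p.2.1.1 == [::]]; split; last first.
  move=> i m lam lam0 lami; rewrite act_sum sfn_sumE big_map big_filter [RHS]big_mkcond.
  apply: eq_big_seq => p /hs; case: p => c [[w k] v] /= e.
  rewrite actZ sfnZE; case: (eqVneq v [::]) => [v0|v0].
    have -> : w = [::] by apply: wt_eq0; rewrite e v0 wt_nil.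
    rewrite v0 /= mul1r mulr1 act_Kk -[i :: nseq m i]/(nseq m.+1 i) bf_nseq /= /pow_fn eqxx.
    by rewrite /GRing.scale /= mulr1.
  rewrite act_pow_mono // scaler0; case: eqP => // w0.
  by move: v0; rewrite (wt_eq0 (w := v)) ?eqxx // -e w0 wt_nil.
move=> V hV lam lam0 f.
rewrite act_sum sfn_sumE /clist big_map scaler_suml big_filter [RHS]big_mkcond.
apply: eq_big_seq => p /hs; case: p => c [[w k] v] /= e.
rewrite actZ sfnZE; case: w e => [|i w] /= e.
  have -> : v = [::] by apply: wt_eq0; rewrite -e wt_nil.
  by rewrite mul1r mulr1 act_Kk_nil scalerA.
rewrite !actM act_spanG_nil; last by apply: spanT_wd.
by rewrite actG_nil !scaler0.
Qed.

(** At the empty word only the monomials without [E] and [G] contribute, by a scalar. Every other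
    value is a value at the empty word after deleting letters, and [z] commutes with deletion. *)
Lemma acts_by_ex z : (forall i, K i * z = z * K i) -> (forall i, E i * z = z * E i) ->
  exists s, acts_by z s /\ refl_inv s.
Proof.
move=> hK hE; have [s [hs hr]] := acts_by_nil hK; exists s.
suff h : acts_by z s.
  split=> // i m lam lam0 lami; rewrite -(hr i m lam lam0 lami) h sfnZE /= /pow_fn.
  by rewrite eqxx /GRing.scale /= mulr1.
move=> V hV lam lam0 f.
have zE w : z * wd E w = wd E w * z.
  by elim: w => [|i w IH] /=; rewrite ?mulr1 ?mul1r // mulrA IH -!mulrA hE.
apply: sfn_ext => w; rewrite sfnZE -[w in LHS]cats0 -(act_wd HU hV lam0) -actM -zE actM hs.
by rewrite act_wd cats0.
Qed.

Lemma central_of_comm z : (forall i, K i * z = z * K i) -> (forall i, E i * z = z * E i) ->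
  forall u, z * u = u * z.
Proof.
move=> hK hE u; have [s [hs _]] := acts_by_ex hK hE.
apply/eqP; rewrite -subr_eq0; apply/eqP/(kills_eq0 (HU := HU)) => t ht f.
by rewrite actB !actM !hs actZr subrr.
Qed.

Lemma acts_by_eq0 z s : acts_by z s ->
  (forall t : Z, (forall i, 0 <= t i) -> clist s (qlam q t) = 0) -> z = 0.
Proof.
move=> hs h; apply: (kills_eq0 (HU := HU)) => t ht f.
by rewrite hs h // scale0r.
Qed.

End CentralCharacter.

(** * Weyl group invariance and evenness of the coefficients *)

Section Invariance.
Variables (F : fieldType) (n : nat) (a : gcm n) (q : qpar F).
Notation I := 'I_n.
Notation qF := (q : F).
Notation Z := ({ffun I -> int}).
Let q0 := q_neq0 q.

Definition rfl i (k : Z) : Z := [ffun j => k j - sr i j * ap a k i].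
Lemma rfl_i i k : rfl i k i = k i - ap a k i.
Proof. by rewrite !ffunE eqxx mul1r. Qed.
Lemma dot_rfl t i k : dot t (rfl i k) = dot t k - t i * ap a k i.
Proof.
rewrite /dot -[in RHS](sum_sr t i) mulr_suml -sumrB; apply: eq_bigr => j _.
by rewrite ffunE mulrBr mulrA.
Qed.
Lemma ap_rfl i k : ap a (rfl i k) i = - ap a k i.
Proof.
have -> : ap a (rfl i k) i = ap a k i - a i i * ap a k i.
  rewrite {1 2}/ap -(sum_sr (a^~ i) i) mulr_suml -sumrB; apply: eq_bigr => j _.
  by rewrite ffunE; ring.
by rewrite ca_diag; ring.
Qed.
Lemma rflK i : involutive (rfl i).
Proof.
by move=> k; apply/ffunP => j; rewrite !ffunE ap_rfl mulrN opprK subrK.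
Qed.

Definition cf (s : seq (F * Z)) (k : Z) : F := \sum_(p <- s | p.2 == k) p.1.
Definition keys (s : seq (F * Z)) := undup [seq p.2 | p <- s].
Lemma cf_notin s k : k \notin keys s -> cf s k = 0.
Proof.
move=> h; rewrite /cf big1_seq // => p /andP [/eqP pk ps]; case/negP: h.
by rewrite mem_undup -pk map_f.
Qed.
Lemma sum_cf s (f : Z -> F) : \sum_(p <- s) p.1 * f p.2 = \sum_(k <- keys s) cf s k * f k.
Proof.
rewrite (sum_fibers _ snd); apply: eq_bigr => k _; rewrite mulr_suml.
by apply: eq_bigr => p /eqP ->.
Qed.

(** At [lam j = q^(t j)], with the additional factor [sgn] at node [i], the linkage identity becomes
    one between characters of [t], and [char_indep] compares coefficients. The factor [q^(-k i)] is
    the shift by rho at node [i]. *)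
Lemma refl_inv_sign s i (sgn : F) : refl_inv a q s -> sgn ^+ 2 = 1 -> forall k,
  cf s k * sgn ^ (k i) * qF ^ (- k i) = cf s (rfl i k) * sgn ^ (rfl i k i) * qF ^ (- rfl i k i).
Proof.
move=> hs hsgn.
have sgn0 : sgn != 0 by apply: contra_eq_neq hsgn => ->; rewrite expr0n /= eq_sym oner_neq0.
pose d k := cf s k * sgn ^ (k i) * qF ^ (- k i).
(* Closing the support under [rfl i] lets both sides be summed over the same index set. *)
pose S := undup (keys s ++ map (rfl i) (keys s)).
have uS : uniq S by apply: undup_uniq.
have S1 k : k \notin S -> k \notin keys s.
  by rewrite mem_undup mem_cat negb_or => /andP [].
have Sr k : (rfl i k \in S) = (k \in S).
  rewrite [LHS]mem_undup [RHS]mem_undup !mem_cat orbC (mem_map (inv_inj (rflK i))).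
  by congr (_ || _); rewrite -{2}[k](rflK i) (mem_map (inv_inj (rflK i))).
have d0 k : k \notin S -> d k = 0 by move=> /S1 /cf_notin h; rewrite /d h !mul0r.
move=> k; rewrite -/(d k) -/(d (rfl i k)); case: (boolP (k \in S)) => kS; last first.
  by rewrite !d0 ?Sr.
have key (t : Z) : (forall j, 0 <= t j) ->
    \sum_(k <- S) qF ^ dot t k *: ((d k - d (rfl i k)) * qF ^ k i : F^o) = 0.
  move=> t0; pose m := absz (t i); pose lam j := (if j == i then sgn else 1) * qF ^ t j.
  have lam0 j : lam j != 0 by rewrite mulf_neq0 ?qexp_neq0 //; case: (j == i); rewrite ?oner_neq0.
  have lami : lam i ^+ 2 = qF ^+ 2 ^+ m.
    by rewrite /lam eqxx exprMn hsgn mul1r -[t i]gez0_abs // -exprnP -!exprM mulnC.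
  have lamE l : lamk lam l = sgn ^ (l i) * qF ^ dot t l.
    rewrite -lamk_qlam /lamk; under eq_bigr do rewrite /lam expfzMl.
    rewrite big_split /=; congr (_ * _); rewrite (bigD1 i) //= eqxx big1 ?mulr1 // => j /negbTE ->.
    by rewrite exp1rz.
  have extS (f : Z -> F) : \sum_(k <- keys s) cf s k * f k = \sum_(k <- S) cf s k * f k.
    rewrite [RHS](bigID (fun k => k \in keys s)) /= [X in _ + X]big1 ?addr0.
      rewrite -[RHS]big_filter; apply: perm_big; apply: uniq_perm; rewrite ?filter_uniq ?undup_uniq //.
      move=> l; rewrite mem_filter; case: (boolP (l \in keys s)) => //= h.
      by rewrite mem_undup mem_cat h.
    by move=> l hl; rewrite cf_notin ?mul0r.
  have := hs i m lam lam0 lami.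
  rewrite /clist (sum_cf s (lamk lam)) (sum_cf s (fun l => lamk lam l * qF ^ (- (m.+1%:Z * ap a l i)))).
  rewrite !extS => e.
  have e1 : \sum_(k <- S) d k * qF ^ dot (t + sr i) k = \sum_(k <- S) d k * qF ^ dot (t + sr i) (rfl i k).
    transitivity (\sum_(k <- S) cf s k * lamk lam k).
      apply: eq_bigr => l _; rewrite lamE /d dotDl dot_sr expfzDr // -invr_expz.
      by have h := qexp_neq0 q (l i); field.
    rewrite e; apply: eq_bigr => l _.
    rewrite lamE /d dot_rfl dotDl dot_sr !expfzDr // !ffunE eqxx.
    have -> : (t i + true%:Z) = m.+1%:Z by rewrite /m intS gez0_abs // addrC.
    rewrite -!invr_expz; have h := qexp_neq0 q (l i); have h' := qexp_neq0 q (m.+1%:Z * ap a l i).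
    by field; rewrite h h'.
  have e2 : \sum_(k <- S) d k * qF ^ dot (t + sr i) (rfl i k) =
      \sum_(k <- S) d (rfl i k) * qF ^ dot (t + sr i) k.
    under eq_bigr => l _ do rewrite -{1}[l](rflK i).
    rewrite -(big_map (rfl i) xpredT (fun k => d (rfl i k) * qF ^ dot (t + sr i) k)) /=.
    apply: perm_big; apply: uniq_perm => //; first by rewrite map_inj_uniq //; apply/inv_inj/rflK.
    by move=> l; rewrite -{1}[l](rflK i) (mem_map (inv_inj (rflK i))) Sr.
  rewrite e2 in e1; rewrite -[RHS](subrr (\sum_(k <- S) d k * qF ^ dot (t + sr i) k)) {2}e1.
  rewrite -sumrB; apply: eq_bigr => l _; rewrite dotDl dot_sr expfzDr // /GRing.scale /=.
  by ring.
have h : (d k - d (rfl i k)) * qF ^ k i = 0 by exact: (@char_indep F n q F^o S (fun k => (d k - d (rfl i k)) * qF ^ k i) uS key k kS).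
by move/eqP: h; rewrite mulf_eq0 (negbTE (qexp_neq0 _ _)) orbF subr_eq0 => /eqP.
Qed.
Lemma refl_inv_cf s i : refl_inv a q s -> forall k,
  cf s k * qF ^ (- k i) = cf s (rfl i k) * qF ^ (- rfl i k i).
Proof.
move=> hs k; have := refl_inv_sign i hs (expr1n _ 2) k.
by rewrite !exp1rz !mulr1.
Qed.

(** The identities for the signs [1] and [-1] are compatible with a nonzero coefficient only if
    [k i] and [rfl i k i] have the same parity, and these differ by [ap a k i]. *)
Lemma refl_inv_even s i k : refl_inv a q s -> cf s k != 0 -> (2 %| ap a k i)%Z.
Proof.
move=> hs c0; have h1 := refl_inv_cf i hs k.
have s1 : (-1 : F) ^+ 2 = 1 by rewrite sqrrN expr1n.
have h2 := refl_inv_sign i hs s1 k.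
have n0 : (-1 : F) != 0 by rewrite oppr_eq0 oner_neq0.
have c0' : cf s (rfl i k) * qF ^ (- rfl i k i) != 0.
  by rewrite -h1 mulf_neq0 ?qexp_neq0.
have : (-1 : F) ^ k i = (-1) ^ (rfl i k i).
  by apply: (mulfI c0'); rewrite -{1}h1 mulrAC h2 mulrAC.
rewrite rfl_i expfzDr // -{1}[_ ^ k i]mulr1 => /(mulfI (expfz_neq0 _ n0))/esym.
rewrite -invr_expz => /(congr1 GRing.inv); rewrite invrK invr1.
rewrite {1}(divz_eq (ap a k i) 2) expfzDr // [_ ^ (_ * _)](_ : _ = 1); last first.
  by rewrite mulrC -exprz_exp -exprnP s1 exp1rz.
rewrite mul1r => h; apply/dvdz_mod0P.
have := modz_ge0 (ap a k i) (isT : (2 : int) != 0).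
have := ltz_pmod (ap a k i) (isT : 0 < (2 : int)).
case: (_ %% 2)%Z h => [[|[|m]]|m] //.
rewrite expr1z => /eqP; rewrite -subr_eq0 -opprD oppr_eq0.
by have := q_char0 q 1; rewrite -[2%:R]/(1 + 1 : F) => /negbTE ->.
Qed.
End Invariance.

(** * Quantum traces *)

Section WordList.
Variable n : nat.
Definition words_le (B : nat) : seq (seq 'I_n) :=
  flatten [seq [seq val t | t <- enum {: k.-tuple 'I_n}] | k <- iota 0 B.+1].
Lemma mem_words_le B w : (w \in words_le B) = (size w <= B)%N.
Proof.
apply/flatten_mapP/idP => [[k]|hw].
  by rewrite mem_iota ltnS => /andP [_ kB] /mapP [t _ ->]; rewrite size_tuple.
exists (size w); first by rewrite mem_iota ltnS.
by apply/mapP; exists (in_tuple w); rewrite // mem_enum.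
Qed.
End WordList.

(** * Elements of one half with prescribed pairings *)

Section Representability.
Variables (F : fieldType) (n : nat) (a : gcm n) (q : qpar F).
Notation I := 'I_n.
Variables (A : algType F) (E G K L : I -> A) (HU : isU a q E G K L).
Notation HU' := (isU_swap (q_neq0 q) HU).

Lemma gram_size v w : size v <> size w -> gram a q v w = 0.
Proof.
move=> h; rewrite -(pr_wd HU); apply: (@pr_hom _ _ _ _ _ _ _ _ _ HU (wt w)).
  exact: span_wd.
by move=> e; apply: h; have := wt_size v; rewrite e wt_size => [[]].
Qed.

(** A linear system for the Gram matrix of the words of length at most [B]. It is solvable if [h]
    vanishes on the kernel of this matrix; a kernel vector is a combination of words in [G] that
    pairs to zero with every word, hence a true relation in [A] by nondegeneracy for the opposite
    half. *)
Lemma pr_represents B (h : seq I -> F) :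
  (forall w, (B < size w)%N -> h w = 0) ->
  (forall (s : seq (seq I)) (c : seq I -> F),
     \sum_(w <- s) c w *: wd G w = 0 -> \sum_(w <- s) c w * h w = 0) ->
  exists2 y, spanT E y & forall w, pr HU w y = h w.
Proof.
move=> hB hrel; pose W := words_le n B; pose N := size W.
pose w_ (i : 'I_N) := nth [::] W i.
have hw i : (size (w_ i) <= B)%N by rewrite -mem_words_le mem_nth.
have wex w : (size w <= B)%N -> exists i, w = w_ i.
  rewrite -mem_words_le => wW; have hi : (index w W < N)%N by rewrite index_mem.
  by exists (Ordinal hi); rewrite /w_ nth_index.
pose M : 'M[F]_N := \matrix_(i, j) gram a q (w_ i) (w_ j).
pose hv : 'rV[F]_N := \row_i h (w_ i).
have /submxP [D hD] : (hv <= M)%MS.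
  rewrite submxE; apply/eqP/rowP => k; rewrite !mxE.
  pose kp i := cokermx M i k.
  suff e : \sum_i kp i *: wd G (w_ i) = 0.
    pose c w := \sum_(i | w_ i == w) kp i.
    have sumE (V : lmodType F) (f : seq I -> V) :
        \sum_i kp i *: f (w_ i) = \sum_(w <- undup [seq w_ i | i <- enum 'I_N]) c w *: f w.
      rewrite -big_enum (sum_fibers _ w_); apply: eq_bigr => w _.
      rewrite /c scaler_suml big_enum_cond /=.
      by apply: eq_bigr => i /eqP ->.
    rewrite (sumE A (wd G)) in e; have := hrel _ _ e.
    rewrite -[X in X = 0 -> _](sumE F^o h) => e'; rewrite -[RHS]e'.
    by apply: eq_bigr => i _; rewrite mxE mulrC.
  apply: (pr_nondeg (HU := HU')).
    by apply: span_sum => i; apply/spanZ/spanT_wd.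
  move=> v; rewrite pr_sum; under eq_bigr do rewrite prZ pr_wd.
  case: (leqP (size v) B) => hvB; last first.
    rewrite big1 // => i _; rewrite gram_size ?mulr0 // => e.
    by move: (hw i); rewrite -e leqNgt hvB.
  have [i ->] := wex _ hvB.
  have := mulmx_coker M => /matrixP /(_ i k); rewrite !mxE => e; rewrite -[RHS]e.
  by apply: eq_bigr => j _; rewrite mxE mulrC.
exists (\sum_j D 0 j *: wd E (w_ j)).
  by apply: span_sum => i; apply/spanZ/spanT_wd.
move=> w; rewrite pr_sum; under eq_bigr do rewrite prZ pr_wd.
case: (leqP (size w) B) => hwB; last first.
  rewrite hB // big1 // => i _; rewrite gram_size ?mulr0 // => e.
  by move: (hw i); rewrite -e leqNgt hwB.
have [i ->] := wex _ hwB.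
have /rowP /(_ i) := hD; rewrite !mxE => ->.
by apply: eq_bigr => j _; rewrite mxE gram_sym.
Qed.

Lemma pr_rescale (c : F) x : spanT E x ->
  exists y, spanT E y /\ forall w, pr HU w y = c ^+ size w * pr HU w x.
Proof.
move: x; apply: span_ind => [|b x y [x' [sx hx]] [y' [sy hy]]|v _].
- by exists 0; split=> [|w]; [exact: span0 | rewrite pr0 mulr0].
- exists (b *: x' + y'); split=> [|w]; first exact: span_lin.
  by rewrite !pr_lin hx hy; ring.
exists (c ^+ size v *: wd E v); split=> [|w]; first exact/spanZ/spanT_wd.
rewrite prZ pr_wd; case: (eqVneq (size w) (size v)) => [->|/eqP h] //.
by rewrite gram_size ?mulr0.
Qed.

Lemma pr_weight (nu : {ffun I -> int}) b i x : spanT E x ->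
  (forall w, pr HU w x != 0 -> wt w = nu) -> tw K L b i x = (q : F) ^ (sg b * ap a nu i) *: x.
Proof.
move=> sx h; apply: (pr_inj (HU := HU)) => [||w]; [exact: (tw_span HU) | exact: spanZ |].
rewrite pr_tw // prZ; case: (eqVneq (pr HU w x) 0) => [->|/h <-]; first by rewrite !mulr0.
by rewrite ap_wt.
Qed.

Lemma cst_Xmul i x : spanT E x -> cst HU (E i * x) = 0.
Proof.
move: x; apply: span_ind => [|c x y hx hy|w _].
- by rewrite mulr0; apply: (pr0 HU [::]).
- by rewrite mulrDr -scalerAr cst_lin hx hy mulr0 addr0.
by have := cst_wd HU (w ++ [:: i]); rewrite wd_cat /= mul1r => ->; case: w.
Qed.
End Representability.

(** The basis vector [b] has weight [mu] minus [nu b], with [nu b] in root lattice coordinates.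
    [mr_bound] gives the matrix coefficients on words finite support. *)
Record matrix_rep (F : fieldType) n (a : gcm n) (q : qpar F) (A : algType F)
    (E G K : 'I_n -> A) (m : nat) (R : A -> 'M[F]_m)
    (mu : 'I_n -> int) (nu : 'I_m -> {ffun 'I_n -> int}) := MatrixRep {
  mr_lin : forall c x y, R (c *: x + y) = c *: R x + R y;
  mr_mul : forall x y, R (x * y) = R x *m R y;
  mr_one : R 1 = 1%:M;
  mr_K : forall i b c, R (K i) b c = if b == c then (q : F) ^ (mu i - ap a (nu b) i) else 0;
  mr_bound : exists B, forall w, (B < size w)%N -> R (wd E w) = 0 /\ R (wd G w) = 0 }.

(** * L-operators and the quantum trace *)

Section Rep.
Variables (F : fieldType) (n : nat) (a : gcm n) (q : qpar F).
Notation I := 'I_n.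
Notation qF := (q : F).
Notation Z := ({ffun I -> int}).
Variables (A : algType F) (E G K L : I -> A) (HU : isU a q E G K L).
Let q0 := q_neq0 q.
Let U0 : urel0 a q E G K L. Proof. by case: HU => [[]]. Qed.
Notation HU' := (isU_swap (q_neq0 q) HU).
Variables (m : nat) (R : A -> 'M[F]_m) (mu : I -> int) (nu : 'I_m -> Z).
Hypothesis HR : matrix_rep a q E G K R mu nu.

Let kv i b : F := qF ^ (mu i - ap a (nu b) i).
Let kv0 i b : kv i b != 0. Proof. exact: qexp_neq0. Qed.

Lemma mr_zero : R 0 = 0.
Proof. by have := mr_lin HR (-1) 0 0; rewrite scaler0 addr0 scaleN1r addNr. Qed.
Lemma mr_scale c x : R (c *: x) = c *: R x.
Proof. by have := mr_lin HR c x 0; rewrite mr_zero !addr0. Qed.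
Lemma mr_sum T (r : seq T) (f : T -> A) : R (\sum_(t <- r) f t) = \sum_(t <- r) R (f t).
Proof.
elim: r => [|t r IH]; rewrite ?big_nil ?mr_zero // !big_cons -IH.
by have := mr_lin HR 1 (f t) (\sum_(t <- r) f t); rewrite !scale1r.
Qed.

Lemma mr_Kl i x b c : R (K i * x) b c = kv i b * R x b c.
Proof.
rewrite (mr_mul HR) mxE (bigD1 b) //= (mr_K HR) eqxx big1 ?addr0 // => d.
by rewrite eq_sym (mr_K HR) => /negbTE ->; rewrite mul0r.
Qed.
Lemma mr_Kr i x b c : R (x * K i) b c = R x b c * kv i c.
Proof.
rewrite (mr_mul HR) mxE (bigD1 c) //= (mr_K HR) eqxx big1 ?addr0 // => d.
by rewrite (mr_K HR) => /negbTE ->; rewrite mulr0.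
Qed.
Lemma mr_Lr i x b c : R (x * L i) b c = R x b c * (kv i c)^-1.
Proof.
by apply: (mulIf (kv0 i c)); rewrite -mr_Kr -mulrA (uLK U0) mulr1 divfK.
Qed.

Lemma mr_E_wt w b c : R (wd E w) b c != 0 -> nu c = nu b + wt w.
Proof.
move=> h; apply/eqP; rewrite -subr_eq0; apply/eqP/(@ap_eq0 _ a) => i.
have e : K i * wd E w = qF ^ wp a i w *: (wd E w * K i).
  have := tw_wd HU true i w; rewrite /tw mul1r scalerAl => <-.
  by rewrite -[_ * L i * _]mulrA (uLK U0) mulr1.
have := congr1 (fun x => R x b c) e; rewrite mr_Kl mr_scale mxE mr_Kr.
rewrite mulrC [RHS]mulrCA => /(mulfI h); rewrite /kv -expfzDr // => /qexp_inj.
by rewrite apD apN apD ap_wt; lia.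
Qed.
Lemma mr_G_wt w b c : R (wd G w) b c != 0 -> nu b = nu c + wt w.
Proof.
move=> h; apply/eqP; rewrite -subr_eq0; apply/eqP/(@ap_eq0 _ a) => i.
have := congr1 (fun x => R x b c) (KG_wd HU i w); rewrite mr_Kl mr_scale mxE mr_Kr.
rewrite mulrC [RHS]mulrCA => /(mulfI h); rewrite /kv -expfzDr // => /qexp_inj.
by rewrite apD apN apD ap_wt; lia.
Qed.

(** Cancels, up to sign, the denominator [q - q^-1] in the commutator formula [commE]. *)
Let c0 : F := - (qF - qF^-1).

(** As [R] is linear, its matrix coefficients respect all linear relations between words in [E], so
    [pr_represents] applies to the [G] half. *)
Lemma lower_entries_ex : exists Y : 'I_m -> 'I_m -> A, forall b c,
  spanT G (Y b c) /\ forall w, pr HU' w (Y b c) = c0 ^+ size w * R (wd E w) b c.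
Proof.
have h b c : exists y, spanT G y /\ forall w, pr HU' w y = c0 ^+ size w * R (wd E w) b c.
  have [B hB] := mr_bound HR.
  have [||y sy hy] := @pr_represents _ _ a q A G E L K HU' B (fun w => R (wd E w) b c).
  - by move=> w /hB [-> _]; rewrite mxE.
  - move=> s f e; have := congr1 (fun x => R x b c) e.
    rewrite mr_zero mxE mr_sum summxE => e'; rewrite -[RHS]e'.
    by apply: eq_bigr => w _; rewrite mr_scale mxE.
  have [y' [sy' hy']] := pr_rescale HU' c0 sy.
  by exists y'; split=> // w; rewrite hy' hy.
exists (fun b c => projT1 (cid (h b c))) => b c.
by case: (cid _).
Qed.
Lemma upper_entries_ex : exists X : 'I_m -> 'I_m -> A, forall b c,
  spanT E (X b c) /\ forall w, pr HU w (X b c) = c0 ^+ size w * R (wd G w) b c.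
Proof.
have h b c : exists y, spanT E y /\ forall w, pr HU w y = c0 ^+ size w * R (wd G w) b c.
  have [B hB] := mr_bound HR.
  have [||y sy hy] := @pr_represents _ _ a q A E G K L HU B (fun w => R (wd G w) b c).
  - by move=> w /hB [_ ->]; rewrite mxE.
  - move=> s f e; have := congr1 (fun x => R x b c) e.
    rewrite mr_zero mxE mr_sum summxE => e'; rewrite -[RHS]e'.
    by apply: eq_bigr => w _; rewrite mr_scale mxE.
  have [y' [sy' hy']] := pr_rescale HU c0 sy.
  by exists y'; split=> // w; rewrite hy' hy.
exists (fun b c => projT1 (cid (h b c))) => b c.
by case: (cid _).
Qed.

Section Entries.
Variables (X Y : 'I_m -> 'I_m -> A).
Hypothesis hY : forall b c,
  spanT G (Y b c) /\ forall w, pr HU' w (Y b c) = c0 ^+ size w * R (wd E w) b c.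
Hypothesis hX : forall b c,
  spanT E (X b c) /\ forall w, pr HU w (X b c) = c0 ^+ size w * R (wd G w) b c.
Let sY b c : spanT G (Y b c). Proof. by case: (hY b c). Qed.
Let sX b c : spanT E (X b c). Proof. by case: (hX b c). Qed.
Let pY b c w : pr HU' w (Y b c) = c0 ^+ size w * R (wd E w) b c. Proof. by case: (hY b c). Qed.
Let pX b c w : pr HU w (X b c) = c0 ^+ size w * R (wd G w) b c. Proof. by case: (hX b c). Qed.
Notation e i := (R (E i)).
Notation f i := (R (G i)).

Lemma sum_sr1 (i : I) : \sum_j sr i j = 1 :> int.
Proof.
rewrite (bigD1 i) //= ffunE eqxx big1 ?addr0 // => j ji.
by rewrite ffunE (negbTE ji).
Qed.
Lemma e_wt i b c : e i b c != 0 -> nu c = nu b + sr i.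
Proof. by have := @mr_E_wt [:: i] b c; rewrite /= mul1r wt_cons wt_nil addr0. Qed.
Lemma f_wt i b c : f i b c != 0 -> nu b = nu c + sr i.
Proof. by have := @mr_G_wt [:: i] b c; rewrite /= mul1r wt_cons wt_nil addr0. Qed.

Lemma sd_lower i b c : sd HU' true i (Y b c) = c0 *: \sum_d e i d c *: Y b d.
Proof.
apply: (pr_inj (HU := HU')) => [||w]; [exact: sd_span | exact/spanZ/span_sum/(fun d => spanZ _ (sY b d)) |].
rewrite -[LHS]/(pr HU' (i :: w) (Y b c)) pY /= (mr_mul HR) mxE prZ pr_sum exprS -mulrA; congr (_ * _).
by rewrite mulr_sumr; apply: eq_bigr => d _; rewrite prZ pY; ring.
Qed.
Lemma sd_upper i b c : sd HU true i (X b c) = c0 *: \sum_d f i d c *: X b d.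
Proof.
apply: (pr_inj (HU := HU)) => [||w]; [exact: sd_span | exact/spanZ/span_sum/(fun d => spanZ _ (sX b d)) |].
rewrite -[LHS]/(pr HU (i :: w) (X b c)) pX /= (mr_mul HR) mxE prZ pr_sum exprS -mulrA; congr (_ * _).
by rewrite mulr_sumr; apply: eq_bigr => d _; rewrite prZ pX; ring.
Qed.
Lemma sd_lower' i b c :
  sd HU' false i (Y b c) = c0 *: \sum_d e i b d *: (K i * Y d c * L i).
Proof.
have sKY d : spanT G (K i * Y d c * L i) by apply: (tw_span HU' false i (sY d c)).
apply: (pr_inj (HU := HU')) => [||w]; [exact: sd_span | exact/spanZ/span_sum/(fun d => spanZ _ (sKY d)) |].
rewrite pr_sd // pY size_rcons -cats1 wd_cat /= mul1r (mr_mul HR) mxE prZ pr_sum exprS.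
rewrite !mulr_sumr; apply: eq_bigr => d _.
have := pr_tw HU' false i w (sY d c); rewrite /tw prZ => ->; rewrite pY mulN1r; ring.
Qed.

Lemma E_lower i b c : E i * Y b c - Y b c * E i =
  \sum_d e i d c *: (Y b d * L i) - \sum_d e i b d *: (K i * Y d c).
Proof.
have qq := qqV_neq0 q.
rewrite (commE HU) // sd_lower sd_lower' -!scalerAl -scalerBr scalerA mulrN mulVf // scaleN1r opprB.
rewrite !mulr_suml; congr (_ - _); apply: eq_bigr => d _; rewrite -!scalerAl //.
by rewrite -[_ * L i * K i]mulrA (uLK U0) mulr1.
Qed.

Lemma upper_tw i b c : K i * X b c = qF ^ ap a (nu b - nu c) i *: (X b c * K i).
Proof.
have := @pr_weight _ _ a q A E G K L HU (nu b - nu c) true i _ (sX b c); rewrite mul1r /tw => h.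
rewrite scalerAl -h; first by rewrite -[_ * L i * K i]mulrA (uLK U0) mulr1.
move=> w; rewrite pX => hw; rewrite (@mr_G_wt w b c) ?addrK 1?[nu c + _]addrC ?addrK //.
by apply: contraNneq hw => ->; rewrite mulr0.
Qed.
Lemma lower_tw i b c : K i * Y b c = qF ^ ap a (nu b - nu c) i *: (Y b c * K i).
Proof.
have := @pr_weight _ _ a q A G E L K HU' (nu c - nu b) false i _ (sY b c).
rewrite mulN1r -apN opprB /tw => h.
rewrite scalerAl -h; first by rewrite -[_ * L i * K i]mulrA (uLK U0) mulr1.
move=> w; rewrite pY => hw; rewrite (@mr_E_wt w b c) ?addrK 1?[nu b + _]addrC ?addrK //.
by apply: contraNneq hw => ->; rewrite mulr0.
Qed.

(* The intertwining relation of the upper L-operator; it vanishes because it is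
   stable under all skew derivations and has zero constant term. *)
Let Zd i b c := \sum_d (e i b d *: X d c - e i d c *: X b d) +
  kv i b *: (E i * X b c) - (kv i c)^-1 *: (X b c * E i).
Let sZd i b c : spanT E (Zd i b c).
Proof.
have s1 := spanTM (spanTX E i) (sX b c); have s2 := spanTM (sX b c) (spanTX E i).
apply: spanD; last exact: (spanN (spanZ _ s2)).
apply: spanD; last exact: (spanZ _ s1).
by apply: span_sum => d; apply: spanD; [exact: (spanZ _ (sX d c)) | exact: (spanN (spanZ _ (sX b d)))].
Qed.
Lemma ef_comm i j b c : \sum_d (e i b d * f j d c - f j b d * e i d c) =
  if (i == j) && (b == c) then (kv i b - (kv i b)^-1) / (qF - qF^-1) else 0.
Proof.
have := congr1 (fun x => R x b c) (uEG U0 i j).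
have -> : R (E i * G j - G j * E i) b c = \sum_d (e i b d * f j d c - f j b d * e i d c).
  by rewrite -[_ - _]addrC -scaleN1r (mr_lin HR) !(mr_mul HR) !mxE sumrB mulN1r addrC.
move=> ->; case: eqP => [->|_] /=; last by rewrite mr_zero mxE.
rewrite mr_scale mxE -[K j - L j]addrC -scaleN1r (mr_lin HR) !mxE.
have := mr_Lr j 1 b c; rewrite mul1r (mr_one HR) mxE => ->; rewrite (mr_K HR) -/(kv j b).
by case: eqP => [->|_] /=; rewrite ?mul0r ?mulr0 ?addr0 ?mulr0 // mul1r mulN1r addrC mulrC.
Qed.

Lemma sd_upper_rel i j b c : sd HU true j (Zd i b c) = c0 *: \sum_d f j d c *: Zd i b d.
Proof.
have qq := qqV_neq0 q.
pose S1 := \sum_d \sum_g (e i b g * f j d c) *: X g d.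
pose S2 := \sum_g (\sum_d e i g d * f j d c) *: X b g.
pose S2' := \sum_g (\sum_d f j g d * e i d c) *: X b g.
pose S3 := E i * \sum_d f j d c *: X b d.
pose S4 := (\sum_d (f j d c * (kv i d)^-1) *: X b d) * E i.
(* Exchanging the matrices of [E i] and [G j] leaves a diagonal term; it matches the terms in which
   the skew derivation hits the factor [E i]. *)
have hS : S2 = S2' + (if i == j then (kv i c - (kv i c)^-1) / (qF - qF^-1) else 0) *: X b c.
  rewrite /S2 /S2' -[RHS]addrC; apply/eqP; rewrite -subr_eq; apply/eqP.
  rewrite -sumrB; under eq_bigr do rewrite -scalerBl -sumrB ef_comm.
  rewrite (bigD1 c) //= eqxx andbT big1 ?addr0 // => g gc.
  by rewrite (negbTE gc) andbF scale0r.
have -> : \sum_d f j d c *: Zd i b d = S1 - S2 + kv i b *: S3 - S4.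
  rewrite /Zd; under eq_bigr do rewrite scalerBr scalerDr.
  rewrite sumrB big_split /=; congr (_ + _ - _).
  - rewrite /S1 /S2; under eq_bigr do rewrite scaler_sumr.
    under [X in _ = _ - X]eq_bigr do rewrite scaler_suml.
    rewrite [X in _ = _ - X]exchange_big -sumrB; apply: eq_bigr => d _.
    by rewrite -sumrB; apply: eq_bigr => g _; lin_eq F A; ring.
  - rewrite /S3 mulr_sumr scaler_sumr; apply: eq_bigr => d _.
    by rewrite -scalerAr; lin_eq F A; ring.
  by rewrite /S4 mulr_suml; apply: eq_bigr => d _; rewrite -scalerAl scalerA.
rewrite /Zd -addrA -[_ *: (E i * _) - _]opprB sdD -scaleN1r sdZ sdD -scaleN1r !sdZ sdMX // sdM //; last exact: spanTX.
rewrite sdX sd_upper (big_morph _ (sdD HU true j) (sd0 HU true j)).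
under eq_bigr do rewrite sdD -scaleN1r !sdZ !sd_upper.
have -> : \sum_d (e i b d *: (c0 *: \sum_g f j g c *: X d g) +
    -1 *: (e i d c *: (c0 *: \sum_g f j g d *: X b g))) = c0 *: (S1 - S2').
  rewrite /S1 /S2' [X in _ = _ *: (X - _)]exchange_big /=.
  under [X in _ = _ *: (_ - X)]eq_bigr do rewrite scaler_suml.
  rewrite [X in _ = _ *: (_ - X)]exchange_big /= -sumrB scaler_sumr; apply: eq_bigr => d _.
  rewrite -sumrB !scaler_sumr -big_split; apply: eq_bigr => g _ /=.
  by lin_eq F A; ring.
have -> : tw K L true j (X b c) = qF ^ ap a (nu b - nu c) j *: X b c.
  by rewrite /tw upper_tw -scalerAl -mulrA (uKL U0) mulr1.
have hS4 : (kv i c)^-1 *: (qF ^ (sg true * a j i) *: (c0 *: (\sum_d f j d c *: X b d) * E i)) = c0 *: S4.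
  rewrite /S4 -!scalerAl scalerA scalerA [_ * c0]mulrC -scalerA; congr (_ *: _).
  rewrite scalerAl; congr (_ * _); rewrite scaler_sumr; apply: eq_bigr => d _.
  case: (eqVneq (f j d c) 0) => [->|/f_wt hd]; first by rewrite !(mul0r, mulr0, scale0r, scaler0).
  rewrite scalerA mulrC /kv hd apD ap_sr mul1r; congr ((_ * _) *: _).
  by rewrite !invr_expz -expfzDr // (ca_sym a); congr (_ ^ _); lia.
have k0 := kv0 i c; rewrite (canRL (scalerKV k0) hS4).
rewrite -scalerAr -/S3 [j == i]eq_sym hS; case: eqP => [->|_]; last first.
  by rewrite !(mul0r, scale0r); lin_eq F A; try ring; field.
have kE : kv j b * qF ^ ap a (nu b - nu c) j = kv j c.
  by rewrite /kv -expfzDr // apD apN; congr (_ ^ _); lia.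
have {}k0 := kv0 j c; rewrite [1 * _](mul1r (_ : A)); lin_eq F A.
all: rewrite -?kE /c0; have k1 := kv0 j b; have k2 := qexp_neq0 q (ap a (nu b - nu c) j).
all: move: (kv j b) k1 (qF ^ ap a (nu b - nu c) j) k2 => u u0 v v0; try by ring.
all: by field; rewrite q0 u0 v0 -expr2 q2_neq1.
Qed.

Lemma upper_rel i b c : Zd i b c = 0.
Proof.
apply: (pr_nondeg (HU := HU)) => // v; elim: v b c => [|j v IH] b c /=; last first.
  by rewrite sd_upper_rel prZ pr_sum big1 ?mulr0 // => d _; rewrite prZ IH mulr0.
have X1 d g : pr HU [::] (X d g) = (d == g)%:R by rewrite pX expr0 mul1r (mr_one HR) mxE.
rewrite /Zd -[LHS]/(pr HU [::] _) prD prN prD !prZ pr_sum.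
rewrite -[pr HU _ (E i * _)]/(cst HU _) -[pr HU _ (_ * E i)]/(cst HU _) cst_Xmul // cst_mulX //.
rewrite !mulr0 oppr0 !addr0; under eq_bigr do rewrite prD prN !prZ !X1.
rewrite sumrB (bigD1 c) //= [X in _ - X](bigD1 b) //= !eqxx !mulr1.
by rewrite !big1 ?addr0 ?subrr // => d /negbTE; rewrite 1?[b == d]eq_sym => ->; rewrite mulr0.
Qed.

(** Twice the highest weight in root lattice coordinates. The highest weight itself may lie outside
    the root lattice, where [Kk] has no element for it. *)
Variable kl : Z.
Hypothesis hkl : forall i, ap a kl i = 2 * mu i.
(** Determined by the requirement that [W b d * K i] and [L i * W d c] produce the same scalar
    [kv i c * qF ^ sx b c]. *)
Let sx b c : int := dot [ffun i => mu i] (nu b - nu c) - bf a (nu c) (nu b - nu c).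
Let kap b c : Z := nu b + nu c - kl.
(* Antipode-like twist of [X]: [Y] and [W] have opposite commutation defects with
   [E i], which cancel in the product [Gam]. *)
Let W b c : A := qF ^ sx b c *: (Kk K L (kap b c) * X b c).

Lemma W_Kr i b c d : nu c = nu d + sr i ->
  W b d * K i = (kv i c * qF ^ sx b c) *: (Kk K L (kap b c) * X b d).
Proof.
move=> hd.
have -> : kap b c = kap b d + sr i by rewrite /kap hd addrA [LHS]addrAC.
rewrite (KkS HU) -[in RHS](Kk_sr HU) (KkC HU) (Kk_sr HU) -mulrA upper_tw /W -!scalerAr !scalerA !mulrA -scalerAl.
congr (_ *: _); rewrite /kv -!expfzDr //; congr (_ ^ _).
rewrite /sx hd opprD addrA !dotDr !dotNr [dot _ (sr i)]dotC dot_sr ffunE.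
by rewrite !(bfDl, bfDr, bfNr) !bf_srr !bf_srl !(apD, apN) ap_sr ca_diag; lia.
Qed.
Lemma W_Ll i b c d : nu d = nu b + sr i ->
  L i * W d c = (kv i c * qF ^ sx b c) *: (Kk K L (kap b c) * X d c).
Proof.
move=> hd.
have -> : kap b c = kap d c - sr i by apply/ffunP => j; rewrite /kap hd !ffunE; ring.
rewrite (KkB HU) /W -scalerAr mulrA; congr (_ *: _).
rewrite /kv -!expfzDr //; congr (_ ^ _).
rewrite /sx hd !dotDr [dot _ (sr i)]dotC dot_sr ffunE.
by rewrite !(bfDr) !bf_srr; lia.
Qed.

Lemma W_rel i b c : W b c * E i - E i * W b c =
  \sum_d e i b d *: (L i * W d c) - \sum_d e i d c *: (W b d * K i).
Proof.
have h := upper_rel i b c.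
have -> : \sum_d e i d c *: (W b d * K i) =
    (kv i c * qF ^ sx b c) *: (Kk K L (kap b c) * \sum_d e i d c *: X b d).
  rewrite mulr_sumr scaler_sumr; apply: eq_bigr => d _.
  case: (eqVneq (e i d c) 0) => [->|/e_wt hd]; first by rewrite !(mul0r, mulr0, scale0r, scaler0).
  by rewrite (W_Kr b hd) -scalerAr !scalerA mulrC.
have -> : \sum_d e i b d *: (L i * W d c) =
    (kv i c * qF ^ sx b c) *: (Kk K L (kap b c) * \sum_d e i b d *: X d c).
  rewrite mulr_sumr scaler_sumr; apply: eq_bigr => d _.
  case: (eqVneq (e i b d) 0) => [->|/e_wt hd]; first by rewrite !(mul0r, mulr0, scale0r, scaler0).
  by rewrite (W_Ll c hd) -scalerAr !scalerA mulrC.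
have -> : E i * W b c = (kv i b * kv i c * qF ^ sx b c) *: (Kk K L (kap b c) * (E i * X b c)).
  rewrite /W -scalerAr [in RHS]mulrA (KkE HU) -scalerAl scalerA mulrA; congr (_ *: _).
  rewrite mulrAC -mulrA [X in _ = _ * X]mulrC mulrA -!expfzDr //; congr (_ ^ _).
  by rewrite /kap !(apD, apN) hkl; lia.
rewrite -scalerBr -mulrBr -sumrB.
have -> : \sum_d (e i b d *: X d c - e i d c *: X b d) =
   (kv i c)^-1 *: (X b c * E i) - kv i b *: (E i * X b c).
  by move/eqP: h; rewrite /Zd subr_eq add0r => /eqP <-; rewrite addrK.
rewrite /W mulrBr -!scalerAr -scalerAl !mulrA; have k0 := kv0 i c.
move: (kv i c) k0 (kv i b) (qF ^ sx b c) => u u0 v w.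
by lin_eq F A; try ring; field.
Qed.

Let Gam b c := \sum_d Y b d * W d c.

Lemma Gam_rel i b c : Gam b c * E i - E i * Gam b c =
  \sum_d e i b d *: (K i * Gam d c) - \sum_d e i d c *: (Gam b d * K i).
Proof.
have -> : \sum_d e i b d *: (K i * Gam d c) = \sum_g (\sum_d e i b d *: (K i * Y d g)) * W g c.
  under eq_bigr do rewrite /Gam mulr_sumr scaler_sumr.
  rewrite exchange_big; apply: eq_bigr => g _; rewrite mulr_suml; apply: eq_bigr => d _ /=.
  by rewrite -scalerAl mulrA.
have -> : \sum_d e i d c *: (Gam b d * K i) = \sum_g Y b g * \sum_d e i d c *: (W g d * K i).
  under eq_bigr do rewrite /Gam mulr_suml scaler_sumr.
  rewrite exchange_big; apply: eq_bigr => g _; rewrite mulr_sumr; apply: eq_bigr => d _ /=.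
  by rewrite -[RHS]scalerAr mulrA.
have hE g : \sum_d e i d g *: (Y b d * L i) - E i * Y b g + Y b g * E i = \sum_d e i b d *: (K i * Y d g).
  by have := E_lower i b g => /eqP; rewrite subr_eq => /eqP ->; lin_eq F A; ring.
have hW g : \sum_d e i d c *: (W g d * K i) = \sum_d e i g d *: (L i * W d c) - (W g c * E i - E i * W g c).
  by rewrite W_rel; lin_eq F A; ring.
under [X in _ = X - _]eq_bigr do rewrite -hE.
under [X in _ = _ - X]eq_bigr do rewrite hW.
rewrite /Gam mulr_suml mulr_sumr -!sumrB.
transitivity (\sum_g (Y b g * W g c * E i - E i * (Y b g * W g c)) +
   (\sum_g (\sum_d e i d g *: (Y b d * L i)) * W g c - \sum_g Y b g * \sum_d e i g d *: (L i * W d c))).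
  suff -> : \sum_g (\sum_d e i d g *: (Y b d * L i)) * W g c = \sum_g Y b g * \sum_d e i g d *: (L i * W d c).
    by rewrite subrr addr0.
  under eq_bigr do rewrite mulr_suml.
  rewrite exchange_big; apply: eq_bigr => g _; rewrite mulr_sumr; apply: eq_bigr => d _ /=.
  by rewrite -[LHS]scalerAl -[RHS]scalerAr !mulrA.
rewrite -sumrB -big_split; apply: eq_bigr => g _ /=.
rewrite !(mulrDl, mulrDr, mulrN, mulNr, opprD, opprK, mulrA).
by lin_eq F A; ring.
Qed.

Lemma Gam_K i b c : K i * Gam b c = qF ^ ap a (nu b - nu c) i *: (Gam b c * K i).
Proof.
rewrite /Gam mulr_sumr mulr_suml scaler_sumr; apply: eq_bigr => d _.
have -> : Y b d * W d c = qF ^ sx d c *: (Y b d * Kk K L (kap d c) * X d c) by rewrite -scalerAr mulrA.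
rewrite -scalerAr !mulrA lower_tw -!scalerAl.
have -> : Y b d * K i * Kk K L (kap d c) * X d c = Y b d * Kk K L (kap d c) * (K i * X d c).
  by rewrite -{1}(Kk_sr HU) -[_ * Kk K L (sr i) * _]mulrA (KkC HU) (Kk_sr HU) !mulrA.
rewrite upper_tw -!scalerAr !mulrA !scalerA; congr (_ *: _).
rewrite -mulrA mulrC -!expfzDr //; congr (_ ^ _).
by rewrite !(apD, apN); lia.
Qed.

(** The weights that make the trace quantum: adding a simple root to [nu b] multiplies [gw b] by
    [q^2], which is the scalar that arises when [K i] is moved past the matching off-diagonal entry
    of [Gam]. *)
Let gw b : F := qF ^ (2 * \sum_i nu b i).
Let zc := \sum_b gw b *: Gam b b.

Lemma qtrace_K i : K i * zc = zc * K i.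
Proof.
rewrite /zc mulr_sumr mulr_suml; apply: eq_bigr => b _.
by rewrite -scalerAr -scalerAl Gam_K subrr ap0 scale1r.
Qed.
Lemma qtrace_E i : E i * zc = zc * E i.
Proof.
apply/esym/eqP; rewrite -subr_eq0; apply/eqP.
rewrite /zc mulr_sumr mulr_suml -sumrB.
under eq_bigr do rewrite -scalerAl -scalerAr -scalerBr Gam_rel scalerBr.
rewrite sumrB; under eq_bigr do rewrite scaler_sumr.
under [X in _ - X]eq_bigr do rewrite scaler_sumr.
rewrite exchange_big -sumrB big1 // => d _; rewrite -sumrB big1 // => b _ /=.
case: (eqVneq (e i b d) 0) => [->|/e_wt hd]; first by rewrite !(mul0r, mulr0, scale0r, scaler0) subrr.
rewrite Gam_K hd addrAC subrr add0r !scalerA ap_sr ca_diag; apply/eqP; rewrite subr_eq0; apply/eqP.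
congr (_ *: _); rewrite /gw hd.
under [X in _ = qF ^ (2 * X) * _]eq_bigr do rewrite ffunE.
rewrite big_split /= sum_sr1 mulrDr mulr1.
by rewrite mulrAC -expfzDr.
Qed.

(** At the empty word [Y b d] acts by its constant term, a Kronecker symbol. Only [d = b] remains,
    with [X b b = 1] and the torus element [Kk K L (kap b b)]. *)
Lemma qtrace_nil (V : lmodType F) hV (lam : I -> F) (lam0 : forall i, lam i != 0) (g : sfn a q V) :
  act HU hV lam0 zc g [::] = (\sum_b gw b * lamk lam (nu b + nu b - kl)) *: g [::].
Proof.
rewrite /zc act_sum sfn_sumE scaler_suml; apply: eq_bigr => b _.
rewrite actZ sfnZE -scalerA; congr (_ *: _).
have X1 : X b b = 1.
  apply: (pr_inj (HU := HU)) => [||w]; [by [] | exact: spanT1 |].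
  have -> : 1 = wd E [::] by [].
  rewrite pr_wd gram_sym pX; case: w => [|i w] /=; first by rewrite mul1r (mr_one HR) mxE eqxx.
  case: (eqVneq (R (wd G w * G i) b b) 0) => [->|h]; first by rewrite mulr0.
  by have /eqP := @mr_G_wt (i :: w) b b h; rewrite -subr_eq0 opprD addrA subrr add0r oppr_eq0 => /eqP/wt_eq0.
have -> : Gam b b = \sum_d qF ^ sx d b *: (Y b d * (Kk K L (kap d b) * X d b)).
  by apply: eq_bigr => d _; rewrite -scalerAr.
rewrite act_sum sfn_sumE (bigD1 b) //= big1 ?addr0 => [|d db].
  rewrite actZ sfnZE /sx subrr bf0r /dot big1 => [|i _]; last by rewrite !ffunE mulr0.
  rewrite subrr expr0z scale1r !actM act_spanG_nil // act_Kk_nil X1 act1.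
  by rewrite -[cst HU' _]/(pr HU' [::] _) pY mul1r /= (mr_one HR) mxE eqxx scale1r.
rewrite actZ sfnZE actM act_spanG_nil // -[cst HU' _]/(pr HU' [::] _) pY mul1r /= (mr_one HR) mxE.
by rewrite eq_sym (negbTE db) scale0r scaler0.
Qed.
End Entries.

Theorem qtrace (kl : Z) : (forall i, ap a kl i = 2 * mu i) ->
  exists z, [/\ forall i, K i * z = z * K i, forall i, E i * z = z * E i &
    acts_by HU z [seq (qF ^ (2 * \sum_i nu b i), nu b + nu b - kl) | b <- enum 'I_m]].
Proof.
move=> hkl; have [Y hY] := lower_entries_ex; have [X hX] := upper_entries_ex.
have hK := qtrace_K hY hX kl; have hE := qtrace_E hY hX hkl.
have hn V := qtrace_nil hY hX kl (V := V).
move: hK hE hn; set z := \sum_b _ => hK hE hn; exists z; split=> //.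
have [s [hs _]] := acts_by_ex HU hK hE.
move=> V hV lam lam0 g; rewrite hs; congr (_ *: _).
(* The scalar by which [z] acts is read off on the highest weight vector over [F^o]. *)
have := hn _ (nzF F) lam lam0 (vac a q (1 : F^o)); rewrite hs sfnZE /= => h.
have {}h := etrans (esym (mulr1 _)) (etrans h (mulr1 _)); rewrite h.
by rewrite /clist big_map big_enum.
Qed.
End Rep.

(** * Finite-dimensional highest weight modules *)

Section SL2.
Variables (F : fieldType) (n : nat) (a : gcm n) (q : qpar F).
Notation I := 'I_n.
Notation qF := (q : F).
Let q0 := q_neq0 q.
Variables (A : algType F) (E G K L : I -> A).
Definition sl2_coef k : F := (qF ^+ k.+1 - (qF ^+ k.+1)^-1) / (qF - qF^-1) ^+ 2.
Lemma qn_sub_neq0 k : (0 < k)%N -> qF ^+ k - (qF ^+ k)^-1 != 0.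
Proof.
move=> k0; have qk : qF ^+ k != 0 by rewrite expf_neq0.
rewrite subr_eq0; apply/eqP => /(congr1 ( *%R^~ (qF ^+ k))).
rewrite mulVf // -expr2 -exprM => /eqP; apply/negP/q_nroot; lia.
Qed.
Lemma sl2_coef_neq0 k : sl2_coef k != 0.
Proof. by rewrite mulf_neq0 ?invr_eq0 ?expf_neq0 ?qn_sub_neq0 // (@qn_sub_neq0 1). Qed.

Lemma sl2_comm i k : urel0 a q E G K L ->
  E i ^+ k.+1 * G i - G i * E i ^+ k.+1 =
  sl2_coef k *: (E i ^+ k * (qF ^+ k *: K i - (qF ^+ k)^-1 *: L i)).
Proof.
move=> U; have q1 : qF * qF - 1 != 0 by rewrite -expr2 q2_neq1.
have EG := uEG U i i; rewrite eqxx in EG.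
elim: k => [|k IH].
  rewrite !expr1 EG !expr0 invr1 !scale1r mul1r /sl2_coef expr1; congr (_ *: _).
  by field; rewrite q0 q1.
have -> : E i ^+ k.+2 * G i - G i * E i ^+ k.+2 =
    E i * (E i ^+ k.+1 * G i - G i * E i ^+ k.+1) + (E i * G i - G i * E i) * E i ^+ k.+1.
  by rewrite ![_ ^+ k.+2]exprS mulrBr mulrBl !mulrA addrA subrK.
have KE l : K i * E i ^+ l = (qF ^+ l ^+ 2) *: (E i ^+ l * K i).
  elim: l => [|l IHl]; first by rewrite !expr0 expr1n scale1r mulr1 mul1r.
  rewrite [E i ^+ l.+1]exprSr [LHS]mulrA IHl -[LHS]scalerAl -[E i ^+ l * _ * E i]mulrA (uKE U) ca_diag -[_ ^+ l * _]scalerAr scalerA !mulrA.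
  by congr (_ *: _); rewrite [qF ^+ l.+1]exprSr exprMn !mulrA.
have LE l : L i * E i ^+ l = (qF ^+ l ^+ 2)^-1 *: (E i ^+ l * L i).
  elim: l => [|l IHl]; first by rewrite !expr0 expr1n invr1 scale1r mulr1 mul1r.
  rewrite [E i ^+ l.+1]exprSr [LHS]mulrA IHl -[LHS]scalerAl -[E i ^+ l * _ * E i]mulrA (uLE q0 U) ca_diag -[_ ^+ l * _]scalerAr scalerA !mulrA.
  congr (_ *: _); rewrite -invr_expz -invfM; congr (_^-1).
  by rewrite [qF ^+ l.+1]exprSr exprMn.
rewrite IH EG -scalerAr mulrA -exprS -scalerAl mulrBl KE LE !mulrBr -!scalerAr /sl2_coef.
have qk : qF ^+ k != 0 by rewrite expf_neq0.
rewrite ![_ ^+ k.+2]exprS ![_ ^+ k.+1]exprS; move: (qF ^+ k) qk => u u0.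
move: (E i * E i ^+ k * K i) (E i * E i ^+ k * L i) => x y.
by lin_eq F A; field; rewrite q0 u0 q1.
Qed.
End SL2.

Section HighestWeight.
Variables (F : fieldType) (n : nat) (a : gcm n) (q : qpar F).
Notation I := 'I_n.
Notation qF := (q : F).
Notation Z := ({ffun I -> int}).
Variables (A : algType F) (E G K L : I -> A) (HU : isU a q E G K L).
Let q0 := q_neq0 q.
Let U0 : urel0 a q E G K L. Proof. by case: HU => [[]]. Qed.
Let SG : serre a q G. Proof. by case: HU => [[]]. Qed.
Notation HU' := (isU_swap (q_neq0 q) HU).
Variable m : I -> nat.
Let lam i : F := qF ^ (m i)%:Z.
Let lam0 i : lam i != 0. Proof. exact: qexp_neq0. Qed.
Notation ac := (act HU (nzF F) lam0).
Notation vac1 := (vac a q (1 : F^o)).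
Notation u w := (ac (wd G w) vac1).

Lemma acE_vac i : ac (E i) vac1 = 0.
Proof. by apply: sfn_ext => w; rewrite actE sfn0E. Qed.
Lemma acK_vac i : ac (K i) vac1 = lam i *: vac1.
Proof.
apply: sfn_ext => w; rewrite actK sfnZE; case: w => [|j w] /=; last by rewrite !scaler0.
by rewrite /wp big_nil oppr0 expr0z mulr1.
Qed.
Lemma acL_vac i : ac (L i) vac1 = (lam i)^-1 *: vac1.
Proof.
apply: sfn_ext => w; rewrite actL sfnZE; case: w => [|j w] /=; last by rewrite !scaler0.
by rewrite /wp big_nil expr0z mulr1.
Qed.
(** A dual Verma module has no singular vectors besides the multiples of [vac1]. This forces the
    integrability relations on [vac1], which therefore generates a finite-dimensional module for
    dominant weights. *)
Lemma singular_eq0 (g : sfn a q F^o) : (forall j, ac (E j) g = 0) -> g [::] = 0 -> g = 0.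
Proof.
move=> hE h0; apply: sfn_ext => w; rewrite sfn0E; case: w => [|j w] //.
by rewrite -(actE HU (nzF F) lam0) hE sfn0E.
Qed.
Lemma acG_pow_vac i : ac (G i ^+ (m i).+1) vac1 = 0.
Proof.
apply: singular_eq0 => [j|]; last by rewrite exprS actM actG_nil.
rewrite -actM; have := uEG U0 j i; case: eqP => [->|_ /eqP].
  have := sl2_comm i (m i) (urel0_swap q0 U0) => /(congr1 (fun x => ac x vac1)) /=.
  rewrite actB !actM acE_vac act0r sub0r actZ actM actB !actZ acK_vac acL_vac !scalerA -scalerBl.
  rewrite /lam -exprnP; have qk : qF ^+ m i != 0 by rewrite expf_neq0.
  by rewrite divff // mulVf // subrr scale0r act0r scaler0 => /eqP; rewrite oppr_eq0 => /eqP.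
rewrite subr_eq0 => /eqP h; have /commrX -> : GRing.comm (E j) (G i) by [].
by rewrite actM acE_vac act0r.
Qed.

Lemma serre_pow i j k : i != j -> exists c d,
  G i ^+ k.+1 * G j = c *: (G i * G j * G i ^+ k) + d *: (G j * G i ^+ k.+1).
Proof.
move=> ij; have [h0 h1] := SG ij; case: (ca_off a ij) => [/h0 h|/h1 h].
  exists 0, 1; rewrite scale0r add0r scale1r.
  by apply/esym/commrX; rewrite /GRing.comm h.
elim: k => [|k [c [d IH]]]; first by exists 1, 0; rewrite scale1r scale0r addr0 expr0 mulr1.
have h' : G i * G i * G j = (qF + qF^-1) *: (G i * G j * G i) - G j * G i * G i.
  by apply/eqP; rewrite -subr_eq0 opprB addrA addrAC h.
exists (c * (qF + qF^-1) + d), (- c).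
rewrite exprS -mulrA IH mulrDr -!scalerAr !mulrA h' mulrBl -scalerAl -!mulrA -!exprS.
by lin_eq F A; ring.
Qed.

(** By [serre_pow] a high power of [G i] passes a letter [G j] at the cost of one factor, so the
    property propagates from [vac1] to all words. *)
Lemma loc_nilp i y : spanT G y -> exists N, ac (G i ^+ N * y) vac1 = 0.
Proof.
have up N x : ac (G i ^+ N * x) vac1 = 0 -> forall k, (N <= k)%N -> ac (G i ^+ k * x) vac1 = 0.
  by move=> h k /subnK <-; rewrite exprD -mulrA actM h act0r.
move: y; apply: span_ind => [|c x y [N hN] [N' hN']|w _].
- by exists 0%N; rewrite mulr0 act0.
- exists (N + N')%N; rewrite mulrDr -scalerAr actD actZ (up _ _ hN) ?leq_addr //.
  by rewrite (up _ _ hN') ?leq_addl // scaler0 addr0.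
elim/last_ind: w => [|w j [N hN]]; first by exists (m i).+1; rewrite mulr1 acG_pow_vac.
exists N.+1; rewrite -cats1 wd_cat /= mul1r mulrA; case: (eqVneq i j) => [<-|ij].
  by rewrite -exprSr exprS -mulrA actM (up _ _ hN) // act0r.
have [c [d ->]] := serre_pow N ij.
rewrite mulrDl -!scalerAl -!mulrA actD !actZ !actM.
by rewrite -!(actM HU (nzF F) lam0 (G i ^+ _)) hN (up _ _ hN) // !act0r !scaler0 addr0.
Qed.

Lemma acK_hom i nu y : wspan G nu y -> ac (K i * y) vac1 = qF ^ ((m i)%:Z - ap a nu i) *: ac y vac1.
Proof.
move: y; apply: span_ind => [|c x y hx hy|w <-]; first by rewrite mulr0 act0 scaler0.
  by rewrite mulrDr -scalerAr !actD !actZ hx hy; lin_eq F (sfn a q F^o); ring.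
rewrite (KG_wd HU) actZ actM acK_vac actZr scalerA -expfzDr // -ap_wt; congr (qF ^ _ *: _); lia.
Qed.
Lemma acL_hom i nu y : wspan G nu y -> ac (L i * y) vac1 = qF ^ (- ((m i)%:Z - ap a nu i)) *: ac y vac1.
Proof.
move=> hy; have h := acK_hom i hy.
have : ac (L i * (K i * y)) vac1 = ac y vac1 by rewrite mulrA (uLK U0) mul1r.
by rewrite actM h actZr -actM => <-; rewrite scalerA -expfzDr // addNr expr0z scale1r.
Qed.

(** Represents, inside the [G] half, the effect of [E i] on [y] applied to [vac1]. *)
Let eff i y : A :=
  (qF - qF^-1)^-1 *: (lam i *: sd HU' false i y - (lam i)^-1 *: sd HU' true i y).
Lemma acE_span i y : spanT G y -> ac (E i * y) vac1 = ac (eff i y) vac1.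
Proof.
move=> sy; have := commE HU i sy; move/(congr1 (fun x => ac x vac1)) => /=.
rewrite actB [ac (y * _) _]actM acE_vac act0r subr0 => ->.
rewrite /eff !actZ !actB !actZ !actM acK_vac acL_vac !actZr.
by lin_eq F (sfn a q F^o); ring.
Qed.
Lemma eff_hom i nu y : wspan G nu y -> wspan G (nu - sr i) (eff i y).
Proof. by move=> hy; apply/spanZ/spanD; [|apply/spanN]; apply/spanZ/hom_sd. Qed.

Lemma lowest_string i (Q k : nat) g : g <> 0 -> ac (G i) g = 0 ->
  ac (K i) g = (qF ^+ Q)^-1 *: g -> ac (L i) g = qF ^+ Q *: g ->
  (k <= Q)%N -> ac (E i ^+ k) g <> 0.
Proof.
move=> g0 hG hK hL; elim: k => [|k IH] hk; first by rewrite expr0 act1.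
move=> h; apply: (IH (ltnW hk)).
have := sl2_comm i k U0 => /(congr1 (fun x => ac x g)) /=.
rewrite actB !actM hG h !act0r subrr actZ actM actB !actZ hK hL !scalerA -scalerBl actZr scalerA.
move/esym/eqP; rewrite scaler_eq0 mulf_eq0 (negbTE (sl2_coef_neq0 _ _)) /= => /orP [|/eqP //].
have -> : Q = (k + (Q - k))%N by lia.
have := @qn_sub_neq0 _ q (Q - k) _; rewrite subn_gt0 => /(_ hk).
have qk : qF ^+ k != 0 by rewrite expf_neq0.
have ql : qF ^+ (Q - k) != 0 by rewrite expf_neq0.
rewrite exprD; move: (qF ^+ k) (qF ^+ (Q - k)) qk ql => x y x0 y0.
have -> : x / (x * y) - x^-1 * (x * y) = - (y - y^-1) by field; rewrite x0 y0.
by rewrite oppr_eq0 => /negbTE ->.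
Qed.

Definition is_weight nu := exists2 y, wspan G nu y & ac y vac1 <> 0.

Lemma wt_pow nu i (k : nat) y : wspan G nu y -> wspan G (nu + sr i *+ k) (G i ^+ k * y).
Proof.
move=> hy; elim: k => [|k IH]; first by rewrite expr0 mul1r mulr0n addr0.
rewrite exprS -mulrA mulrS addrCA; move: IH; move: (G i ^+ k * y) (nu + _) => x mu.
move: x; apply: span_ind => [|c x z hx hz|w hw]; first by rewrite mulr0; apply: span0.
  by rewrite mulrDr -scalerAr; apply: span_lin.
have -> : G i * wd G w = wd G (rcons w i) by rewrite -cats1 wd_cat /= mul1r.
by apply: span_wd; rewrite -cats1 wt_cat wt_cons wt_nil addr0 hw addrC.
Qed.

(* A lowest vector of the [i]-string through [nu] is moved up by [E i] to the
   mirror image of [nu]. *)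
Lemma weight_reflect nu i (Q : nat) : is_weight nu -> ap a nu i - (m i)%:Z = Q%:Z ->
  is_weight (nu - sr i *+ Q).
Proof.
move=> [y hy y0] hQ.
have ex : exists N, `[< ac (G i ^+ N * y) vac1 = 0 >].
  by have [N hN] := loc_nilp i (homT hy); exists N; apply/asboolP.
case: (ex_minnP ex) => [[|N]] /asboolP hN hmin; first by rewrite mul1r in hN.
pose l := G i ^+ N * y; have hl : wspan G (nu + sr i *+ N) l by exact: wt_pow.
have l0 : ac l vac1 <> 0 by move=> /asboolP/hmin; rewrite ltnn.
have apl : (m i)%:Z - ap a (nu + sr i *+ N) i = - (Q + N * 2)%N%:Z.
  rewrite apD; have -> : ap a (sr i *+ N) i = (N * 2)%N%:Z.
    by elim: (N) => [|k IH]; rewrite ?mulr0n ?ap0 // mulrS apD IH ap_sr ca_diag; lia.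
  lia.
have := @lowest_string i (Q + N * 2) (Q + N) (ac l vac1) l0.
rewrite -!actM mulrA -exprS hN (acK_hom i hl) (acL_hom i hl) apl opprK -invr_expz -!exprnP.
have le : (Q + N <= Q + N * 2)%N by lia.
move=> /(_ erefl erefl erefl le).
have [z hz ->] : exists2 z, wspan G (nu + sr i *+ N - sr i *+ (Q + N)) z &
    ac (E i ^+ (Q + N) * l) vac1 = ac z vac1.
  elim: (Q + N)%N => [|k [z hz e]]; first by exists l; rewrite ?mulr0n ?subr0 // mul1r.
  exists (eff i z); last by rewrite exprS -mulrA actM e -actM acE_span //; apply: homT hz.
  by rewrite mulrSr opprD addrA; apply: eff_hom.
by exists z => //; move: hz; rewrite mulrnDr opprD [- _ - _]addrC addrA addrK.
Qed.

Lemma weight_word nu : is_weight nu -> exists w, wt w = nu.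
Proof. by move=> [y hy y0]; apply: hom_neq0 hy _ => e; apply: y0; rewrite e act0. Qed.

(** It says that the weight [m] minus [nu] is no longer than [m]. If the weight has a negative label
    at [i], reflecting it preserves its length and lowers the height of [nu]. If it is dominant,
    [ap a nu i] is at most [m i] for all [i], and already half of the bound suffices. *)
Lemma weight_norm nu : is_weight nu -> bf a nu nu <= 2 * \sum_i (m i)%:Z * nu i.
Proof.
have [k] := ubnP (absz (\sum_i nu i)); elim: k nu => // k IH nu hk hnu.
have [w hw] := weight_word hnu.
have nu0 i : 0 <= nu i by rewrite -hw wt_ge0.
case: (pselect (exists i, (m i)%:Z < ap a nu i)) => [[i hi]|hno].
  pose Q := absz (ap a nu i - (m i)%:Z).
  have hQ : ap a nu i - (m i)%:Z = Q%:Z by rewrite /Q; lia.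
  have h := weight_reflect hnu hQ.
  have [w' hw'] := weight_word h.
  have sE : \sum_j (sr i *+ Q) j = Q%:Z.
    by under eq_bigr do rewrite ffunMnE; rewrite sumrMnl sum_sr1; lia.
  have mE : \sum_j (m j)%:Z * (sr i *+ Q) j = Q%:Z * (m i)%:Z.
    by rewrite -(sum_sr (fun j => (m j)%:Z) i) mulr_sumr; apply: eq_bigr => j _; rewrite ffunMnE; ring.
  have aE j : ap a (sr i *+ Q) j = Q%:Z * a i j.
    by elim: (Q) => [|l IHl]; rewrite ?mulr0n ?ap0 ?mul0r // mulrS apD IHl ap_sr; lia.
  have bE k' : bf a k' (sr i *+ Q) = Q%:Z * ap a k' i.
    by elim: (Q) => [|l IHl]; rewrite ?mulr0n ?bf0r ?mul0r // mulrS bfDr IHl bf_srr; lia.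
  have bE' k' : bf a (sr i *+ Q) k' = Q%:Z * ap a k' i.
    by elim: (Q) => [|l IHl]; rewrite ?mulr0n ?bf0l ?mul0r // mulrS bfDl IHl bf_srl; lia.
  have hS : \sum_j (nu - sr i *+ Q) j = \sum_j nu j - Q%:Z.
    by rewrite -sE -sumrB; apply: eq_bigr => j _; rewrite !ffunE.
  have := IH _ _ h.
  have -> : \sum_j (m j)%:Z * (nu - sr i *+ Q) j = \sum_j (m j)%:Z * nu j - Q%:Z * (m i)%:Z.
    by rewrite -mE -sumrB; apply: eq_bigr => j _; rewrite !ffunE mulrBr.
  rewrite !(bfDl, bfDr, bfNl, bfNr) !bE !bE' aE ca_diag.
  have s0 : 0 <= \sum_j nu j by rewrite sumr_ge0.
  have s1 : 0 <= \sum_j (nu - sr i *+ Q) j by rewrite sumr_ge0 // => j _; rewrite -hw' wt_ge0.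
  rewrite hS in s1 *; move=> h1; have {}h1 := h1 _; nia.
have h1 : bf a nu nu <= \sum_i (m i)%:Z * nu i.
  apply: ler_sum => i _; apply: ler_wpM2r => //.
  by rewrite leNgt; apply/negP => hi; apply: hno; exists i.
have : 0 <= \sum_i (m i)%:Z * nu i by apply: sumr_ge0 => i _; apply: mulr_ge0.
lia.
Qed.

Variable bnd : nat.
Hypothesis hbnd : forall nu : Z, (forall i, 0 <= nu i) ->
  bf a nu nu <= 2 * \sum_i (m i)%:Z * nu i -> \sum_i nu i <= bnd%:Z.

Lemma long_word_vac w : (bnd < size w)%N -> u w = 0.
Proof.
move=> hw; apply/eqP/negPn/negP => /eqP h.
have hwt : is_weight (wt w) by exists (wd G w) => //; apply: span_wd.
have := hbnd (wt_ge0 w) (weight_norm hwt); rewrite wt_size; lia.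
Qed.
Lemma u_support w v : u w v != 0 -> wt v = wt w.
Proof.
move=> h; apply/eqP; rewrite -subr_eq0; apply/eqP/(@ap_eq0 _ a) => i.
have := acK_hom i (span_wd G (erefl (wt w))).
rewrite actM => /(congr1 (fun f : sfn a q F^o => f v)); rewrite actK sfnZE => /(mulIf h).
by rewrite -expfzDr // => e; have := @qexp_inj _ q _ _ e; rewrite apD apN !ap_wt; lia.
Qed.
Lemma u_long w v : (bnd < size v)%N -> u w v = 0.
Proof.
move=> hv; case: (eqVneq (u w v) 0) => // h; have := u_support h => /(congr1 (fun k : Z => \sum_i k i)).
by rewrite !wt_size => [[e]]; rewrite long_word_vac -?e // sfn0E.
Qed.

Definition in_mod (g : sfn a q F^o) := exists2 y, spanT G y & ac y vac1 = g.
Lemma in_mod_lin c f g : in_mod f -> in_mod g -> in_mod (c *: f + g).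
Proof.
by move=> [x sx <-] [y sy <-]; exists (c *: x + y); [exact: span_lin | rewrite actD actZ].
Qed.
Lemma in_mod0 : in_mod 0.
Proof. by exists 0; [exact: span0 | rewrite act0]. Qed.
Lemma in_mod_ind (P : sfn a q F^o -> Prop) : P 0 ->
  (forall c f g, P f -> P g -> P (c *: f + g)) -> (forall w, P (u w)) ->
  forall g, in_mod g -> P g.
Proof.
move=> P0 Pl Pu g [y sy <-]; move: y sy; apply: span_ind => [|c x y hx hy|w _] //.
  by rewrite act0.
by rewrite actD actZ; apply: Pl.
Qed.
Lemma in_mod_act x g : in_mod g -> in_mod (ac x g).
Proof.
move: x g; apply: (gen_ind HU) => [g|c x y hx hy g hg|x y hx hy g hg|i].
- by rewrite act1.
- by rewrite actD actZ; apply: in_mod_lin; [apply: hx | apply: hy].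
- by rewrite actM; apply/hx/hy.
split=> g [y sy <-].
- rewrite -actM acE_span //; exists (eff i y) => //.
  by apply/spanZ/spanD; [|apply/spanN]; apply/spanZ/sd_span.
- by rewrite -actM; exists (G i * y) => //; apply: spanTM => //; apply: spanTX.
- exists (lam i *: (K i * y * L i)); first by apply/spanZ/(tw_span HU' false i sy).
  by rewrite actZ -actZr -acK_vac -actM -mulrA (uLK U0) mulr1 actM.
exists ((lam i)^-1 *: (L i * y * K i)); first by apply/spanZ/(tw_span HU' true i sy).
by rewrite actZ -actZr -acL_vac -actM -mulrA (uKL U0) mulr1 actM.
Qed.
Lemma in_mod_long g v : in_mod g -> (bnd < size v)%N -> g v = 0.
Proof.
move=> hg hv; move: g hg; apply: in_mod_ind => [|c f g hf hg|w].
- by rewrite sfn0E.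
- by rewrite sfnDE sfnZE hf hg scaler0 addr0.
exact: u_long.
Qed.

Let W := undup (words_le n bnd).
Let N := size W.
Let wn (i : 'I_N) := nth [::] W i.
Let wn_size i : (size (wn i) <= bnd)%N.
Proof. by rewrite -mem_words_le -mem_undup mem_nth. Qed.
Let wn_ex w : (size w <= bnd)%N -> exists i, wn i = w.
Proof.
rewrite -mem_words_le -mem_undup -/W => wW; have hi : (index w W < N)%N by rewrite index_mem.
by exists (Ordinal hi); rewrite /wn nth_index.
Qed.
Let wn_inj : injective wn.
Proof. by move=> i j /eqP; rewrite nth_uniq ?undup_uniq // => /eqP/ord_inj. Qed.

(** Rows tabulate the vectors [u w] on the words of length at most [bnd]. A maximal independent set
    of rows yields a basis of weight vectors of the submodule generated by [vac1]. *)
Let M : 'M[F]_N := \matrix_(i, j) u (wn i) (wn j).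
Let mr := maxrankfun M.
Let bs j := u (wn (mr j)).
Let Bm := rowsub mr M.
Let vals (g : sfn a q F^o) : 'rV[F]_N := \row_j g (wn j).
Let vals_lin c f g : vals (c *: f + g) = c *: vals f + vals g.
Proof. by apply/rowP => j; rewrite !mxE sfnDE sfnZE. Qed.
Let vals0 : vals 0 = 0.
Proof. by apply/rowP => j; rewrite !mxE sfn0E. Qed.
Let vals_inj g : in_mod g -> vals g = 0 -> g = 0.
Proof.
move=> hg /rowP h; apply: sfn_ext => v; rewrite sfn0E.
case: (leqP (size v) bnd) => [/wn_ex [i <-]|hv]; last exact: in_mod_long.
by have := h i; rewrite !mxE.
Qed.
Let vals_sub g : in_mod g -> (vals g <= Bm)%MS.
Proof.
move: g; apply: in_mod_ind => [|c f g hf hg|w]; first by rewrite vals0 sub0mx.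
  by rewrite vals_lin addmx_sub ?scalemx_sub.
rewrite eq_maxrowsub; case: (leqP (size w) bnd) => [/wn_ex [i <-]|hw]; last first.
  by rewrite long_word_vac // vals0 sub0mx.
have -> : vals (u (wn i)) = row i M by apply/rowP => j; rewrite !mxE.
exact: row_sub.
Qed.
Let in_bs j : in_mod (bs j).
Proof. by exists (wd G (wn (mr j))) => //; apply: spanT_wd. Qed.
Let cv g := vals g *m pinvmx Bm.
Let cv_lin c f g : cv (c *: f + g) = c *: cv f + cv g.
Proof. by rewrite /cv vals_lin mulmxDl scalemxAl. Qed.
Let sum_bs (c : 'rV[F]_(\rank M)) : vals (\sum_i c 0 i *: bs i) = c *m Bm.
Proof.
rewrite mulmx_sum_row; elim/big_rec2: _ => [|i x y _ <-]; first by rewrite vals0.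
by rewrite vals_lin; congr (_ *: _ + _); apply/rowP => j; rewrite !mxE.
Qed.
Let in_sum_bs (c : 'rV[F]_(\rank M)) : in_mod (\sum_i c 0 i *: bs i).
Proof.
by elim/big_rec: _ => [|i x _ hx]; [exact: in_mod0 | apply: in_mod_lin].
Qed.
Let cvK g : in_mod g -> g = \sum_i cv g 0 i *: bs i.
Proof.
move=> hg; apply/eqP; rewrite -subr_eq0; apply/eqP; rewrite -[_ - _]addrC -scaleN1r.
apply: vals_inj; first exact: in_mod_lin.
by rewrite vals_lin sum_bs mulmxKpV ?vals_sub // scaleN1r addNr.
Qed.
Let cv_eq g (c : 'rV[F]_(\rank M)) : g = \sum_i c 0 i *: bs i -> cv g = c.
Proof. by move=> ->; rewrite /cv sum_bs mulmxKp // maxrowsub_free. Qed.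

Let R x : 'M[F]_(\rank M) := \matrix_(i, j) cv (ac x (bs j)) 0 i.
Let nu j : Z := wt (wn (mr j)).

Let RE x i j : R x i j = cv (ac x (bs j)) 0 i. Proof. by rewrite mxE. Qed.

Lemma hw_rep : matrix_rep a q E G K R (fun i => (m i)%:Z) nu.
Proof.
split.
- move=> c x y; apply/matrixP => i j; rewrite [RHS]mxE [X in _ = X + _]mxE !RE actD actZ cv_lin.
  by rewrite [LHS]mxE [X in X + _ = _]mxE.
- move=> x y; apply/matrixP => i j; rewrite RE actM.
  have -> : ac x (ac y (bs j)) = \sum_k R y k j *: ac x (bs k).
    rewrite {1}[ac y (bs j)]cvK; last exact: in_mod_act.
    have sumE (r : seq 'I_(\rank M)) (f : 'I_(\rank M) -> sfn a q F^o) :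
        ac x (\sum_(k <- r) f k) = \sum_(k <- r) ac x (f k).
      by elim: r => [|k r IH]; rewrite ?big_nil ?act0r // !big_cons actDr IH.
    by rewrite sumE; apply: eq_bigr => k _; rewrite actZr RE.
  have -> : cv (\sum_k R y k j *: ac x (bs k)) = \sum_k R y k j *: cv (ac x (bs k)).
    elim/big_rec2: _ => [|k z z' _ <-]; first by rewrite /cv vals0 mul0mx.
    by rewrite cv_lin.
  rewrite summxE [RHS]mxE; apply: eq_bigr => k _.
  by rewrite [LHS]mxE (RE x) mulrC.
- apply/matrixP => i j; rewrite RE act1 (@cv_eq _ (delta_mx 0 j)) ?mxE ?eqxx //.
  rewrite (bigD1 j) //= mxE !eqxx scale1r big1 ?addr0 // => k kj.
  by rewrite mxE (negbTE kj) andbF scale0r.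
- move=> i j k; rewrite RE.
  rewrite (@cv_eq _ (qF ^ ((m i)%:Z - ap a (nu k) i) *: delta_mx 0 k)); last first.
    rewrite (bigD1 k) //= !mxE !eqxx mulr1 big1 ?addr0 => [|l lk]; last first.
      by rewrite !mxE (negbTE lk) andbF mulr0 scale0r.
    by rewrite -actM; apply/acK_hom/span_wd.
  by rewrite !mxE eqxx /=; case: eqP => [->|_]; rewrite ?mulr1 ?mulr0.
exists bnd => w hw; split; apply/matrixP => i j; rewrite RE [RHS]mxE.
  have -> : ac (wd E w) (bs j) = 0.
    by apply: sfn_ext => v; rewrite act_wd sfn0E in_mod_long // size_cat; lia.
  by rewrite /cv vals0 mul0mx mxE.
rewrite -actM -wd_cat long_word_vac; last by rewrite size_cat; lia.
by rewrite /cv vals0 mul0mx mxE.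
Qed.

(** Only the empty word has weight zero, and the list of words has no repetition. The multiplicity
    one becomes the leading coefficient of the trace. *)
Lemma hw_zero_weight : count_mem 0 [seq nu j | j <- enum 'I_(\rank M)] = 1%N.
Proof.
have [j hj] : exists j, nu j = 0.
  apply/not_existsP => h; have hv : in_mod vac1 by exists 1; [exact: spanT1 | rewrite act1].
  have := congr1 (fun f : sfn a q F^o => f [::]) (cvK hv).
  rewrite sfn_sumE big1 => [/eqP|i _]; first by rewrite oner_eq0.
  rewrite sfnZE; case: (eqVneq (bs i [::]) 0) => [->|/u_support e]; first by rewrite scaler0.
  by case: (h i); rewrite /nu -e wt_nil.
have hu : forall k, nu k = 0 -> k = j.
  move=> k hk; apply: (@maxrankfun_inj _ _ _ M); apply: wn_inj.
  by rewrite (wt_eq0 hk) (wt_eq0 hj).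
rewrite count_map (eq_count (a2 := pred1 j)) ?count_uniq_mem ?enum_uniq ?mem_enum // => k /=.
by apply/eqP/eqP => [/hu|->].
Qed.

Theorem hw_trace (kl : Z) : (forall i, ap a kl i = 2 * (m i)%:Z) ->
  exists (z : A) (vs : seq Z), [/\ forall i, K i * z = z * K i, forall i, E i * z = z * E i,
    forall v, v \in vs -> forall i, 0 <= v i, count_mem 0 vs = 1%N &
    acts_by HU z [seq (qF ^ (2 * \sum_i v i), v + v - kl) | v : Z <- vs]].
Proof.
move=> hkl; have [z [hK hE hz]] := qtrace HU hw_rep hkl.
exists z, [seq nu j | j <- enum 'I_(\rank M)]; split=> //; last by rewrite -map_comp.
- by move=> v /mapP [j _ ->] i; apply: wt_ge0.
exact: hw_zero_weight.
Qed.
End HighestWeight.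

(** * Roots and weights of type D *)

Section RootsD.
Variables (n : nat) (hn : (5 <= n)%N).
Notation I := 'I_n.
Notation Z := ({ffun I -> int}).

Definition nv (x : Z) (k : nat) : int := if insub k is Some i then x i else 0.
Lemma nvE x (i : I) : nv x i = x i.
Proof. by rewrite /nv valK. Qed.
Lemma nv_ffun (f : nat -> int) k : (k < n)%N -> nv [ffun j : I => f j] k = f k.
Proof. by move=> hk; rewrite /nv insubT ffunE. Qed.
Lemma sum_delta (x : Z) k : (k < n)%N -> \sum_(j < n) x j * (j == k :> nat)%:Z = nv x k.
Proof.
move=> hk; rewrite (bigD1 (Ordinal hk)) //= eqxx mulr1 big1 ?addr0 => [|j /eqP jk].
  by rewrite /nv insubT.
by case: eqP => [e|_]; rewrite ?mulr0 //; case: jk; apply/val_inj.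
Qed.

(** With coordinates counted from 0: [e_i - e_(i+1)] for the nodes before the last, and
    [e_(n-2) + e_(n-1)] for the last one. *)
Definition alf (i k : nat) : int :=
  if i == n.-1 then (k == (n - 2)%N)%:Z + (k == n.-1)%:Z else (k == i)%:Z - (k == i.+1)%:Z.
Definition al (i : I) : Z := [ffun k : I => alf i k].

Lemma dot_al x (i : I) : dot x (al i) =
  if i == n.-1 :> nat then nv x (n - 2) + nv x n.-1 else nv x i - nv x i.+1.
Proof.
rewrite /dot; under eq_bigr do rewrite ffunE /alf.
have hi := ltn_ord i; case: eqP => hin.
  under eq_bigr do rewrite mulrDr.
  by rewrite big_split /= !sum_delta //; lia.
under eq_bigr do rewrite mulrBr.
by rewrite sumrB /= !sum_delta //; lia.
Qed.

Lemma dot_al_al i j : dot (al i) (al j) = cartanD i j.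
Proof.
have hi := ltn_ord i; have hj := ltn_ord j.
rewrite /cartanD /D_adj -(inj_eq val_inj) /=.
rewrite dot_al; case: (j == n.-1 :> nat) / eqP => h1.
  rewrite !(nv_ffun (alf i)); try lia.
  by rewrite /alf; case: (i == n.-1 :> nat) / eqP => h2; do ![case: ifP => /=]; lia.
rewrite !(nv_ffun (alf i)); try lia.
by rewrite /alf; case: (i == n.-1 :> nat) / eqP => h2; do ![case: ifP => /=]; lia.
Qed.

(** Passage from root lattice coordinates to the standard coordinates of [Z^n]. *)
Definition eps (k : Z) : Z := [ffun j => \sum_i k i * al i j].
Lemma dot_eps x k : dot x (eps k) = \sum_i k i * dot x (al i).
Proof.
rewrite /dot; under eq_bigr do rewrite ffunE mulr_sumr.
rewrite exchange_big; apply: eq_bigr => i _; rewrite mulr_sumr; apply: eq_bigr => j _ /=; ring.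
Qed.

(* [dl j] is, up to the factor [dlc j], the fundamental weight dual to [al j]. *)
Definition dlf (j k : nat) : int :=
  if (j < n - 2)%N then (k <= j)%N%:Z else if (j == n - 2)%N && (k == n.-1) then -1 else 1.
Definition dl (j : nat) : Z := [ffun k : I => dlf j k].
Definition dlc (j : nat) : int := if (j < n - 2)%N then 1 else 2.
Lemma dot_dl j i : (j < n)%N -> dot (dl j) (al i) = dlc j * (j == i)%:Z.
Proof.
move=> hj; have hi := ltn_ord i.
rewrite dot_al; case: (i == n.-1 :> nat) / eqP => h; rewrite !(nv_ffun (dlf j)); try lia.
all: rewrite /dlf /dlc; case: (eqVneq j i) => h1; rewrite /=; do ![case: ifP => /=]; lia.
Qed.
Lemma eps_eq0 k : eps k = 0 -> k = 0.
Proof.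
move=> h; apply/ffunP => j; rewrite ffunE.
have d0 : dot (dl j) 0 = 0 by rewrite /dot big1 // => i _; rewrite !ffunE mulr0.
have := dot_eps (dl j) k; rewrite h d0; under eq_bigr do rewrite dot_dl //.
rewrite (bigD1 j) //= eqxx big1 => [|i ij]; last first.
  by rewrite [(_ == _ :> nat)](inj_eq val_inj) eq_sym (negbTE ij) !mulr0.
by rewrite /dlc; case: ifP; lia.
Qed.

Lemma cartanD_sym (i j : I) : cartanD i j = cartanD j i.
Proof. by rewrite -!dot_al_al dotC. Qed.
Lemma cartanD_diag (i : I) : cartanD i i = 2.
Proof. by rewrite /cartanD eqxx. Qed.
Lemma cartanD_off (i j : I) : i != j -> cartanD i j = 0 \/ cartanD i j = -1.
Proof. by move=> h; rewrite /cartanD (negbTE h); case: D_adj; [right|left]. Qed.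
Lemma dot_epsC k x : dot (eps k) x = \sum_i k i * dot (al i) x.
Proof. by rewrite dotC dot_eps; apply: eq_bigr => i _; rewrite dotC. Qed.
Lemma dot_self_eq0 (x : Z) : dot x x <= 0 -> x = 0.
Proof.
move=> h; apply/ffunP => i; rewrite ffunE.
have : x i * x i <= 0.
  apply: le_trans h; rewrite /dot (bigD1 i) //= lerDl sumr_ge0 // => j _; nia.
by rewrite -expr2 => h2; apply/eqP; rewrite -sqrf_eq0 eq_le h2 sqr_ge0.
Qed.
Lemma cartanD_pos (v : Z) : \sum_i \sum_j cartanD i j * v i * v j <= 0 -> v = 0.
Proof.
move=> h; apply/eps_eq0/dot_self_eq0; rewrite dot_eps.
suff -> : \sum_i v i * dot (eps v) (al i) = \sum_i \sum_j cartanD i j * v i * v j by [].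
apply: eq_bigr => i _; rewrite dot_epsC mulr_sumr; apply: eq_bigr => j _.
by rewrite dotC dot_al_al; ring.
Qed.
Definition gcmD : gcm n := Gcm cartanD_sym cartanD_diag cartanD_off cartanD_pos.

Lemma ap_eps k i : ap gcmD k i = dot (eps k) (al i).
Proof. by rewrite dot_epsC; apply: eq_bigr => j _; rewrite dot_al_al. Qed.
Lemma bf_eps k l : bf gcmD k l = dot (eps k) (eps l).
Proof. by rewrite dot_eps; apply: eq_bigr => j _; rewrite ap_eps mulrC. Qed.
Lemma epsD k l : eps (k + l) = eps k + eps l.
Proof.
by apply/ffunP => j; rewrite !ffunE -big_split; apply: eq_bigr => i _; rewrite ffunE mulrDl.
Qed.
Lemma epsN k : eps (- k) = - eps k.
Proof. by apply/ffunP => j; rewrite !ffunE -sumrN; apply: eq_bigr => i _; rewrite ffunE mulNr. Qed.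
Lemma eps_inj : injective eps.
Proof.
move=> k l h; apply/eqP; rewrite -subr_eq0; apply/eqP/eps_eq0.
by rewrite epsD epsN h subrr.
Qed.
Lemma eps_sr i : eps (sr i) = al i.
Proof.
apply/ffunP => j; rewrite ffunE (bigD1 i) //= ffunE eqxx mul1r big1 ?addr0 // => k ki.
by rewrite ffunE (negbTE ki) mul0r.
Qed.

Definition rho : Z := [ffun j : I => (n.-1 - j)%N%:Z].
Definition ht (x : Z) : int := dot rho x.
Lemma ht_al i : ht (al i) = 1.
Proof.
have hi := ltn_ord i; rewrite /ht dot_al; case: eqP => h.
  rewrite !(nv_ffun (fun j => (n.-1 - j)%N%:Z)); lia.
rewrite !(nv_ffun (fun j => (n.-1 - j)%N%:Z)); lia.
Qed.
Lemma ht_eps k : ht (eps k) = \sum_i k i.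
Proof. by rewrite /ht dot_eps; apply: eq_bigr => i _; rewrite -/(ht _) ht_al mulr1. Qed.

Definition unit_vec (k : nat) : Z := [ffun j : I => (j == k :> nat)%:Z].
Lemma double_unit k : (k < n)%N -> exists l, eps l = unit_vec k + unit_vec k.
Proof.
move=> hk; have [j hj] : exists j, (k + j = n.-1)%N by exists (n.-1 - k)%N; lia.
elim: j k hk hj => [|j IH] k hk hj.
  have h1 : (n.-1 < n)%N by lia.
  have h2 : (n - 2 < n)%N by lia.
  exists (sr (Ordinal h1) - sr (Ordinal h2)); rewrite epsD epsN !eps_sr.
  by apply/ffunP => i; rewrite !ffunE /alf /= eqxx; have := ltn_ord i; case: ifP; lia.
have hk1 : (k.+1 < n)%N by lia.
have hj1 : (k.+1 + j = n.-1)%N by lia.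
have [l hl] := IH k.+1 hk1 hj1.
exists (l + (sr (Ordinal hk) + sr (Ordinal hk))); rewrite !epsD hl eps_sr.
by apply/ffunP => i; rewrite !ffunE /alf /=; case: ifP; lia.
Qed.
Lemma double_root x : exists l, eps l = x + x.
Proof.
have -> : x + x = \sum_(k < n) [ffun j => x k * (unit_vec k + unit_vec k) j].
  apply/ffunP => j; rewrite sum_ffunE ffunE (bigD1 j) //= !ffunE eqxx big1; first lia.
  by move=> k kj; rewrite !ffunE [(_ == _ :> nat)](inj_eq val_inj) eq_sym (negbTE kj) mulr0.
elim/big_ind: _ => [|y z [k hk] [l hl]|k _].
- by exists 0; apply/ffunP => j; rewrite !ffunE big1 // => i _; rewrite ffunE mul0r.
- by exists (k + l); rewrite epsD hk hl.
have [l hl] := double_unit (ltn_ord k); exists [ffun i => x k * l i].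
apply/ffunP => j; rewrite -hl !ffunE mulr_sumr; apply: eq_bigr => i _; rewrite !ffunE; ring.
Qed.
Lemma dot_al_eq0 x : (forall i, dot x (al i) = 0) -> x = 0.
Proof.
move=> h; apply: dot_self_eq0; have [l hl] := double_root x.
have : dot x (x + x) = 0 by rewrite -hl dot_eps big1 // => i _; rewrite h mulr0.
rewrite dotDr; lia.
Qed.

Definition dominant x := forall i, 0 <= dot x (al i).
Lemma dominant_nv x k : dominant x -> (k < n.-1)%N -> 0 <= nv x k.
Proof.
move=> hx hk; have [j hj] : exists j, (k + j = n - 2)%N by exists (n - 2 - k)%N; lia.
elim: j k hk hj => [|j IH] k hk hj.
  have h1 : (n.-1 < n)%N by lia.
  have h2 : (n - 2 < n)%N by lia.
  have := hx (Ordinal h1); have := hx (Ordinal h2); rewrite !dot_al /= eqxx.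
  have -> : (n - 2 == n.-1)%N = false by lia.
  have -> : (n - 2).+1 = n.-1 by lia.
  have -> : k = (n - 2)%N by lia.
  lia.
have h1 : (k < n)%N by lia.
have := hx (Ordinal h1); rewrite dot_al /=.
have -> : (k == n.-1)%N = false by lia.
have := IH k.+1; lia.
Qed.
Lemma dominant_ht x : dominant x -> 0 <= ht x.
Proof.
move=> hx; apply: sumr_ge0 => j _; rewrite ffunE.
have hj := ltn_ord j; case: (ltnP j n.-1) => h; last by rewrite (_ : (_ - _)%N = 0%N) ?mul0r //; lia.
by apply: mulr_ge0 => //; rewrite -nvE; apply: dominant_nv.
Qed.

Definition refl i (x : Z) : Z := [ffun j => x j - dot x (al i) * al i j].
Lemma dot_refl t i x : dot t (refl i x) = dot t x - dot x (al i) * dot t (al i).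
Proof.
rewrite /dot [in RHS]mulr_sumr -sumrB; apply: eq_bigr => j _; rewrite ffunE; ring.
Qed.
Lemma ht_refl i x : ht (refl i x) = ht x - dot x (al i).
Proof. by rewrite /ht dot_refl -/(ht (al i)) ht_al mulr1. Qed.
Lemma eps_rfl i k : eps (rfl gcmD i k) = refl i (eps k).
Proof.
apply/ffunP => j; rewrite [LHS]ffunE [RHS]ffunE [eps k j]ffunE -ap_eps.
rewrite -(sum_sr (fun l => al l j) i) mulr_sumr -sumrB.
by apply: eq_bigr => l _; rewrite [rfl _ _ _ _]ffunE; ring.
Qed.

Lemma dot_refl_al i (x : Z) : dot (refl i x) (al i) = - dot x (al i).
Proof. by rewrite dotC dot_refl dot_al_al cartanD_diag dotC; ring. Qed.
Lemma sum_eps_even (k : Z) : (2 %| \sum_j eps k j)%Z.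
Proof.
have -> : \sum_j eps k j = dot [ffun=> 1] (eps k).
  by apply: eq_bigr => j _; rewrite [in RHS]ffunE mul1r.
rewrite dot_eps; elim/big_ind: _ => [|y z|i _]; [by []|lia|].
rewrite mulrC; apply: dvdz_mulr; have hi' := ltn_ord i.
by rewrite dot_al; case: ifP => hi; rewrite !(nv_ffun (fun=> 1)); lia.
Qed.

(** Even labels at consecutive nodes give all coordinates of [eps k] the same parity. Their sum is
    even because [eps k] is in the root lattice, and with an odd number of coordinates the common
    parity is even. *)
Lemma even_eps k : odd n -> (forall i, (2 %| ap gcmD k i)%Z) ->
  exists x, eps k = x + x.
Proof.
move=> hodd h.
have hpar j : (j < n)%N -> (2 %| nv (eps k) j - nv (eps k) 0)%Z.
  elim: j => [|j IH] hj; first by rewrite subrr dvdz0.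
  have h1 : (j < n)%N by lia.
  have := h (Ordinal h1); rewrite ap_eps dot_al /=.
  have -> : (j == n.-1)%N = false by lia.
  have := IH h1; lia.
have hsum := sum_eps_even k.
have h0 : (2 %| nv (eps k) 0)%Z.
  have : (2 %| \sum_(j < n) (nv (eps k) j - nv (eps k) 0))%Z.
    by elim/big_ind: _ => [|y z|j _]; [by []|lia|apply/hpar/ltn_ord].
  rewrite sumrB sumr_const card_ord.
  under eq_bigr do rewrite nvE.
  move: (\sum_j _) hsum (nv _ _) => s hs y; rewrite -mulr_natl; nia.
exists [ffun j => (eps k j %/ 2)%Z]; apply/ffunP => j; rewrite !ffunE.
have := hpar j (ltn_ord j); rewrite nvE ffunE; lia.
Qed.

(* Each coordinate of a weight no longer than [x] is at most [dot x x]. *)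
Lemma weight_bound (m : I -> nat) x : (forall i, dot x (al i) = (m i)%:Z) ->
  exists B : nat, forall nu : Z, (forall i, 0 <= nu i) ->
    bf gcmD nu nu <= 2 * \sum_i (m i)%:Z * nu i -> \sum_i nu i <= B%:Z.
Proof.
move=> hx; pose C := dot x x.
have C0 : 0 <= C by apply: sumr_ge0 => i _; nia.
exists (absz (\sum_(j < n) n%:Z * (C + `|x j|))) => nu _ h.
have hd : dot (x - eps nu) (x - eps nu) <= C.
  have e : dot x (eps nu) = \sum_i (m i)%:Z * nu i.
    by rewrite dot_eps; apply: eq_bigr => i _; rewrite hx mulrC.
  rewrite !(dotDl, dotDr, dotNl, dotNr) [dot (eps nu) x]dotC e -bf_eps /C; lia.
have hc j : `|eps nu j| <= C + `|x j|.
  have : (x - eps nu) j * (x - eps nu) j <= C.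
    apply: le_trans hd; rewrite /dot (bigD1 j) //= lerDl sumr_ge0 // => l _; nia.
  rewrite !ffunE; move: (\sum_i _) (x j) => y z; nia.
rewrite -ht_eps gez0_abs; last by apply: sumr_ge0 => j _; nia.
apply: ler_sum => j _; rewrite ffunE.
have := hc j; move: (eps nu j) (C + _) => y z hyz; have : ((n.-1 - j)%N <= n)%N by lia.
nia.
Qed.
End RootsD.

(** * Invariant Laurent polynomials and the center *)

Lemma half_double (y : int) : ((y + y) %/ 2)%Z = y.
Proof. lia. Qed.

Section Laurent.
Variables (F : fieldType) (n : nat) (hn : (5 <= n)%N) (q : qpar F).
Notation I := 'I_n.
Notation Z := ({ffun I -> int}).
Notation qF := (q : F).
Let q0 := q_neq0 q.
Implicit Types (r : seq (F * Z)) (f g : Z -> F).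

Definition lau r (t : Z) : F := \sum_(p <- r) p.1 * qF ^ (2 * dot t p.2).

Lemma lau_eq0 r : (forall t, lau r t = 0) -> forall k, cf r k = 0.
Proof.
move=> h k; case: (boolP (k \in keys r)) => [hk|]; last exact: cf_notin.
pose dbl (k : Z) := k + k; pose hlf (k : Z) : Z := [ffun j => (k j %/ 2)%Z].
have hlfK x : hlf (dbl x) = x by apply/ffunP => j; rewrite /hlf /dbl !ffunE half_double.
have := @char_indep F n q F^o (map dbl (keys r)) (fun k => cf r (hlf k)) _ _ (dbl k).
rewrite hlfK; apply; last by rewrite map_f.
  by rewrite map_inj_uniq ?undup_uniq //; apply: can_inj hlfK.
move=> t _; rewrite big_map -[RHS](h t) /lau (sum_cf r (fun k => qF ^ (2 * dot t k))).
apply: eq_bigr => x _; rewrite hlfK -[_ *: _]/(_ * _) mulrC; congr (_ * qF ^ _).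
by rewrite /dbl dotDr; lia.
Qed.
Lemma cf_cat r r' k : cf (r ++ r') k = cf r k + cf r' k.
Proof. by rewrite /cf big_cat. Qed.
Lemma cf_scale c r k : cf [seq (c * p.1, p.2) | p <- r] k = c * cf r k.
Proof. by rewrite /cf big_map mulr_sumr. Qed.
Lemma lau_cat r r' t : lau (r ++ r') t = lau r t + lau r' t.
Proof. by rewrite /lau big_cat. Qed.
Lemma lau_scale c r t : lau [seq (c * p.1, p.2) | p <- r] t = c * lau r t.
Proof. by rewrite /lau big_map mulr_sumr; apply: eq_bigr => p _; rewrite mulrA. Qed.
Lemma lau_cf_inj r r' : (forall t, lau r t = lau r' t) -> forall k, cf r k = cf r' k.
Proof.
move=> h k; have := @lau_eq0 (r ++ [seq (-1 * p.1, p.2) | p <- r']) _ k.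
rewrite cf_cat cf_scale mulN1r => e; apply/eqP; rewrite -subr_eq0; apply/eqP/e => t.
by rewrite lau_cat lau_scale h mulN1r subrr.
Qed.

Definition inv_fun f := exists r, (forall t, f t = lau r t) /\
  forall i k, cf r (refl i k) = cf r k.

Definition lead f (l : Z) := exists r,
  (forall t, f t = qF ^ (2 * dot t l) + lau r t) /\ forall p, p \in r -> ht p.2 < ht l.
Lemma lead_lau f l r : lead f l -> (forall t, f t = lau r t) ->
  cf r l = 1 /\ forall k, k != l -> ht l <= ht k -> cf r k = 0.
Proof.
move=> [s [hs hl]] hr.
have e k : cf r k = (l == k)%:R + cf s k.
  rewrite (@lau_cf_inj r ((1, l) :: s)); last first.
    by move=> t; rewrite -hr hs /lau big_cons /= mul1r.
  by rewrite /cf big_cons /=; case: eqP => _; rewrite ?add0r.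
have s0 k : ht l <= ht k -> cf s k = 0.
  move=> h; rewrite /cf big1_seq // => p /andP [/eqP pk /hl]; rewrite pk ltNge.
  by rewrite h.
split=> [|k kl hk]; rewrite e s0 ?addr0 ?eqxx //.
by rewrite eq_sym (negbTE kl).
Qed.
Lemma lead_one : lead (fun=> 1) 0.
Proof.
exists [::]; split=> // t; rewrite /lau big_nil addr0 /dot big1 ?mulr0 ?expr0z // => i _.
by rewrite ffunE mulr0.
Qed.
Lemma htD x y : ht (x + y : Z) = ht x + ht y. Proof. exact: dotDr. Qed.
Lemma lead_mul f g k l : lead f k -> lead g l -> lead (fun t => f t * g t) (k + l).
Proof.
move=> [r [hr lr]] [s [hs ls]].
exists ([seq (p.1, p.2 + l) | p <- r] ++ ([seq (p.1, k + p.2) | p <- s] ++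
   [seq (p.1 * p'.1, p.2 + p'.2) | p <- r, p' <- s])).
have qD t (x y : Z) : qF ^ (2 * dot t (x + y)) = qF ^ (2 * dot t x) * qF ^ (2 * dot t y).
  by rewrite -expfzDr // -mulrDr dotDr.
split=> [t|p].
  have e1 : lau [seq (p.1, p.2 + l) | p <- r] t = lau r t * qF ^ (2 * dot t l).
    by rewrite /lau big_map mulr_suml; apply: eq_bigr => p _ /=; rewrite qD mulrA.
  have e2 : lau [seq (p.1, k + p.2) | p <- s] t = qF ^ (2 * dot t k) * lau s t.
    by rewrite /lau big_map mulr_sumr; apply: eq_bigr => p _ /=; rewrite qD mulrCA.
  have e3 : lau [seq (p.1 * p'.1, p.2 + p'.2) | p <- r, p' <- s] t = lau r t * lau s t.
    rewrite /lau big_allpairs_dep mulr_suml; apply: eq_bigr => p _.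
    by rewrite mulr_sumr; apply: eq_bigr => p' _ /=; rewrite qD mulrACA.
  by rewrite hr hs !lau_cat e1 e2 e3 qD; ring.
rewrite !mem_cat => /or3P [/mapP [x /lr hx ->]|/mapP [x /ls hx ->]|/allpairsP [[x y] /= [/lr hx /ls hy ->]]] /=.
all: by rewrite !htD ?ltrD2l ?ltrD2r ?ltrD.
Qed.

(** Reflecting a weight at a negative label raises its height, and a dominant weight has nonnegative
    height. A weight of negative height in the support would thus produce further ones with heights
    climbing towards zero, which must stop. *)
Lemma cf_gap r : (forall i k, cf r (refl i k) = cf r k) ->
  (forall k, cf r k != 0 -> ht k < 0) -> forall k, cf r k = 0.
Proof.
move=> ir hr k; apply/eqP/negPn/negP => hk.
have [N] := ubnP (absz (ht k)); elim: N k hk => // N IH k hk hN.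
have hlt := hr _ hk.
case: (pselect (dominant k)) => [/(dominant_ht hn) hd|hnd]; first by move: hlt; rewrite ltNge hd.
have [i hi] : exists i, ~ (0 <= dot k (al i)) by apply/not_existsP => h; apply: hnd => i; apply: contrapT => /h.
 apply: (IH (refl i k)); first by rewrite ir.
have := hr (refl i k); rewrite ir => /(_ hk); rewrite ht_refl //; move: hi; lia.
Qed.

(* Peel off the weights of maximal height, which are dominant by invariance. *)
Lemma inv_ind (P : (Z -> F) -> Prop) : P (fun=> 0) ->
  (forall c f g, P f -> P g -> P (fun t => c * f t + g t)) ->
  (forall l, dominant l -> exists g, [/\ inv_fun g, lead g l & P g]) ->
  forall f, inv_fun f -> P f.
Proof.
move=> P0 Pl Pd f hf.
(* A nested induction: [h%:Z - 1] bounds the heights in the support and [T] lists the weights that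
   may attain the bound. The shift by one makes [h = 0] the case of negative heights, settled by
   [cf_gap]. *)
suff H (h : nat) : forall (T : seq Z) f r, (forall t, f t = lau r t) ->
    (forall i k, cf r (refl i k) = cf r k) ->
    (forall k, cf r k != 0 -> ht k <= h%:Z - 1 /\ (ht k = h%:Z - 1 -> k \in T)) -> P f.
  have [r [hr ir]] := hf.
  have [B hB] : exists B : nat, forall k, k \in keys r -> ht k < B%:Z.
    elim: (keys r) => [|k s [B hB]]; first by exists 0%N.
    exists (B + (absz (ht k)).+1)%N => l; rewrite inE => /orP [/eqP ->|/hB]; lia.
  apply: (H B.+1 [::] f r hr ir) => k hk.
  have : k \in keys r by apply: contraNT hk => /cf_notin ->.
  by move/hB => hkB; split; lia.
elim: h => [|h IHh].
  move=> T {hf}f r hr ir hk; have z0 : forall k, cf r k = 0.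
    by apply: cf_gap => // k /hk []; lia.
  suff -> : f = fun=> 0 by [].
  apply/funext => t; rewrite hr /lau (sum_cf r (fun k => qF ^ (2 * dot t k))) big1 // => k _.
  by rewrite z0 mul0r.
elim=> [|l T IHT] {hf}f r hr ir hk.
  apply: (IHh (undup [seq p.2 | p <- r]) f r hr ir) => k k0; have [h1 h2] := hk k k0; split.
    by case: (eqVneq (ht k) (h.+1%:Z - 1)) => [/h2 //|]; lia.
  by move=> _; apply: contraNT k0 => /cf_notin ->.
case: (pselect (cf r l != 0 /\ ht l = h.+1%:Z - 1)) => [[l0 hl]|hno]; last first.
  apply: (IHT f r hr ir) => k k0; have [h1 h2] := hk k k0; split=> // e.
  by have := h2 e; rewrite inE => /orP [/eqP kl|//]; case: hno; rewrite -kl.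
have hdom : dominant l.
  by move=> i; have [] := hk (refl i l) _; rewrite ?ir // ht_refl //; lia.
have [g [[s [hs js]] lg Pg]] := Pd l hdom.
have [s1 s2] := lead_lau lg hs.
have -> : f = fun t => cf r l * g t + (- cf r l * g t + f t).
  by apply/funext => t; rewrite mulNr addNKr.
apply: Pl => //.
apply: (IHT _ ([seq (- cf r l * p.1, p.2) | p <- s] ++ r)) => [t|i k|k].
- by rewrite lau_cat lau_scale hs hr.
- by rewrite !cf_cat !cf_scale js ir.
rewrite cf_cat cf_scale; case: (eqVneq k l) => [->|kl]; first by rewrite s1 mulr1 addNr eqxx.
case: (leP (ht l) (ht k)) => hlk.
  rewrite s2 // mulr0 add0r => k0; have [h1 h2] := hk k k0; split=> // e.
  by have := h2 e; rewrite inE (negbTE kl).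
by move=> _; split; lia.
Qed.
End Laurent.

(** * Evaluation of central elements at shifted weights *)

Section Center.
Variables (F : fieldType) (n : nat) (hn : (5 <= n)%N) (q : qpar F).
Notation I := 'I_n.
Notation Z := ({ffun I -> int}).
Notation qF := (q : F).
Let q0 := q_neq0 q.
Variables (A : algType F) (E G K L : I -> A) (HU : isU (gcmD hn) q E G K L).

(* [ev z] is the value of [z] on the highest weight [- t - rho]; the sign makes the
   weight [lam] of a module contribute [q ^ (2 * dot t lam)]. *)
Definition tv (t : Z) : Z := [ffun j => dot (- t - rho n) (al j)].
Definition ev (z : A) (t : Z) : F :=
  act HU (nzF F) (qlam_neq0 q (tv t)) z (vac (gcmD hn) q (1 : F^o)) [::].
Definition cent (z : A) := (forall i, K i * z = z * K i) /\ (forall i, E i * z = z * E i).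

Lemma ev_lin c x y t : ev (c *: x + y) t = c * ev x t + ev y t.
Proof. by rewrite /ev actD actZ sfnDE sfnZE. Qed.
Lemma ev_one t : ev 1 t = 1. Proof. by rewrite /ev act1. Qed.
Lemma ev_zero t : ev 0 t = 0. Proof. by rewrite /ev act0 sfn0E. Qed.
Lemma cent_central z : cent z -> forall u, z * u = u * z.
Proof. by move=> [hK hE]; apply: (central_of_comm HU hK hE). Qed.
Lemma cent_acts z : cent z -> exists s, acts_by HU z s /\ refl_inv (gcmD hn) q s.
Proof. by move=> [hK hE]; apply: acts_by_ex. Qed.
Lemma cent_lin c x y : cent x -> cent y -> cent (c *: x + y).
Proof.
move=> [kx ex] [ky ey]; split=> i; rewrite mulrDl mulrDr -scalerAl -scalerAr.
  by rewrite kx ky.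
by rewrite ex ey.
Qed.
Lemma cent_mul x y : cent x -> cent y -> cent (x * y).
Proof.
by move=> [kx ex] [ky ey]; split=> i; rewrite mulrA ?kx ?ex -!mulrA ?ky ?ey.
Qed.
Lemma cent_one : cent 1.
Proof. by split=> i; rewrite mulr1 mul1r. Qed.

Lemma dot_tv t k : dot (tv t) k = - dot t (eps k) - \sum_i k i.
Proof.
rewrite -ht_eps // /ht -dotNl -dotNl -dotDl dot_eps; apply: eq_bigr => i _.
by rewrite ffunE mulrC.
Qed.
Lemma ev_acts z s t : acts_by HU z s ->
  ev z t = \sum_(p <- s) p.1 * qF ^ (- (\sum_i p.2 i) - dot t (eps p.2)).
Proof.
move=> hs; rewrite /ev hs sfnZE -[_ *: _]/(_ * _) mulr1; apply: eq_bigr => p _.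
by rewrite lamk_qlam dot_tv addrC.
Qed.
Lemma ev_mul x y t : cent x -> cent y -> ev (x * y) t = ev x t * ev y t.
Proof.
move=> /cent_acts [s [hs _]] /cent_acts [s' [hs' _]].
rewrite /ev actM hs' actZr hs !sfnZE; rewrite -![_ *: _]/(_ * _) !mulr1; exact: mulrC.
Qed.
Lemma ev_eq0 z : cent z -> (forall t, ev z t = 0) -> z = 0.
Proof.
move=> cz h; have [s [hs _]] := cent_acts cz.
suff c0 k : cf s k = 0.
  apply: (acts_by_eq0 hs) => t _; rewrite /clist (sum_cf s (lamk (qlam q t))) big1 // => k _.
  by rewrite c0 mul0r.
case: (boolP (k \in keys s)) => [hk|]; last exact: cf_notin.
pose nk (k : Z) : Z := - eps k.
have inj : injective nk by move=> x y /oppr_inj/(eps_inj hn).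
(* A left inverse of [nk], with default value 0 outside its image. *)
have [pk hpk] : exists pk : Z -> Z, forall k, pk (nk k) = k.
  exists (fun y => if pselect (exists k, nk k = y) is left e then projT1 (cid e) else 0) => x.
  by case: pselect => [e|[]]; [case: (cid e) => y /= /inj | exists x].
have := @char_indep F n q F^o (map nk (keys s)) (fun y => cf s (pk y) * qF ^ (- \sum_i pk y i)) _ _ (nk k).
rewrite hpk => hi.
suff : cf s k * qF ^ (- \sum_i k i) = 0.
  by move/eqP; rewrite mulf_eq0 (negbTE (qexp_neq0 _ _)) orbF => /eqP.
apply: hi; last by rewrite map_f.
  by rewrite map_inj_uniq ?undup_uniq.
move=> t _; rewrite big_map -[RHS](h t) (ev_acts _ hs).
rewrite (sum_cf s (fun k => qF ^ (- (\sum_i k i) - dot t (eps k)))); apply: eq_bigr => x _.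
by rewrite hpk -[_ *: _]/(_ * _) expfzDr // /nk dotNr mulrC mulrA.
Qed.

(** Multiplying the coefficients by [q] to minus the height absorbs the shift by rho and turns
    [refl_inv_cf] into plain invariance. On the support [eps k] is twice a vector of [Z^n], by
    [refl_inv_even] and [even_eps], so the weights can be halved. *)
Lemma ev_inv z : odd n -> cent z -> inv_fun q (ev z).
Proof.
move=> hodd cz; have [s [hs ri]] := cent_acts cz.
pose ct k := cf s k * qF ^ (- \sum_i k i).
have ct_rfl i k : ct (rfl (gcmD hn) i k) = ct k.
  have sE : \sum_j rfl (gcmD hn) i k j = \sum_j k j - ap (gcmD hn) k i.
    by rewrite -!(ht_eps hn) eps_rfl ht_refl // ap_eps.
  have := refl_inv_cf i ri k; rewrite rfl_i /ct sE => e.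
  have -> : - (\sum_j k j - ap (gcmD hn) k i) = - (k i - ap (gcmD hn) k i) + (k i - \sum_j k j).
    by ring.
  by rewrite expfzDr // mulrA -e -mulrA -expfzDr //; congr (_ * _ ^ _); ring.
have rflE i k : rfl (gcmD hn) i (rfl (gcmD hn) i k) = k by exact: rflK.
pose hlf (k : Z) : Z := [ffun j => (- k j %/ 2)%Z].
pose ks := [seq k <- keys s | cf s k != 0].
pose r := [seq (ct k, hlf (eps k)) | k <- ks].
have dblK k : cf s k != 0 -> eps k = - (hlf (eps k) + hlf (eps k)).
  move=> k0; have [x hx] := @even_eps n hn k hodd (fun i => refl_inv_even i ri k0).
  by rewrite hx; apply/ffunP => j; rewrite !ffunE [- (x j + x j)]opprD half_double; ring.
have cfr k x : eps k = - (x + x) -> cf r x = ct k.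
  move=> hk; rewrite /cf /r big_map /= big_filter_cond.
  have hE l : (cf s l != 0) && (hlf (eps l) == x) = (cf s l != 0) && (l == k).
    case: (eqVneq (cf s l) 0) => //= l0; apply/eqP/eqP => [e|->].
      by apply: (eps_inj hn); rewrite hk -e; apply: dblK.
    by rewrite hk; apply/ffunP => j; rewrite !ffunE opprK half_double.
  under eq_bigl do rewrite hE.
  case: (eqVneq (cf s k) 0) => [k0|k0].
    by rewrite /ct k0 mul0r big1 // => l /andP [l0 /eqP e]; rewrite e k0 eqxx in l0.
  have kin : k \in keys s by apply: contraNT k0 => /cf_notin ->.
  rewrite big_mkcond (bigD1_seq k) ?undup_uniq //= k0 eqxx big1 ?addr0 // => l lk.
  by rewrite (negbTE lk) andbF.
have cfr0 x : (forall k, eps k <> - (x + x)) -> cf r x = 0.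
  move=> hx; rewrite /cf /r big_map big1_seq // => k /andP [/eqP e].
  by rewrite mem_filter => /andP [k0 _]; case: (hx k); rewrite -e; apply: dblK.
exists r; split=> [t|i x].
  rewrite (ev_acts _ hs) (sum_cf s (fun k => qF ^ (- (\sum_i k i) - dot t (eps k)))).
  rewrite /lau big_map big_filter [RHS]big_mkcond; apply: eq_bigr => k _ /=.
  case: eqP => [->|/eqP k0]; first by rewrite mul0r.
  rewrite /ct /= -mulrA -expfzDr //; congr (_ * _ ^ _).
  by rewrite {1}(dblK k k0) dotNr dotDr; lia.
case: (pselect (exists k, eps k = - (x + x))) => [[k hk]|hno].
  rewrite (cfr k x hk) -(ct_rfl i); apply: cfr; rewrite eps_rfl hk.
  by apply/ffunP => j; rewrite !ffunE dotNl dotDl; ring.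
rewrite !cfr0 // => k hk; apply: hno; first by exists k.
exists (rfl (gcmD hn) i k); rewrite eps_rfl hk; apply/ffunP => j.
by rewrite ffunE dotNl dotDl (dot_refl_al hn) !ffunE; ring.
Qed.

Lemma ev_lead l : dominant l -> exists2 z, cent z & lead q (ev z) l.
Proof.
move=> hl; pose m i := absz (dot l (al i)).
have hm i : dot l (al i) = (m i)%:Z by have := hl i; rewrite /m; lia.
have [kl hkl] := double_root hn l.
have [B hB] := weight_bound hn hm.
have hkl2 i : ap (gcmD hn) kl i = 2 * (m i)%:Z.
  by rewrite ap_eps hkl dotDl hm; lia.
have [z [vs [hK hE vs0 vs1 hz]]] := hw_trace HU hB hkl2.
have cz : cent z by [].
(* This scalar removes the factor [q^(sum of kl)] common to all terms, so that the leading
   coefficient is 1. The summand 0 only gives the term the shape of [cent_lin]. *)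
exists (qF ^ (- \sum_i kl i) *: z + 0).
  by apply: cent_lin => //; split=> i; rewrite mulr0 mul0r.
have evE t : ev (qF ^ (- \sum_i kl i) *: z + 0) t = \sum_(v <- vs) qF ^ (2 * dot t (l - eps v)).
  rewrite ev_lin ev_zero addr0 (ev_acts _ hz) big_map mulr_sumr; apply: eq_bigr => v _ /=.
  rewrite mulrA -!expfzDr //; congr (_ ^ _).
  rewrite -!(ht_eps hn) !epsD epsN hkl /ht !(dotDr, dotNr); lia.
exists [seq (1, l - eps v) | v <- vs & v != 0]; split=> [t|p].
  rewrite evE (bigID (pred1 0)) /= /lau big_map big_filter; congr (_ + _); last first.
    by apply: eq_bigr => v _; rewrite mul1r.
  rewrite -big_filter (eq_big_seq (fun=> qF ^ (2 * dot t l))).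
    by move: vs1; rewrite -size_filter; case: (filter _ vs) => [|v []] // _; rewrite big_seq1.
  move=> v; rewrite mem_filter => /andP [/eqP -> _]; congr (qF ^ (2 * dot t _)).
  by apply/ffunP => j; rewrite !ffunE big1 ?subr0 // => i _; rewrite ffunE mul0r.
move=> /mapP [v]; rewrite mem_filter => /andP [v0 /vs0 vge] -> /=.
rewrite /ht dotDr dotNr -![dot (rho n) _]/(ht _) ht_eps // gtrDl oppr_lt0 lt_def sumr_ge0 ?andbT //.
rewrite psumr_eq0 //; apply: contra v0 => /allP h; apply/eqP/ffunP => i; rewrite ffunE.
by apply/eqP/h; rewrite mem_index_enum.
Qed.

Theorem ev_surj f : odd n -> inv_fun q f -> exists2 z, cent z & forall t, ev z t = f t.
Proof.
move=> hodd; move: f; apply: (inv_ind hn (P := fun f => exists2 z, cent z & forall t, ev z t = f t)) => [|c g h [x cx hx] [y cy hy]|l /ev_lead [z cz lz]].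
- by exists 0; [split=> i; rewrite mulr0 mul0r | apply: ev_zero].
- by exists (c *: x + y); [apply: cent_lin | move=> t; rewrite ev_lin hx hy].
by exists (ev z); split=> //; [apply: ev_inv | exists z].
Qed.
End Center.

(** * Half-spin characters *)

Section HalfSpin.
Variables (F : fieldType) (n : nat) (hn : (5 <= n)%N) (q : qpar F).
Notation I := 'I_n.
Notation Z := ({ffun I -> int}).
Notation S := ({ffun I -> bool}).
Notation qF := (q : F).
Let q0 := q_neq0 q.

Lemma reflK i : involutive (@refl n i).
Proof. by move=> x; apply/ffunP => j; rewrite ffunE (dot_refl_al hn) ffunE; ring. Qed.
Lemma reflD i (x y : Z) : refl i (x + y) = refl i x + refl i y.
Proof. by apply/ffunP => j; rewrite !ffunE dotDl; ring. Qed.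
(** Twice a weight of a half-spin representation, which keeps the coordinates integral. *)
Definition sgv (b : S) : Z := [ffun i => if b i then -1 else 1].
Lemma sgv_inj : injective sgv.
Proof.
move=> b c /ffunP h; apply/ffunP => i; have := h i; rewrite !ffunE.
by case: (b i) (c i) => [] [].
Qed.
Lemma sgv_pm b k : (k < n)%N -> nv (sgv b) k = 1 \/ nv (sgv b) k = -1.
Proof. by move=> hk; rewrite /nv insubT ffunE; case: (b _); [right|left]. Qed.
Lemma refl_sgv_pm i b j : refl i (sgv b) j = 1 \/ refl i (sgv b) j = -1.
Proof.
have hi := ltn_ord i; have hj := ltn_ord j.
rewrite ffunE [al i j]ffunE /alf dot_al // -[sgv b j]nvE.
case: ifP => h.
  have [h1 h2] : (n - 2 < n)%N /\ (n.-1 < n)%N by lia.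
  have e1 := sgv_pm b h1; have e2 := sgv_pm b h2; have e3 := sgv_pm b hj.
  case: (eqVneq (j : nat) (n - 2)%N) => [e|]; first by rewrite e (_ : (n - 2 == n.-1)%N = false); lia.
  case: (eqVneq (j : nat) n.-1) => [e|]; first by rewrite e; lia.
  lia.
have h1 : (i.+1 < n)%N by lia.
have e1 := sgv_pm b h1; have e2 := sgv_pm b hi; have e3 := sgv_pm b hj.
case: (eqVneq (j : nat) i) => [e|]; first by rewrite e (_ : (i == i.+1 :> nat) = false); lia.
case: (eqVneq (j : nat) i.+1) => [e|]; first by rewrite e; lia.
lia.
Qed.
Definition ru i b : S := [ffun j => refl i (sgv b) j == -1].
Lemma sgv_ru i b : sgv (ru i b) = refl i (sgv b).
Proof. by apply/ffunP => j; rewrite [LHS]ffunE [ru i b j]ffunE; case: (refl_sgv_pm i b j) => ->. Qed.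
Lemma ruK i : involutive (ru i).
Proof. by move=> b; apply: sgv_inj; rewrite !sgv_ru reflK. Qed.

Definition tb (c : bool) : S := [ffun i : I => c && (i == n.-1 :> nat)].
(* The weights of a half-spin representation are the [sgv b / 2] congruent to
   the highest one modulo the root lattice. *)
Definition cl (c : bool) (b : S) := `[< exists k, eps k + eps k = sgv (tb c) - sgv b >].
Lemma cl_top c : cl c (tb c).
Proof.
apply/asboolP; exists 0; rewrite subrr -epsD addr0.
by apply/ffunP => j; rewrite !ffunE big1 // => i _; rewrite ffunE mul0r.
Qed.
Lemma cl_ru c i b : cl c (ru i b) = cl c b.
Proof.
suff h b' : cl c b' -> cl c (ru i b') by apply/idP/idP => [/h|/h //]; rewrite ruK.
move=> /asboolP [k hk]; apply/asboolP.
have [d hd] : exists d, dot (sgv b') (al i) = d + d.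
  have hi := ltn_ord i; rewrite dot_al //; case: ifP => h.
    have [h1 h2] : (n - 2 < n)%N /\ (n.-1 < n)%N by lia.
    have [-> | ->] := sgv_pm b' h1; have [-> | ->] := sgv_pm b' h2; by [exists 1|exists 0|exists (-1)].
  have h1 : (i.+1 < n)%N by lia.
  have [-> | ->] := sgv_pm b' h1; have [-> | ->] := sgv_pm b' hi; by [exists 1|exists 0|exists (-1)].
exists (k + [ffun j => d * sr i j]); rewrite sgv_ru.
have -> : eps (k + [ffun j => d * sr i j]) = eps k + [ffun j => d * al i j].
  rewrite epsD; congr (_ + _); apply/ffunP => j; rewrite [LHS]ffunE [RHS]ffunE -eps_sr ffunE mulr_sumr.
  by apply: eq_bigr => l _; rewrite ffunE mulrA.
rewrite addrACA hk; apply/ffunP => j; rewrite [refl _ _]/refl hd !ffunE; ring.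
Qed.
(** [rho] vanishes at the last coordinate, so equal heights would leave only the last sign free.
    Changing this sign alone leaves the class, because the coordinates of a root lattice vector have
    even sum. *)
Lemma cl_ht c b : cl c b -> b != tb c -> ht (sgv b) < ht (sgv (tb c)).
Proof.
move=> /asboolP [k hk] bt.
have le (j : I) : (j < n.-1)%N -> sgv b j <= sgv (tb c) j.
  by move=> hj; rewrite !ffunE (ltn_eqF hj) andbF; case: (b j).
have rj (j : I) : rho n j = (n.-1 - j)%N%:Z by rewrite ffunE.
have hle : forall j, true -> rho n j * sgv b j <= rho n j * sgv (tb c) j.
  move=> j _; rewrite rj; have hj := ltn_ord j; case: (ltnP j n.-1) => h.
    by apply: ler_wpM2l => //; apply: le.
  by rewrite (_ : (_ - _)%N = 0%N) ?mul0r //; lia.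
rewrite /ht /dot lt_neqAle ler_sum // andbT; apply/negP => /eqP e.
have he (j : I) : (j < n.-1)%N -> sgv b j = sgv (tb c) j.
  move=> hj; have : \sum_j (rho n j * sgv (tb c) j - rho n j * sgv b j) = 0 by rewrite sumrB e subrr.
  move/eqP; rewrite psumr_eq0 => [|l _]; last by rewrite subr_ge0 hle.
  move=> /allP /(_ j (mem_index_enum j)) /=; rewrite -mulrBr mulf_eq0 rj subr_eq0 => /orP [|/eqP //].
  by lia.
have h1 : (n.-1 < n)%N by lia.
pose l := Ordinal h1.
have hl j : j != l -> sgv (tb c) j - sgv b j = 0.
  move=> jl; rewrite he ?subrr //; have := ltn_ord j; have : (j : nat) <> n.-1 by move=> e'; case/eqP: jl; apply: val_inj.
  lia.
have := sum_eps_even hn k.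
have : 2 * \sum_j eps k j = sgv (tb c) l - sgv b l.
  transitivity (\sum_j (sgv (tb c) - sgv b) j).
    by rewrite mulr_sumr -hk; apply: eq_bigr => j _; rewrite [RHS]ffunE; ring.
  rewrite (bigD1 l) //= big1 ?addr0 => [|j jl]; first by rewrite !ffunE.
  by have := hl j jl; rewrite !ffunE.
have : b l <> tb c l.
  move=> e'; case/eqP: bt; apply/sgv_inj/ffunP => j; case: (eqVneq j l) => [->|/hl].
    by rewrite !ffunE; move: e'; rewrite ffunE => ->.
  by move/eqP; rewrite subr_eq0 => /eqP.
rewrite [sgv (tb c) l]ffunE [sgv b l]ffunE.
move: (\sum_j _) => s; case: (b l) (tb c l) => [] [] //=; lia.
Qed.

Definition hs (b b' : S) : Z := [ffun i => if b i == b' i then if b i then -1 else 1 else 0].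
Lemma hsE b b' : sgv b + sgv b' = hs b b' + hs b b'.
Proof. by apply/ffunP => i; rewrite !ffunE; case: (b i) (b' i) => [] []. Qed.
Lemma double_inj (x y : Z) : x + x = y + y -> x = y.
Proof.
move=> /ffunP h; apply/ffunP => j; have := h j; rewrite !ffunE => e.
by rewrite -[x j]half_double e half_double.
Qed.
Lemma hs_ru i b b' : hs (ru i b) (ru i b') = refl i (hs b b').
Proof. by apply: double_inj; rewrite -hsE !sgv_ru -!reflD hsE. Qed.

(** The half-spin character at [q^2]. Its weights [sgv b / 2] are not in [Z^n]; those of a product
    of two such characters are. *)
Definition chi c (t : Z) : F := \sum_(b | cl c b) qF ^ dot t (sgv b).
Lemma chi_mul c c' t : chi c t * chi c' t =
  \sum_(p : S * S | cl c p.1 && cl c' p.2) qF ^ (2 * dot t (hs p.1 p.2)).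
Proof.
rewrite /chi mulr_suml; under eq_bigr do rewrite mulr_sumr.
rewrite pair_big; apply: eq_bigr => p _ /=; rewrite -expfzDr // -dotDr hsE dotDr.
by congr (_ ^ _); ring.
Qed.
Lemma chi_inv c c' : inv_fun q (fun t => chi c t * chi c' t).
Proof.
exists [seq (1, hs p.1 p.2) | p : S * S <- enum [pred p : S * S | cl c p.1 && cl c' p.2]].
split=> [t|i k]; first by rewrite chi_mul /lau big_map big_enum_cond; apply: eq_big => [p|p _]; rewrite ?mul1r ?inE ?andbT.
rewrite /cf !big_map /= !big_enum_cond /=.
pose f (p : S * S) := (ru i p.1, ru i p.2).
have fK : involutive f by move=> [b b']; rewrite /f /= !ruK.
rewrite (reindex_inj (inv_inj fK)); apply: eq_bigl => -[b b'] /=.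
by rewrite !inE /= !cl_ru hs_ru (inj_eq (inv_inj (reflK i))).
Qed.
Lemma chi_lead c c' : lead q (fun t => chi c t * chi c' t) (hs (tb c) (tb c')).
Proof.
pose Q := [pred p : S * S | (cl c p.1 && cl c' p.2) && (p != (tb c, tb c'))].
exists [seq (1, hs p.1 p.2) | p <- enum Q]; split=> [t|p].
  rewrite chi_mul (bigD1 (tb c, tb c')) ?cl_top //=; congr (_ + _).
  by rewrite /lau big_map big_enum_cond; apply: eq_big => [p|p _]; rewrite ?mul1r ?inE ?andbT.
move=> /mapP [[b b']]; rewrite mem_enum => /andP [/andP [/= h1 h2] h3] -> /=.
have le d x : cl d x -> ht (sgv x) <= ht (sgv (tb d)).
  by move=> hx; case: (eqVneq x (tb d)) => [->//|/(cl_ht hx)/ltW].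
suff : ht (sgv b) + ht (sgv b') < ht (sgv (tb c)) + ht (sgv (tb c')) by rewrite -!htD !hsE !htD; lia.
move: h3; rewrite xpair_eqE negb_and => /orP [/(cl_ht h1) h|/(cl_ht h2) h].
  by apply: ltr_leD => //; apply: le.
by apply: ler_ltD => //; apply: le.
Qed.
End HalfSpin.

Section MEval.
Variables (F : fieldType) (A : algType F) (N : nat) (h : 'I_N -> A).
(* The commutation hypothesis is an argument so that the morphism instances can
   depend on it. *)
Definition mev of (forall i x, GRing.comm x (h i)) := mmap (in_alg A) h.
Variable hc : forall i x, GRing.comm x (h i).
Fact mev_zmod : zmod_morphism (mev hc).
Proof. by move=> x y; rewrite /mev raddfB. Qed.
HB.instance Definition _ := GRing.isZmodMorphism.Build _ _ (mev hc) mev_zmod.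
Fact mev_monoid : monoid_morphism (mev hc).
Proof.
have [h1 h2] : multiplicative (mmap (in_alg A) h).
  apply: commr_mmap_is_multiplicative => // p m m'.
  by rewrite /GRing.comm /= -scalerAl -scalerAr mul1r mulr1.
by split.
Qed.
HB.instance Definition _ := GRing.isMonoidMorphism.Build _ _ (mev hc) mev_monoid.
Fact mev_scal : scalable (mev hc).
Proof. by move=> c p; rewrite /mev mmapZ /= -scalerAl mul1r. Qed.
HB.instance Definition _ := GRing.isScalable.Build F _ _ _ (mev hc) mev_scal.
Definition mev_lrm : {lrmorphism {mpoly F[N]} -> A} := mev hc.
Lemma mev_lrmE p : mev_lrm p = mmap (in_alg A) h p. Proof. by []. Qed.
End MEval.

(** * Generators and relation *)

Section LeadIndep.
Variables (F : fieldType) (n : nat) (hn : (5 <= n)%N) (q : qpar F).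
Notation Z := ({ffun 'I_n -> int}).
Lemma seq_max_ex (T : eqType) (h : T -> int) (s : seq T) x : x \in s ->
  exists2 y, y \in s & forall z, z \in s -> h z <= h y.
Proof.
elim: s x => // x s IH y _; case: s IH => [|z s] IH.
  by exists x => [|u]; rewrite inE // => /eqP ->.
have [v vs hv] := IH z (mem_head z s); case: (leP (h v) (h x)) => hx.
  exists x => [|u]; first exact: mem_head.
  by rewrite inE => /orP [/eqP ->//|/hv hu]; apply: le_trans hu hx.
exists v => [|u]; first by rewrite inE vs orbT.
by rewrite inE => /orP [/eqP ->|/hv //]; apply: ltW.
Qed.

(** Among the indices with nonzero coefficient choose one whose leading weight has maximal height:
    no other term contains this weight, so it cannot cancel. *)
Lemma lead_indep (T : eqType) (s : seq T) (c : T -> F) (f : T -> Z -> F) (w : T -> Z) :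
  uniq s -> (forall m, m \in s -> lead q (f m) (w m)) -> {in s &, injective w} ->
  (forall t, \sum_(m <- s) c m * f m t = 0) -> forall m, m \in s -> c m = 0.
Proof.
move=> us hl hw h m ms; apply/eqP/negPn/negP => cm.
have /choice [rm hrm] : forall m, exists r : seq (F * Z), (m \in s ->
    (forall t, f m t = (q : F) ^ (2 * dot t (w m)) + lau q r t) /\
    forall p, p \in r -> ht p.2 < ht (w m)).
  move=> x; case: (boolP (x \in s)) => [xs|_]; last by exists [::].
  by have [r hr] := hl x xs; exists r.
have hm : m \in [seq m <- s | c m != 0] by rewrite mem_filter cm.
have [x] := seq_max_ex (fun m => ht (w m)) hm.
rewrite mem_filter => /andP [cx xs] hx.
pose r := flatten [seq [seq (c m * p.1, p.2) | p <- (1, w m) :: rm m] | m <- s].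
have r0 t : lau q r t = 0.
  rewrite -[RHS](h t) /lau big_flatten big_map big_seq [RHS]big_seq; apply: eq_bigr => y ys.
  have [-> _] := hrm y ys; rewrite big_map big_cons /= mulr1 mulrDr /lau mulr_sumr; congr (_ + _).
  by apply: eq_bigr => p _; rewrite mulrA.
have := lau_eq0 hn r0 (w x); rewrite /cf big_flatten big_map.
rewrite (bigD1_seq x) //= [X in _ + X = _ -> _]big1_seq ?addr0 => [|y /andP [yx ys]].
  rewrite big_cons big_map /= eqxx mulr1 [X in _ + X = _ -> _]big1_seq ?addr0 => [/eqP|p /andP [/eqP e ps]].
    by rewrite (negbTE cx).
  by have [_ /(_ p ps)] := hrm x xs; rewrite e ltxx.
rewrite big_cons big_map /= (inj_in_eq hw) // (negbTE yx).
case: (eqVneq (c y) 0) => [->|cy]; first by rewrite big1 // => p _; rewrite mul0r.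
rewrite big1_seq // => p /andP [/eqP e ps].
have [_ /(_ p ps)] := hrm y ys; rewrite e ltNge hx // mem_filter cy ys //.
Qed.
End LeadIndep.

Definition relF (F : fieldType) (n : nat) : {mpoly F[n.+1]} :=
  'X_(inord (n - 2)%N) * 'X_(inord n.-1) - 'X_(inord n) ^+ 2.

Section Reduction.
Variables (F : fieldType) (n : nat) (hn : (5 <= n)%N).
(** Division by the relation: the square of the last variable is traded for a product of two other
    variables, which lowers the exponent of the last one by two. *)
Lemma relF_reduce (p : {mpoly F[n.+1]}) : exists p0 g,
  p = p0 + g * relF F n /\ forall m, p0@_m != 0 -> (m ord_max <= 1)%N.
Proof.
have emax : inord n = ord_max :> 'I_n.+1 by apply: val_inj; rewrite /= inordK.
have na : (inord (n - 2) : 'I_n.+1) != ord_max by rewrite -val_eqE /= inordK; lia.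
have nb : (inord n.-1 : 'I_n.+1) != ord_max by rewrite -val_eqE /= inordK; lia.
elim/mpolyind: p => [|c m p _ _ [p0 [g [-> hp0]]]].
  by exists 0, 0; split=> [|m]; rewrite ?mul0r ?addr0 // mcoeff0 eqxx.
suff [x0 [y [-> hx0]]] : exists x0 y, 'X_[m] = x0 + y * relF F n /\
    forall m', x0@_m' != 0 -> (m' ord_max <= 1)%N.
  exists (c *: x0 + p0), (c *: y + g); split.
    by rewrite scalerDr mulrDl -scalerAl addrACA.
  move=> m' h; case: (eqVneq (x0@_m') 0) => [e|/hx0 //]; apply: hp0.
  by move: h; rewrite mcoeffD mcoeffZ e mulr0 add0r.
have [k] := ubnP (m ord_max); elim: k m => // k IH m hk.
case: (leqP (m ord_max) 1) => hm.
  exists 'X_[m], 0; split=> [|m']; first by rewrite mul0r addr0.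
  by rewrite mcoeffX; case: (eqVneq m m') => [<- //|]; rewrite eqxx.
pose m1 := (m - (U_(ord_max) *+ 2))%MM.
have mE : m = (m1 + (U_(ord_max) *+ 2))%MM.
  apply/mnmP => i; rewrite !(mnmDE, mnmBE, mulmnE, mnm1E); case: eqP => [<-|_]; lia.
have hlt : ((m1 + U_(inord (n - 2)) + U_(inord n.-1))%MM ord_max < k)%N.
  by rewrite !(mnmDE, mnmBE, mulmnE, mnm1E) (negbTE na) (negbTE nb) eqxx; lia.
have [x0 [y [e hx0]]] := IH _ hlt.
exists x0, (y - 'X_[m1]); split=> //.
have eX : 'X_[m1 + U_(inord (n - 2)) + U_(inord n.-1)] =
    'X_[m1] * ('X_(inord (n - 2)) * 'X_(inord n.-1)) :> {mpoly F[n.+1]} by rewrite !mpolyXD mulrA.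
rewrite mulrBl addrA -e eX mE mpolyXD -mpolyXn /relF emax; ring.
Qed.
End Reduction.

(** * Generators of the center and the kernel of the presentation *)

Section Main.
Variables (F : fieldType) (n : nat) (hn : (5 <= n)%N) (hodd : odd n) (q : qpar F).
Notation I := 'I_n.
Notation Z := ({ffun I -> int}).
Notation qF := (q : F).
Variables (A : algType F) (E G K L : I -> A) (HU : isU (gcmD hn) q E G K L).
Notation ev := (ev HU).
Notation cent := (cent E K).
Let e1 : (n.-1 < n - 2)%N = false. Proof. by lia. Qed.
Let e2 : (n.-1 == n - 2)%N = false. Proof. by lia. Qed.
Let e3 : (n - 2 == n.-1)%N = false. Proof. by lia. Qed.
Let e4 : (n < n - 2)%N = false. Proof. by lia. Qed.
Let e5 : (n - 2 == n)%N = false. Proof. by lia. Qed.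
Let e6 : (n.-1 == n)%N = false. Proof. by lia. Qed.
Let e7 : (n - 2).+1 = n.-1. Proof. by lia. Qed.
Let e8 : (n - 2 <= n.-1)%N = true. Proof. by lia. Qed.

(** Fundamental weights for [k < n - 2], then twice each of the two half-spin weights, and for
    [k = n] the sum of the two. *)
Definition gen_wt (k : nat) : Z := if (k < n)%N then dl n k else hs (tb n false) (tb n true).
Lemma sgv_tb c : sgv (tb n c) = dl n (if c then n - 2 else n.-1)%N.
Proof.
apply/ffunP => j; rewrite !ffunE /dlf; have hj := ltn_ord j.
case: c => /=.
  by rewrite ltnn eqxx /=; case: eqP.
by rewrite e1 e2.
Qed.
Lemma dot_gen_wt k (i : I) : (k <= n)%N -> dot (gen_wt k) (al i) =
  if (k < n)%N then dlc n k * (k == i)%:Z else (n - 2 <= i)%N%:Z.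
Proof.
move=> hk; rewrite /gen_wt; case: ltnP => h; first by rewrite dot_dl.
have : dot (sgv (tb n false) + sgv (tb n true)) (al i) = 2 * (n - 2 <= i)%N%:Z.
  rewrite !sgv_tb dotDl !dot_dl //; try lia.
  have hi := ltn_ord i; rewrite /dlc ltnn e1.
  case: (eqVneq n.-1 i) => h1; case: (eqVneq (n - 2)%N i) => h2 /=; lia.
by rewrite hsE dotDl; move: (dot _ _) => x; lia.
Qed.

Definition mon_wt (m : 'X_{1..n.+1}) : Z := \sum_(k < n.+1) gen_wt k *+ m k.
Lemma dot_mon_wt m (i : I) : dot (mon_wt m) (al i) =
  dlc n i * (m (widen_ord (leqnSn n) i))%:Z + (n - 2 <= i)%N%:Z * (m ord_max)%:Z.
Proof.
have d0 : dot 0 (al i) = 0 by rewrite /dot big1 // => j _; rewrite ffunE mul0r.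
have dM x k : dot (x *+ k) (al i) = k%:Z * dot x (al i).
  by elim: k => [|k IH]; rewrite ?mulr0n ?d0 ?mul0r // mulrS dotDl IH; lia.
rewrite /mon_wt (big_morph _ (fun x y => dotDl x y (al i)) d0).
under eq_bigr => k _ do rewrite dM (dot_gen_wt _ (leq_ord k)).
rewrite big_ord_recr /= ltnn; congr (_ + _); last by rewrite mulrC.
rewrite (bigD1 i) //= ltn_ord eqxx mulr1 big1 ?addr0 => [|k ki]; first by rewrite mulrC.
by rewrite ltn_ord [(_ == _ :> nat)](inj_eq val_inj) (negbTE ki) !mulr0.
Qed.
(** The label at the last node is twice an exponent plus [m ord_max], so its parity determines
    [m ord_max]; the labels then determine the other exponents. *)
Lemma mon_wt_inj (m m' : 'X_{1..n.+1}) : (m ord_max <= 1)%N -> (m' ord_max <= 1)%N ->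
  mon_wt m = mon_wt m' -> m = m'.
Proof.
move=> h1 h2 e.
have ei (i : I) : dlc n i * (m (widen_ord (leqnSn n) i))%:Z + (n - 2 <= i)%N%:Z * (m ord_max)%:Z =
    dlc n i * (m' (widen_ord (leqnSn n) i))%:Z + (n - 2 <= i)%N%:Z * (m' ord_max)%:Z.
  by rewrite -!dot_mon_wt e.
have emax : m ord_max = m' ord_max.
  have hi : (n.-1 < n)%N by lia.
  have := ei (Ordinal hi); rewrite /= /dlc e1 e8.
  move: h1 h2; move: (m _) (m' _) (m _) (m' _) => a b c d; lia.
apply/mnmP => k; case: (ltnP k n) => hk; last first.
  by have -> : k = ord_max by apply: val_inj => /=; have := ltn_ord k; lia.
have -> : k = widen_ord (leqnSn n) (Ordinal hk) by apply: val_inj.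
have := ei (Ordinal hk); rewrite emax /dlc; case: ifP; move: (m _) (m' _) => a b; lia.
Qed.
(** For [l] in [Z^n] the labels at the last two nodes differ by twice a coordinate, so they have the
    same parity. This parity is the exponent of the last variable, and their integer halves are the
    exponents of the two variables before it. *)
Lemma dominant_mon_wt l : dominant l -> exists m, mon_wt m = l.
Proof.
move=> hl; pose d k := absz (if insub k is Some i then dot l (al i) else 0).
have dE (i : I) : dot l (al i) = (d i)%:Z by rewrite /d valK; have := hl i; lia.
exists [multinom (if (k < n - 2)%N then d k else if (k < n)%N then ((d k) %/ 2)%N else odd (d n.-1) : nat) | k < n.+1].
apply/eqP; rewrite -subr_eq0; apply/eqP/(dot_al_eq0 hn) => i.
rewrite dotDl dotNl dot_mon_wt !mnmE dE /= ltnn e4.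
have hi := ltn_ord i; rewrite /dlc hi; case: ltnP => h; first by lia.
have h1 : (n.-1 < n)%N by lia.
have h2 : (n - 2 < n)%N by lia.
have := dE (Ordinal h1); have := dE (Ordinal h2); rewrite !dot_al //= eqxx.
rewrite e3 e7.
move: (nv _ _) (nv _ _) => x y g2 g1.
have : odd (d n.-1) = odd (d (n - 2)%N) by lia.
have : (i : nat) = n.-1 \/ (i : nat) = (n - 2)%N by lia.
case=> -> e; rewrite ?e; lia.
Qed.

(** For the first generators a prescribed leading weight is enough. The last three have to be exact
    products of half-spin characters, which [ev_surj] provides; the relation then holds because it
    holds after evaluation. *)
Lemma generators_ex : exists z : 'I_n.+1 -> A, [/\ forall k, cent (z k),
  forall k, lead q (ev (z k)) (gen_wt k) &
  z (inord (n - 2)) * z (inord n.-1) = z (inord n) ^+ 2].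
Proof.
(* Index [n] is the mixed product and [n.-1] the square for the top weight [tb n false]; the default
   is meant for [n - 2]. *)
pose cc (k : nat) := if k == n then (false, true) else if k == n.-1 then (false, false) else (true, true).
have /choice [z hz] : forall k : 'I_n.+1, exists z, (cent z /\ lead q (ev z) (gen_wt k) /\
    ((n - 2 <= k)%N -> forall t, ev z t = chi q (cc k).1 t * chi q (cc k).2 t)).
  move=> k.
  case: (leqP (n - 2) k) => hk; last first.
    have hd : dominant (gen_wt k).
      move=> i; rewrite dot_gen_wt; last exact: leq_ord.
      by rewrite /dlc; case: (k < n)%N => //; case: (k < n - 2)%N; lia.
    have [z cz lz] := ev_lead HU hd.
    by exists z; split=> //; split=> //; rewrite leqNgt hk.
  have [z cz hz] := ev_surj HU hodd (chi_inv hn q (cc k).1 (cc k).2).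
  exists z; split=> //; split=> //.
  have -> : ev z = fun t => chi q (cc k).1 t * chi q (cc k).2 t by apply/funext.
  suff -> : gen_wt k = hs (tb n (cc k).1) (tb n (cc k).2) by apply: chi_lead.
  have hsd c : hs (tb n c) (tb n c) = sgv (tb n c).
    by apply: double_inj; rewrite -hsE.
  have := ltn_ord k; rewrite ltnS /gen_wt /cc => hk'.
  case: (eqVneq (k : nat) n) => [->|h1]; first by rewrite ltnn.
  have -> : (k < n)%N = true by lia.
  case: (eqVneq (k : nat) n.-1) => [->|h2] /=; rewrite hsd sgv_tb //.
  by congr dl; lia.
exists z; split=> [k|k|]; [by case: (hz k) | by case: (hz k) => _ [] |].
have c k : cent (z k) by case: (hz k).
have e k (hk : (k < n.+1)%N) : (n - 2 <= k)%N -> forall t,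
    ev (z (inord k)) t = chi q (cc k).1 t * chi q (cc k).2 t.
  by case: (hz (inord k)) => _ [_]; rewrite inordK.
apply/eqP; rewrite -subr_eq0; apply/eqP; rewrite expr2 -[_ - _]addrC -scaleN1r.
apply: (ev_eq0 (HU := HU)) => [|t]; first by apply: cent_lin; apply: cent_mul.
rewrite ev_lin !ev_mul // !e; try lia.
rewrite /cc eqxx e5 e3 e6 eqxx /=.
ring.
Qed.

Theorem center_typeD : exists phi : {lrmorphism {mpoly F[n.+1]} -> A},
  (forall z : A, central z <-> exists p, phi p = z) /\
  (forall p, phi p = 0 <-> exists g, p = g * relF F n).
Proof.
have [z [cz lz hz]] := generators_ex.
have hc i x : GRing.comm x (z i) by rewrite /GRing.comm (cent_central HU (cz i)).
pose phi := mev_lrm hc; exists phi.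
have lead1 : lead q (ev 1) 0.
  have -> : ev 1 = fun=> 1 by apply/funext => t; apply: ev_one.
  exact: lead_one.
have mon m : cent (mmap1 z m) /\ lead q (ev (mmap1 z m)) (mon_wt m).
  rewrite /mmap1 /mon_wt; elim/big_rec2: _ => [|k w x _ [cx lx]].
    split; first exact: cent_one.
    exact: lead1.
  have [cp lp] : cent (z k ^+ m k) /\ lead q (ev (z k ^+ m k)) (gen_wt k *+ m k).
    elim: (m k) => [|l [cl ll]].
      split; first exact: cent_one.
      exact: lead1.
    rewrite exprS mulrS; split; first exact: cent_mul.
    have -> : ev (z k * z k ^+ l) = fun t => ev (z k) t * ev (z k ^+ l) t.
      by apply/funext => t; apply: ev_mul.
    exact: lead_mul.
  split; first exact: cent_mul.
  have -> : ev (z k ^+ m k * x) = fun t => ev (z k ^+ m k) t * ev x t.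
    by apply/funext => t; apply: ev_mul.
  exact: lead_mul.
have phiX m : phi 'X_[m] = mmap1 z m by rewrite /phi mev_lrmE mmapX.
have phi_lin c x y : phi (c *: x + y) = c *: phi x + phi y by rewrite linearP.
have phi0 : phi 0 = 0 by rewrite raddf0.
have phiM x y : phi (x * y) = phi x * phi y by rewrite rmorphM.
have phiD x y : phi (x + y) = phi x + phi y by rewrite rmorphD.
have cphi p : cent (phi p).
  elim/mpolyind: p => [|c m p _ _ hp]; first by rewrite phi0; split=> i; rewrite mulr0 mul0r.
  by rewrite phi_lin; apply: cent_lin => //; rewrite phiX; case: (mon m).
have cB x y : cent x -> cent y -> cent (x - y).
  by move=> hx hy; rewrite addrC -scaleN1r; apply: cent_lin.
have evB x y t : ev (x - y) t = ev x t - ev y t.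
  by rewrite addrC -scaleN1r ev_lin mulN1r addrC.
have phi_rel : phi (relF F n) = 0.
  by rewrite /relF expr2 addrC -scaleN1r phi_lin !phiM !phiX !mmap1U hz expr2 scaleN1r addNr.
split=> [x|p]; split.
- move=> hx; have cx : cent x by split=> i; rewrite hx.
  suff h f : inv_fun q f -> exists p, forall t, ev (phi p) t = f t.
    have [p hp] := h _ (ev_inv HU hodd cx).
    exists p; apply/eqP; rewrite -subr_eq0; apply/eqP/(ev_eq0 (HU := HU)); first exact: cB.
    by move=> t; rewrite evB hp subrr.
  move: f; apply: (inv_ind hn (P := fun f => exists p, forall t, ev (phi p) t = f t)).
  + by exists 0 => t; rewrite phi0 ev_zero.
  + by move=> c f g [p hp] [p' hp']; exists (c *: p + p') => t; rewrite phi_lin ev_lin hp hp'.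
  move=> l /dominant_mon_wt [m <-]; have [cm lm] := mon m.
  by exists (ev (mmap1 z m)); split=> //; [apply: ev_inv | exists 'X_[m] => t; rewrite phiX].
- by move=> [p <-] u; apply: (cent_central HU).
- have [p0 [g [-> hp0]]] := relF_reduce hn p.
  rewrite phiD phiM phi_rel mulr0 addr0 => h0; exists g; rewrite -[RHS]add0r; congr (_ + _).
  apply/mpolyP => m; rewrite mcoeff0; case: (boolP (m \in msupp p0)) => [hm|]; last first.
    by rewrite mcoeff_msupp negbK => /eqP.
  apply: (@lead_indep F n hn q _ (msupp p0) (fun m => p0@_m) (fun m => ev (mmap1 z m)) mon_wt) => //.
  + by move=> m' _; case: (mon m').
  + move=> m1 m2; rewrite !mcoeff_msupp => /hp0 h1 /hp0 h2; exact: mon_wt_inj.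
  move=> t; transitivity (ev (phi p0) t); last by rewrite h0 ev_zero.
  rewrite /phi mev_lrmE /mmap; elim: (msupp p0) => [|m' s IH]; first by rewrite !big_nil ev_zero.
  by rewrite !big_cons IH /= -scalerAl mul1r ev_lin.
by move=> [g ->]; rewrite phiM phi_rel mulr0.
Qed.
End Main.

(** * The quantum group over C(q) *)

Section Presentations.
Variables (F : fieldType) (n : nat) (hn : (5 <= n)%N) (q : qpar F).
Notation I := 'I_n.
Notation qF := (q : F).
Let q0 := q_neq0 q.

Lemma qint1 : qint qF 1 = 1.
Proof. by rewrite /qint expr1z divff // qqV_neq0. Qed.
Lemma qint2 : qint qF 2 = qF + qF^-1.
Proof.
have q1 : qF * qF - 1 != 0 by rewrite -expr2 q2_neq1.
rewrite /qint -invr_expz -[qF ^ 2%:Z]/(qF ^+ 2); field; by rewrite q0 q1.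
Qed.
Lemma qfact0 : qfact qF 0 = 1. Proof. by rewrite /qfact big_geq. Qed.
Lemma qfact1 : qfact qF 1 = 1. Proof. by rewrite /qfact big_nat1 qint1. Qed.
Lemma qfact2 : qfact qF 2 = qF + qF^-1.
Proof. by rewrite /qfact big_nat_recr //= big_nat1 qint1 qint2 mul1r. Qed.
(** Otherwise [q^2 = -1] and [q^4 = 1]. The q-binomials in the Serre relations divide by this
    number. *)
Lemma qq_sum_neq0 : qF + qF^-1 != 0.
Proof.
apply/negP => /eqP h; have : qF ^+ 4 = 1.
  have : qF ^+ 2 = -1.
    have := congr1 ( *%R qF) h; rewrite mulrDr divff // mulr0 => /eqP.
    by rewrite addr_eq0 => /eqP.
  by move=> e; rewrite (exprM _ 2 2) e sqrrN expr1n.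
by apply/eqP/q_nroot.
Qed.

Lemma serre_sum (B : algType F) (X : I -> B) i j : i != j ->
  let m := absz (1 - cartanD i j) in
  \sum_(s < m.+1) ((-1) ^+ s * qbinom (qF ^+ 1) m s) *: (X i ^+ (m - s) * X j * X i ^+ s) =
  if cartanD i j == 0 then X i * X j - X j * X i
  else X i * X i * X j - (qF + qF^-1) *: (X i * X j * X i) + X j * X i * X i.
Proof.
move=> ij; have h2 := qq_sum_neq0; case: (cartanD_off ij) => -> /=.
  rewrite !big_ord_recl big_ord0 /bump /= addr0 !expr1 /qbinom subnn subn0 qfact0 qfact1.
  by rewrite !(expr0, mul1r, mulr1, invr1, scale1r, scaleN1r).
rewrite !big_ord_recl big_ord0 /bump /= addr0 !expr1 /qbinom /= subnn subn0 subSS subn0.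
rewrite qfact0 qfact1 qfact2 !(expr0, mul1r, mulr1, invr1, scale1r) divff // sqrrN expr1n.
by rewrite !(mulr1, scale1r) !expr2 mulN1r scaleNr mulrA addrA.
Qed.

Lemma uqE (B : algType F) (E G K L : I -> B) :
  Uq_rels (@cartanD n) (fun=> 1%N) qF E G K L <-> urel (gcmD hn) q E G K L.
Proof.
have sw (X : I -> B) i j c : (forall i, K i * L i = 1 /\ L i * K i = 1) ->
    K i * X j * L i = c *: X j <-> K i * X j = c *: (X j * K i).
  move=> h; split=> e; have [h1 h2] := h i.
    by rewrite scalerAl -e -[_ * L i * K i]mulrA h2 mulr1.
  by rewrite e -scalerAl -mulrA h1 mulr1.
have s1 (X : I -> B) : serre (gcmD hn) q X <-> forall i j, i != j ->
   let m := absz (1 - cartanD i j) in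
   \sum_(s < m.+1) ((-1) ^+ s * qbinom (qF ^+ 1) m s) *: (X i ^+ (m - s) * X j * X i ^+ s) = 0.
  split=> h i j ij.
    apply: (etrans (serre_sum X ij)); have [h0 h1] := h i j ij.
    by case: (cartanD_off ij) => e; rewrite e /=; [rewrite h0 // subrr | apply: h1].
  have := etrans (esym (serre_sum X ij)) (h i j ij); case: (cartanD_off ij) => e; rewrite /= e /= => e'; split=> // _.
  by apply/eqP; rewrite -subr_eq0 e'.
split=> [[kk [kl [ke [kg [eg [se sg]]]]]]|[[kl lk kk ke kg eg] se sg]].
  split; [split | exact/s1 | exact/s1] => //.
  - by move=> i; case: (kl i).
  - by move=> i; case: (kl i).
  - by move=> i j; apply/sw.
  - by move=> i j; apply/sw.
have kl' i : K i * L i = 1 /\ L i * K i = 1 by [].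
split=> //; split=> //; split; first by move=> i j; apply/sw.
split; first by move=> i j; apply/sw.
by split=> //; split; apply/s1.
Qed.

Lemma is_Uq_isU (A : algType F) (E G K L : I -> A) :
  is_Uq (@cartanD n) (fun=> 1%N) qF E G K L -> isU (gcmD hn) q E G K L.
Proof.
move=> [/uqE hr hu]; split=> // B E' G' K' L' /uqE; exact: hu.
Qed.
End Presentations.

Lemma qq_neq0 : qq != 0.
Proof. by rewrite /qq tofrac_eq0 polyX_eq0. Qed.
Lemma qq_nroot k : (0 < k)%N -> qq ^+ k != 1.
Proof.
move=> k0; rewrite /qq -rmorphXn -(rmorph1 (@tofrac {poly CC})) tofrac_eq.
apply/eqP => /(congr1 (fun p : {poly CC} => size p)); rewrite size_polyXn size_poly1 => [[e]].
by rewrite e in k0.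
Qed.
Lemma Cq_char0 k : (k.+1)%:R != 0 :> Cq.
Proof.
rewrite -(rmorph_nat (@tofrac {poly CC})) tofrac_eq0 -polyC_natr polyC_eq0.
have h : (k.+1)%:R != 0 :> (Rdefinitions.R)[i] by rewrite pnatr_eq0.
exact: h.
Qed.
Definition qqpar : qpar Cq := Qpar qq_neq0 qq_nroot Cq_char0.

(* Z(U_q(D_n)) ~= C(q)[t_1..t_{n+1}]/(t_{n-1} t_n - t_{n+1}^2) for n >= 5 odd,
   expressed as: there is a C(q)-algebra morphism phi from the polynomial ring
   onto Z(U_q) whose kernel is the principal ideal (relD n). *)
Theorem theorem4p1 (n : nat) (hn : (5 <= n)%N) (hodd : odd n)
    (A : algType Cq) (E Fg K Kinv : 'I_n -> A)
    (HU : is_Uq (@cartanD n) (fun _ => 1%N) qq E Fg K Kinv) :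
  exists phi : {lrmorphism {mpoly Cq[n.+1]} -> A},
    (forall z : A, central z <-> exists p, phi p = z) /\
    (forall p, phi p = 0 <-> exists g, p = g * relD n).
Proof. exact: (center_typeD hodd (is_Uq_isU hn (q := qqpar) HU)). Qed.
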